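(* Let $\mu>0$, and for $H\in(0,1)\cup(1,\infty)$ consider the canonical zero-divergence system $Z=(X,Y)$ with parameters $(\mu,H)$. Let $t_{\mathrm g}(\mu)\in(\pi,2\pi)$ denote the solution of $\frac{\cos t-e^{-\mu t}}{\sin t}=\mu$, and set $$H_{\mathrm g}(\mu)=e^{-2\mu t_{\mathrm g}(\mu)},\qquad H_{\mathrm{crit}}(\mu)=\frac{1}{2\cosh(\pi\mu)-1},\qquad \mathcal I_\mu=\bigl(H_{\mathrm g}(\mu),H_{\mathrm{crit}}(\mu)\bigr),$$ $\zeta_\mu=\frac1{1+\mu^2}$, $\beta_\mu=\frac{2\mu}{1+\mu^2}$. (a) For $t\in(\pi,t_{\mathrm g}(\mu))$ define $$y_0(t)=\zeta_\mu\Bigl(\frac{\cos t-e^{-\mu t}}{\sin t}-\mu\Bigr),\qquad x_0(t)=\zeta_\mu\Bigl(\mu-\frac{e^{\mu t}-\cos t}{\sin t}\Bigr),$$ $$\eta(t)=\frac{x_0(t)y_0(t)+\zeta_\mu}{x_0(t)^2+y_0(t)^2-x_0(t)y_0(t)-\beta_\mu(x_0(t)-y_0(t))+\zeta_\mu}.$$ Then $\eta:(\pi,t_{\mathrm g}(\mu))\to\mathcal I_\mu$ is a strictly decreasing bijection. The map $t\mapsto p_0(t)=(x_0(t),y_0(t),0)$ parametrizes a curve of crossing points in $\Sigma$. The trajectory from $p_0(t)$ is a crossing periodic orbit of simple period if and only if $H=\eta(t)$; in that case it returns to $\Sigma$ at $S(p_0(t))$ and its period is $2t$. For each $H\in\mathcal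 I_\mu$ this orbit is the unique crossing periodic orbit of simple period. No crossing periodic orbit of simple period exists when $H\notin\mathcal I_\mu$. Denote the orbit so obtained by $\gamma_{(\mu,H)}$. (b) Let $F=S\circ\Pi_X$. For every $H\in\mathcal I_\mu$ let $t=\eta^{-1}(H)$, $N(t)=DF(p_0(t))$, and let $\lambda_1(t),\lambda_2(t)$ be the roots of the characteristic polynomial of $N(t)$. Then the two nontrivial Floquet multipliers of $\gamma_{(\mu,H)}$ are $\mu_j=\lambda_j(t)^2$, $j=1,2$, and both have modulus strictly smaller than $1$. Hence $\gamma_{(\mu,H)}$ is isolated among the periodic orbits of $Z$, hyperbolic, and orbitally asymptotically stable.
   Context: Let $f(x,y,z)=z$, $\Sigma=\{z=0\}\subset\mathbb R^3$, $S(x,y,z)=(-y,-x,-z)$. For $\mu>0$ and $H\in(0,1)\cup(1,\infty)$, the canonical zero-divergence system $Z=(X,Y)$ with parameters $(\mu,H)$ is the piecewise-linear Filippov system equal to $X$ on $\{z\ge0\}$ and to $Y=S\circ X\circ S$ on $\{z<0\}$, where $$X(x,y,z)=\bigl(-2\mu x-H(9\mu^2+1)z+H,\ 2\mu y-(1+\mu^2)z+1,\ y\bigr),$$ $$Y(x,y,z)=\bigl(2\mu x-(1+\mu^2)z-1,\ -2\mu y-H(9\mu^2+1)z-H,\ x\bigr).$$ Write $Xf=\langle X,\nabla f\rangle$, $Yf=\langle Y,\nabla f\rangle$; on $\Sigma$, $Xf=y$ and $Yf=x$. The crossing region is $\Sigma^{\rm c}=\{p\in\Sigma: Xf(p)Yf(p)>0\}=\{(x,y,0):xy>0\}$.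 A crossing trajectory follows the flow of $X$ in $z>0$ and of $Y$ in $z<0$; at a point of $\Sigma^{\rm c}$ the incoming and outgoing arcs are concatenated. An orbit is the image of such a maximal trajectory; a nonconstant orbit defined for all times is periodic if the trajectory is $T$-periodic for some $T>0$, and its period is the least such $T$. A periodic orbit $\gamma$ is a crossing periodic orbit if $\varnothing\ne\gamma\cap\Sigma\subset\Sigma^{\rm c}$, and it has simple period if moreover $\gamma\cap\Sigma$ consists of exactly two distinct points. For $p=(x_0,y_0,0)$ with $y_0\ge0$, $\Pi_X(p)\in\Sigma$ is the point at which the $X$-trajectory issued from $p$ returns to $\Sigma$ for the first time at a positive time (it lies in $z>0$ in between; this first return exists). Points of $\Sigma$ are identified with $(x,y)\in\mathbb R^2$. The nontrivial Floquet multipliers of a crossing periodic orbit of simple period are the eigenvalues of the derivative, at its crossing point, of the Poincaré return map on $\Sigma$; the orbit is hyperbolic if none of them lies on the unit circle. *)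

(* Defs.v *)
From Stdlib Require Import Reals Lra ClassicalEpsilon.
From Coquelicot Require Import Coquelicot.
Open Scope R_scope.

Definition R2 : Type := R * R.
Definition R3 : Type := R * R * R.

Definition xc (p : R3) : R := fst (fst p).
Definition yc (p : R3) : R := snd (fst p).
Definition zc (p : R3) : R := snd p.

Definition Sinv (p : R3) : R3 := (- yc p, - xc p, - zc p).

Definition X (mu H : R) (p : R3) : R3 :=
  (- 2 * mu * xc p - H * (9 * mu ^ 2 + 1) * zc p + H,
   2 * mu * yc p - (1 + mu ^ 2) * zc p + 1,
   yc p).

Definition Y (mu H : R) (p : R3) : R3 := Sinv (X mu H (Sinv p)).

Lemma Y_explicit (mu H x y z : R) :
  Y mu H (x, y, z) =
  (2 * mu * x - (1 + mu ^ 2) * z - 1,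
   - 2 * mu * y - H * (9 * mu ^ 2 + 1) * z - H,
   x).
Proof.
unfold Y, X, Sinv, xc, yc, zc; simpl.
apply f_equal2; [apply f_equal2 |]; ring.
Qed.

Definition Sigma (p : R3) : Prop := zc p = 0.

(* Since f(x,y,z) = z, the Lie derivative along a field is its third component. *)
Definition Xf (mu H : R) (p : R3) : R := zc (X mu H p).
Definition Yf (mu H : R) (p : R3) : R := zc (Y mu H p).

Definition Sigma_c (mu H : R) (p : R3) : Prop :=
  Sigma p /\ Xf mu H p * Yf mu H p > 0.

Definition emb (q : R2) : R3 := (fst q, snd q, 0).

(* [v] is the derivative of [g] at [t] relative to the time interval [I]
   (one-sided at an end point of [I]). *)
Definition derive_within (I : R -> Prop) (g : R -> R3) (t : R) (v : R3) : Prop :=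
  @filterdiff R_AbsRing R_NormedModule
    (prod_NormedModule R_AbsRing
       (prod_NormedModule R_AbsRing R_NormedModule R_NormedModule) R_NormedModule)
    g (within I (locally t))
    (fun h => (h * xc v, h * yc v, h * zc v)).

(* Both clauses on Sigma are relative to [I], so that an end point of [I] may
   lie on Sigma.  At a crossing point with Xf, Yf > 0 the incoming arc is in
   z < 0 and the outgoing one in z > 0; when Xf, Yf < 0 it is the reverse. *)
Definition crossing_trajectory_on (mu H : R) (I : R -> Prop) (g : R -> R3) : Prop :=
  forall t, I t ->
    filterlim g (within I (locally t)) (locally (g t)) /\
    (zc (g t) > 0 -> derive_within I g t (X mu H (g t))) /\
    (zc (g t) < 0 -> derive_within I g t (Y mu H (g t))) /\
    (zc (g t) = 0 ->
       Sigma_c mu H (g t) /\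
       (Xf mu H (g t) > 0 ->
          within I (locally t)
            (fun s => (s < t -> zc (g s) < 0) /\ (t < s -> zc (g s) > 0))) /\
       (Xf mu H (g t) < 0 ->
          within I (locally t)
            (fun s => (s < t -> zc (g s) > 0) /\ (t < s -> zc (g s) < 0)))).

(* Being defined for all times, such a trajectory is maximal. *)
Definition trajectory (mu H : R) (g : R -> R3) : Prop :=
  crossing_trajectory_on mu H (fun _ => True) g.

Definition forward_trajectory (mu H : R) (g : R -> R3) : Prop :=
  crossing_trajectory_on mu H (fun t => 0 <= t) g.

Definition orbit (g : R -> R3) : R3 -> Prop := fun p => exists t, g t = p.

Definition same_set (A B : R3 -> Prop) : Prop := forall p, A p <-> B p.

Definition periodic_with (T : R) (g : R -> R3) : Prop :=
  forall t, g (t + T) = g t.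

Definition least_period (g : R -> R3) (T : R) : Prop :=
  0 < T /\ periodic_with T g /\
  (forall T', 0 < T' -> periodic_with T' g -> T <= T').

Definition periodic_orbit (mu H : R) (gam : R3 -> Prop) : Prop :=
  exists g, trajectory mu H g /\ (exists s t, g s <> g t) /\
    (exists T, 0 < T /\ periodic_with T g) /\ same_set gam (orbit g).

Definition crossing_periodic_orbit (mu H : R) (gam : R3 -> Prop) : Prop :=
  periodic_orbit mu H gam /\
  (exists p, gam p /\ Sigma p) /\
  (forall p, gam p -> Sigma p -> Sigma_c mu H p).

Definition simple_crossing_periodic_orbit (mu H : R) (gam : R3 -> Prop) : Prop :=
  crossing_periodic_orbit mu H gam /\
  exists p q, p <> q /\ forall r, (gam r /\ Sigma r) <-> (r = p \/ r = q).

Definition first_return_X (mu H : R) (p q : R2) : Prop :=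
  exists (g : R -> R3) (tau : R),
    (forall t, derive_within (fun _ => True) g t (X mu H (g t))) /\
    g 0 = emb p /\ 0 < tau /\ g tau = emb q /\
    (forall s, 0 < s < tau -> zc (g s) > 0).

(* Arbitrary at the points with y < 0, where Pi_X is undefined. *)
Definition Pi_X (mu H : R) (p : R2) : R2 :=
  epsilon (inhabits (0, 0)) (first_return_X mu H p).

Definition S_Sigma (q : R2) : R2 := (- snd q, - fst q).

Definition F (mu H : R) (p : R2) : R2 := S_Sigma (Pi_X mu H p).

(* A trajectory that leaves a crossing point first meets Sigma on the other
   component of the crossing region; the return to a neighbourhood of the
   starting point is the second meeting with Sigma. *)
Definition poincare_return (mu H : R) (p q : R2) : Prop :=
  exists (g : R -> R3) (t1 t2 : R),
    0 < t1 < t2 /\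
    crossing_trajectory_on mu H (fun t => 0 <= t <= t2) g /\
    g 0 = emb p /\ Sigma (g t1) /\ g t2 = emb q /\
    (forall s, 0 < s < t2 -> s <> t1 -> ~ Sigma (g s)).

(* Arbitrary at the points that do not return. *)
Definition poincare_map (mu H : R) (p : R2) : R2 :=
  epsilon (inhabits (0, 0)) (poincare_return mu H p).

Definition is_differential (f : R2 -> R2) (p : R2) (L : R2 -> R2) : Prop :=
  @filterdiff R_AbsRing
    (prod_NormedModule R_AbsRing R_NormedModule R_NormedModule)
    (prod_NormedModule R_AbsRing R_NormedModule R_NormedModule)
    f (locally p) L.

(* Characteristic polynomial of the matrix of [L] in the canonical basis. *)
Definition charpoly (L : R2 -> R2) (z : C) : C :=
  ((z - RtoC (fst (L (1, 0)%R))) * (z - RtoC (snd (L (0, 1)%R)))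
   - RtoC (fst (L (0, 1)%R)) * RtoC (snd (L (1, 0)%R)))%C.

(* The complex roots counted with multiplicity. *)
Definition charpoly_roots (L : R2 -> R2) (l1 l2 : C) : Prop :=
  forall z : C, charpoly L z = ((z - l1) * (z - l2))%C.

(* The requirement is imposed at each of the two crossing points. *)
Definition floquet_multipliers (mu H : R) (gam : R3 -> Prop) (m1 m2 : C) : Prop :=
  simple_crossing_periodic_orbit mu H gam /\
  forall p : R2, gam (emb p) ->
    exists L, is_differential (poincare_map mu H) p L /\ charpoly_roots L m1 m2.

Definition hyperbolic (mu H : R) (gam : R3 -> Prop) : Prop :=
  exists m1 m2 : C,
    floquet_multipliers mu H gam m1 m2 /\ Cmod m1 <> 1 /\ Cmod m2 <> 1.

(* [p] is at distance less than [eps] (in the sup norm) from a point of [gam]. *)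
Definition near_set (gam : R3 -> Prop) (eps : R) (p : R3) : Prop :=
  exists q, gam q /\
    Rabs (xc p - xc q) < eps /\ Rabs (yc p - yc q) < eps /\ Rabs (zc p - zc q) < eps.

Definition isolated_periodic_orbit (mu H : R) (gam : R3 -> Prop) : Prop :=
  exists eps, 0 < eps /\
    forall gam', periodic_orbit mu H gam' ->
      (forall p, gam' p -> near_set gam eps p) -> same_set gam' gam.

Definition orbitally_stable (mu H : R) (gam : R3 -> Prop) : Prop :=
  forall eps, 0 < eps -> exists delta, 0 < delta /\
    forall p, near_set gam delta p ->
      (exists g, forward_trajectory mu H g /\ g 0 = p) /\
      (forall g, forward_trajectory mu H g -> g 0 = p ->
         forall t, 0 <= t -> near_set gam eps (g t)).

Definition orbitally_attracting (mu H : R) (gam : R3 -> Prop) : Prop :=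
  exists delta, 0 < delta /\
    forall p, near_set gam delta p ->
      forall g, forward_trajectory mu H g -> g 0 = p ->
        forall eps, 0 < eps -> exists T, forall t, T <= t -> 0 <= t ->
          near_set gam eps (g t).

Definition orbitally_asymptotically_stable (mu H : R) (gam : R3 -> Prop) : Prop :=
  orbitally_stable mu H gam /\ orbitally_attracting mu H gam.

Definition is_t_g (mu t : R) : Prop :=
  PI < t < 2 * PI /\ (cos t - exp (- mu * t)) / sin t = mu.

Definition H_g (mu tg : R) : R := exp (- 2 * mu * tg).
Definition H_crit (mu : R) : R := 1 / (2 * cosh (PI * mu) - 1).
Definition I_mu (mu tg H : R) : Prop := H_g mu tg < H < H_crit mu.

Definition zeta (mu : R) : R := 1 / (1 + mu ^ 2).
Definition beta (mu : R) : R := 2 * mu / (1 + mu ^ 2).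

Definition y0 (mu t : R) : R :=
  zeta mu * ((cos t - exp (- mu * t)) / sin t - mu).
Definition x0 (mu t : R) : R :=
  zeta mu * (mu - (exp (mu * t) - cos t) / sin t).
Definition p0 (mu t : R) : R2 := (x0 mu t, y0 mu t).

Definition eta (mu t : R) : R :=
  (x0 mu t * y0 mu t + zeta mu) /
  (x0 mu t ^ 2 + y0 mu t ^ 2 - x0 mu t * y0 mu t
   - beta mu * (x0 mu t - y0 mu t) + zeta mu).

(* Main.v *)
Require Import Defs.
From Stdlib Require Import ZArith Reals Lra Lia Psatz ClassicalEpsilon.
From Coquelicot Require Import Coquelicot.
Open Scope R_scope.

(** In the upper half space the linear field has an explicit flow: a focus with
    eigenvalues [mu + i] and [mu - i] in the plane of [(y,z)], and the combination
    [x - H y + 4 mu H z], which decays like [exp (- 2 mu t)]. An arc that leaves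
    the section with second coordinate [y > 0] therefore returns after a time [t]
    between [PI] and [t_g] that depends on [y] only, with [y = y0 t], and lands
    with second coordinate [- x0 t]. Composed with the symmetry, the half-return map is
    [F (x,y) = (x0 t, H x0 t - exp (- 2 mu t) (x - H y))] ([F_half_return]), and
    the full return map is [F] composed with itself.

    Orbits of simple period. A trajectory is determined by any of its points
    ([crossing_trajectory_unique]), so such an orbit is a point of period two of
    [F]. There is no proper two-cycle: its two equations order the same
    quantities in opposite ways as soon as the two flight times differ
    ([no_two_cycle]). What remains is a fixed point of [F], that is
    [(x0 t, y0 t)] with [H = (y0 + E x0) / (x0 + E y0)] and
    [E = exp (- 2 mu t)]; this quotient is [eta t] ([eta_fixed_form]). In terms
    of [rho = y0 / x0] it is [(rho + E) / (1 + rho E)], and [rho] and [E] both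
    decrease with [t] and stay below [1]; hence [eta] decreases, from [H_crit] at
    [PI], where [rho = exp (- mu PI)], to [H_g] at [t_g], where [rho = 0].
    Conversely the arc over a fixed point and its mirror image close up to a
    periodic trajectory ([fixed_trajectory_exists]).

    Multipliers. The differential of [F] at the fixed point is a companion matrix
    of determinant [D = y0 / x0 < 1] whose trace [T] satisfies [- 1 < T < 1 + D]
    ([jury_conditions]), so its eigenvalues are in the open unit disc. The return
    map has the square of this matrix as differential at one crossing point, and
    its conjugate by the symmetry at the other ([poincare_differential]).

    Stability. A quadratic form contracted by the differential
    ([companion_lyapunov]) is contracted by [F] near the fixed point
    ([fixed_point_contraction]), so its small sublevel sets are invariant and
    their points converge to the fixed point. Between two crossings the flow
    depends continuously on the starting point, and whatever starts near the
    orbit lands first in such a sublevel set ([first_landing]); stability and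
    attraction in space follow. A periodic orbit that stays in the domain of
    attraction is contained in the closed set it is attracted to, and equals it
    by uniqueness. *)

(** * Calculus on an interval *)

Ltac min_upper :=
  first [apply Rmin_l | apply Rmin_r | eapply Rle_trans; [apply Rmin_r | min_upper]].

Lemma continuity_pt_of_derive (f : R -> R) (t l : R) :
  is_derive f t l -> continuity_pt f t.
Proof.
intros h; apply derivable_continuous_pt; exists l.
now apply is_derive_Reals.
Qed.

(** Composition with [clamp] continues a function by constants, so that
    one-sided continuity at the end points is enough for the mean value
    theorem. *)
Definition clamp (a b t : R) : R := Rmax a (Rmin t b).

Lemma clamp_inside (a b t : R) : a <= t <= b -> clamp a b t = t.
Proof.
intros h; unfold clamp; rewrite (Rmin_left t b), Rmax_right; lra.
Qed.

Lemma clamp_bounds (a b t : R) : a <= b -> a <= clamp a b t <= b.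
Proof.
intros h; unfold clamp; split; [apply Rmax_l|].
apply Rmax_lub; [lra|apply Rmin_r].
Qed.

Lemma clamp_contract (a b s t : R) :
  a <= b -> Rabs (clamp a b s - clamp a b t) <= Rabs (s - t).
Proof.
intros h; unfold clamp, Rmax, Rmin.
repeat destruct Rle_dec; unfold Rabs; repeat destruct Rcase_abs; lra.
Qed.

Definition cont_in (I : R -> Prop) (f : R -> R) (t : R) : Prop :=
  forall eps, 0 < eps ->
    exists del, 0 < del /\ forall s, I s -> Rabs (s - t) < del ->
      Rabs (f s - f t) < eps.

Lemma continuity_pt_eps (f : R -> R) (t : R) :
  continuity_pt f t <-> cont_in (fun _ => True) f t.
Proof.
unfold cont_in; split.
- intros h eps he; destruct (h eps he) as [del [hd h']].
  exists del; split; [exact hd|]; intros s _ hs.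
  destruct (Req_dec s t) as [->|hne].
  + now rewrite Rminus_diag, Rabs_R0.
  + apply (h' s); split; [split; [exact I|congruence]|exact hs].
- intros h eps he; destruct (h eps he) as [del [hd h']].
  exists del; split; [exact hd|]; intros s [_ hs]; now apply (h' s).
Qed.

Lemma derive_zero_const (f : R -> R) (a b : R) :
  a <= b ->
  (forall t, a <= t <= b -> cont_in (fun s => a <= s <= b) f t) ->
  (forall t, a < t < b -> is_derive f t 0) ->
  f a = f b.
Proof.
intros hab hc hd.
set (g := fun t => f (clamp a b t)).
destruct (MVT_gen g a b (fun _ => 0)) as [c [_ hc']].
- intros x; rewrite Rmin_left, Rmax_right by lra; intros hx.
  apply (is_derive_ext_loc f); [|now apply hd].
  assert (hp : 0 < Rmin (x - a) (b - x)) by (apply Rmin_glb_lt; lra).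
  exists (mkposreal _ hp); intros s hs; unfold g.
  apply Rabs_lt_between' in hs; simpl in hs.
  generalize (Rmin_l (x - a) (b - x)) (Rmin_r (x - a) (b - x)); intros.
  rewrite clamp_inside; [reflexivity|lra].
- intros x _; apply continuity_pt_eps; intros eps he.
  destruct (hc _ (clamp_bounds a b x hab) eps he) as [del [hdel h]].
  exists del; split; [exact hdel|]; intros s _ hs.
  apply h; [now apply clamp_bounds|].
  eapply Rle_lt_trans; [now apply clamp_contract|exact hs].
- unfold g in hc'; rewrite !clamp_inside in hc' by lra; lra.
Qed.

(** Connectedness of an interval: the indicator function of [P] has derivative
    zero. *)
Lemma locally_constant_interval (P : R -> Prop) (a b : R) :
  a <= b ->
  (forall s, a <= s <= b -> exists del, 0 < del /\
     forall r, a <= r <= b -> Rabs (r - s) < del -> (P r <-> P s)) ->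
  (P a <-> P b).
Proof.
intros hab hloc.
set (f := fun r => if excluded_middle_informative (P r) then 1 else 0).
assert (hf : forall r s, (P r <-> P s) -> f r = f s).
{ intros r s h; unfold f.
  destruct (excluded_middle_informative (P r));
    destruct (excluded_middle_informative (P s)); tauto. }
assert (h : f a = f b).
{ apply derive_zero_const; [exact hab| |].
  - intros t ht eps he; destruct (hloc t ht) as [del [hd h]].
    exists del; split; [exact hd|]; intros s hs hst.
    rewrite (hf s t (h s hs hst)), Rminus_diag, Rabs_R0; exact he.
  - intros t ht; destruct (hloc t ltac:(lra)) as [del [hd h]].
    apply (is_derive_ext_loc (fun _ => f t)); [|apply is_derive_Reals, derivable_pt_lim_const].
    assert (hp : 0 < Rmin del (Rmin (t - a) (b - t)))
      by (repeat apply Rmin_glb_lt; lra).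
    exists (mkposreal _ hp); intros s hs; simpl in hs.
    apply Rabs_lt_between' in hs.
    generalize (Rmin_l del (Rmin (t - a) (b - t)))
      (Rmin_r del (Rmin (t - a) (b - t)))
      (Rmin_l (t - a) (b - t)) (Rmin_r (t - a) (b - t)); intros.
    symmetry; apply hf, h; [lra|]; apply Rabs_lt_between'; lra. }
unfold f in h.
destruct (excluded_middle_informative (P a));
  destruct (excluded_middle_informative (P b)); tauto || lra.
Qed.

Lemma strict_decr_of_derive (f df : R -> R) (a b : R) :
  (forall t, a < t < b -> is_derive f t (df t)) ->
  (forall t, a < t < b -> df t < 0) ->
  (forall t, a <= t <= b -> continuity_pt f t) ->
  a < b -> f b < f a.
Proof.
intros hd hneg hc hab.
destruct (MVT f id a b) with
  (pr1 := fun c (hc : a < c < b) =>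
     exist (fun l => derivable_pt_lim f c l) (df c)
       (proj1 (is_derive_Reals f c (df c)) (hd c hc)))
  (pr2 := fun c (hc : a < c < b) => derivable_pt_id c)
  as [c [P h]]; auto.
- intros; apply derivable_continuous_pt, derivable_pt_id.
- rewrite (derive_pt_eq_0 _ _ _ _ (derivable_pt_lim_id c)) in h.
  unfold id in h; simpl in h.
  specialize (hneg c P).
  nra.
Qed.

(** * The half-return functions of time *)

Lemma exp_neg_mul (mu t : R) : exp (- mu * t) = / exp (mu * t).
Proof.
rewrite <- exp_Ropp; f_equal; ring.
Qed.

Lemma sin_neg_arc (t : R) : PI < t < 2 * PI -> sin t < 0.
Proof. intros [h1 h2]; now apply sin_lt_0. Qed.

Lemma zeta_pos (mu : R) : 0 < zeta mu.
Proof. unfold zeta; apply Rdiv_lt_0_compat; nra. Qed.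

Lemma exp_gt_1 (x : R) : 0 < x -> 1 < exp x.
Proof. intros h; rewrite <- exp_0; now apply exp_increasing. Qed.

Lemma exp_lt_1 (x : R) : x < 0 -> exp x < 1.
Proof. intros h; rewrite <- exp_0; now apply exp_increasing. Qed.

(** Multiplied by [sin], [y0] and [x0] have no singularity at [PI], which is
    what their ratio needs there. *)
Definition num_y (mu t : R) : R := cos t - exp (- mu * t) - mu * sin t.
Definition num_x (mu t : R) : R := cos t - exp (mu * t) + mu * sin t.

Lemma y0_num (mu t : R) : sin t <> 0 -> y0 mu t = zeta mu * num_y mu t / sin t.
Proof. intros h; unfold y0, num_y; field; exact h. Qed.

Lemma x0_num (mu t : R) : sin t <> 0 -> x0 mu t = zeta mu * num_x mu t / sin t.
Proof. intros h; unfold x0, num_x; field; exact h. Qed.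

Lemma num_x_neg (mu t : R) : 0 < mu -> PI <= t < 2 * PI -> num_x mu t < 0.
Proof.
intros hmu ht; unfold num_x.
assert (hp := PI_RGT_0).
assert (he := exp_gt_1 (mu * t) ltac:(nra)).
assert (hc := COS_bound t).
assert (hs : sin t <= 0).
{ destruct (Req_dec t PI) as [->|hne]; [rewrite sin_PI; lra|].
  left; apply sin_lt_0; lra. }
nra.
Qed.

Lemma x0_pos (mu t : R) : 0 < mu -> PI < t < 2 * PI -> 0 < x0 mu t.
Proof.
intros hmu ht; assert (hs := sin_neg_arc t ht).
rewrite x0_num by lra.
assert (hn := num_x_neg mu t hmu ltac:(lra)); assert (hz := zeta_pos mu).
apply Rdiv_neg_neg; [nra|exact hs].
Qed.

(** Both derivatives come from differentiating along the level set [z = 0] of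
    the third coordinate, as a function of the flight time and of the initial
    height; the two differ by the reversal of time. *)
Lemma is_derive_y0 (mu t : R) : sin t <> 0 ->
  is_derive (y0 mu) t (x0 mu t * exp (- mu * t) / sin t).
Proof.
intros hs; unfold y0, x0; auto_derive; [exact hs|].
rewrite !exp_neg_mul; assert (he := exp_pos (mu * t)).
assert (hc : cos t * cos t = 1 - sin t * sin t)
  by (generalize (sin2_cos2 t); unfold Rsqr; lra).
unfold zeta; field_simplify_eq;
  [|repeat split; try exact hs; try nra; try lra].
generalize (exp (mu * t)) (cos t) (sin t) hc; intros e c s hcs.
replace (e * c ^ 2) with (e * (c * c)) by ring; rewrite hcs; ring.
Qed.

Lemma is_derive_x0 (mu t : R) : sin t <> 0 ->
  is_derive (x0 mu) t (y0 mu t * exp (mu * t) / sin t).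
Proof.
intros hs; unfold y0, x0; auto_derive; [exact hs|].
rewrite !exp_neg_mul; assert (he := exp_pos (mu * t)).
assert (hc : cos t * cos t = 1 - sin t * sin t)
  by (generalize (sin2_cos2 t); unfold Rsqr; lra).
unfold zeta; field_simplify_eq;
  [|repeat split; try exact hs; try nra; try lra].
generalize (exp (mu * t)) (cos t) (sin t) hc; intros e c s hcs.
replace (c ^ 2) with (c * c) by ring; rewrite hcs; ring.
Qed.

Lemma is_derive_E (mu t : R) :
  is_derive (fun r => exp (- 2 * mu * r)) t (- 2 * mu * exp (- 2 * mu * t)).
Proof. auto_derive; [trivial|ring]. Qed.

Lemma y0_decr (mu s t : R) : 0 < mu ->
  PI < s -> s < t -> t < 2 * PI -> y0 mu t < y0 mu s.
Proof.
intros hmu h1 h2 h3.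
apply (strict_decr_of_derive (y0 mu)
         (fun r => x0 mu r * exp (- mu * r) / sin r)); [| | |exact h2].
- intros r hr; apply is_derive_y0; generalize (sin_neg_arc r); lra.
- intros r hr; assert (hs := sin_neg_arc r ltac:(lra)).
  assert (hx := x0_pos mu r hmu ltac:(lra)); assert (he := exp_pos (- mu * r)).
  apply Rdiv_pos_neg; [nra|exact hs].
- intros r hr; eapply continuity_pt_of_derive, is_derive_y0.
  generalize (sin_neg_arc r); lra.
Qed.

Lemma is_t_g_iff (mu t : R) :
  is_t_g mu t <-> PI < t < 2 * PI /\ num_y mu t = 0.
Proof.
unfold is_t_g, num_y; split; intros [ht h]; (split; [exact ht|]);
  assert (hs := sin_neg_arc t ht).
- assert (hh : cos t - exp (- mu * t) =
                (cos t - exp (- mu * t)) / sin t * sin t) by (field; lra).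
  rewrite h in hh; lra.
- replace (cos t - exp (- mu * t)) with (mu * sin t) by lra; field; lra.
Qed.

Lemma continuity_num_y (mu t : R) : continuity_pt (num_y mu) t.
Proof.
apply (continuity_pt_of_derive _ t (- sin t + mu * exp (- mu * t) - mu * cos t)).
unfold num_y; auto_derive; [trivial|ring].
Qed.

Lemma t_g_exists_unique (mu : R) : 0 < mu -> exists! tg, is_t_g mu tg.
Proof.
intros hmu; assert (hp := PI_RGT_0).
assert (h1 : num_y mu PI < 0).
{ unfold num_y; rewrite cos_PI, sin_PI; generalize (exp_pos (- mu * PI)); lra. }
assert (h2 : 0 < num_y mu (2 * PI)).
{ unfold num_y; rewrite cos_2PI, sin_2PI.
  generalize (exp_lt_1 (- mu * (2 * PI)) ltac:(nra)); lra. }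
destruct (Ranalysis5.IVT_interv (num_y mu) PI (2 * PI)) as [t [ht h0]];
  [intros; apply continuity_num_y|lra|exact h1|exact h2|].
assert (ht' : PI < t < 2 * PI).
{ split; destruct ht as [[ha|ha] [hb|hb]]; try assumption; subst; lra. }
exists t; split; [now apply is_t_g_iff|].
intros t' h'; apply is_t_g_iff in h'; destruct h' as [ht1 h1'].
assert (hz : forall r, PI < r < 2 * PI -> num_y mu r = 0 -> y0 mu r = 0).
{ intros r hr hn; rewrite y0_num, hn; [field|];
  generalize (sin_neg_arc r hr); lra. }
destruct (Rtotal_order t t') as [hlt|[heq|hgt]]; [exfalso|exact heq|exfalso].
- generalize (y0_decr mu t t' hmu ltac:(lra) hlt ltac:(lra)).
  rewrite (hz t), (hz t'); auto; lra.
- generalize (y0_decr mu t' t hmu ltac:(lra) hgt ltac:(lra)).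
  rewrite (hz t), (hz t'); auto; lra.
Qed.

(** * The flow of the linear field *)

(** Planar focus in [(y,z)] around [z = zeta]; then [x - H y + 4 mu H z] decays
    with rate [2 mu], which gives the first coordinate. *)
Definition flow_z (mu : R) (p : R3) (s : R) : R :=
  zeta mu + exp (mu * s) * ((zc p - zeta mu) * cos s
                            + (yc p - mu * (zc p - zeta mu)) * sin s).
Definition flow_y (mu : R) (p : R3) (s : R) : R :=
  exp (mu * s) * (yc p * cos s
                  + (mu * yc p - (1 + mu ^ 2) * (zc p - zeta mu)) * sin s).
Definition flow_x (mu H : R) (p : R3) (s : R) : R :=
  exp (- 2 * mu * s) * (xc p - H * yc p + 4 * mu * H * zc p)
  + H * flow_y mu p s - 4 * mu * H * flow_z mu p s.
Definition flow (mu H : R) (p : R3) (s : R) : R3 :=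
  (flow_x mu H p s, flow_y mu p s, flow_z mu p s).

Lemma R3_eq (p q : R3) : xc p = xc q -> yc p = yc q -> zc p = zc q -> p = q.
Proof.
destruct p as [[a b] c], q as [[a' b'] c']; unfold xc, yc, zc; simpl.
now intros -> -> ->.
Qed.

Lemma flow_0 (mu H : R) (p : R3) : flow mu H p 0 = p.
Proof.
apply R3_eq; unfold flow, flow_x, flow_y, flow_z, xc, yc, zc; simpl;
  rewrite ?Rmult_0_r, cos_0, sin_0, exp_0; ring.
Qed.

Lemma zeta_spec (mu : R) : (1 + mu ^ 2) * zeta mu = 1.
Proof. unfold zeta; field; nra. Qed.

Lemma is_derive_flow_z (mu : R) (p : R3) (s : R) :
  is_derive (flow_z mu p) s (flow_y mu p s).
Proof. unfold flow_z, flow_y; auto_derive; [trivial|ring]. Qed.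

Lemma is_derive_flow_y (mu : R) (p : R3) (s : R) :
  is_derive (flow_y mu p) s
    (2 * mu * flow_y mu p s - (1 + mu ^ 2) * flow_z mu p s + 1).
Proof.
unfold flow_y, flow_z; auto_derive; [trivial|].
generalize (zeta_spec mu); intros hz; lra.
Qed.

Lemma is_derive_flow_x (mu H : R) (p : R3) (s : R) :
  is_derive (flow_x mu H p) s
    (- 2 * mu * flow_x mu H p s - H * (9 * mu ^ 2 + 1) * flow_z mu p s + H).
Proof.
unfold flow_x.
auto_derive.
- repeat split; eexists; [apply is_derive_flow_y|apply is_derive_flow_z].
- assert (ey : Derive (fun r : R => flow_y mu p r) s = _)
    by exact (is_derive_unique _ _ _ (is_derive_flow_y mu p s)).
  assert (ez : Derive (fun r : R => flow_z mu p r) s = _)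
    by exact (is_derive_unique _ _ _ (is_derive_flow_z mu p s)).
  rewrite ey, ez; ring.
Qed.

Definition solves_at (mu H : R) (g : R -> R3) (t : R) : Prop :=
  is_derive (fun s => xc (g s)) t (xc (X mu H (g t))) /\
  is_derive (fun s => yc (g s)) t (yc (X mu H (g t))) /\
  is_derive (fun s => zc (g s)) t (zc (X mu H (g t))).

Lemma flow_solves (mu H : R) (p : R3) (s : R) : solves_at mu H (flow mu H p) s.
Proof.
exact (conj (is_derive_flow_x mu H p s)
        (conj (is_derive_flow_y mu p s) (is_derive_flow_z mu p s))).
Qed.

Lemma is_derive_shift (f : R -> R) (c t l : R) :
  is_derive f (t - c) l -> is_derive (fun s => f (s - c)) t l.
Proof.
intros h.
assert (hs : is_derive (fun s : R => s - c) t 1) by (auto_derive; [trivial|ring]).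
replace l with (1 * l) by ring.
exact (is_derive_comp f (fun s => s - c) t l 1 h hs).
Qed.

Lemma solves_shift (mu H : R) (g : R -> R3) (c t : R) :
  solves_at mu H g (t - c) -> solves_at mu H (fun s => g (s - c)) t.
Proof.
intros [h1 [h2 h3]]; split; [|split].
- exact (is_derive_shift (fun s => xc (g s)) c t _ h1).
- exact (is_derive_shift (fun s => yc (g s)) c t _ h2).
- exact (is_derive_shift (fun s => zc (g s)) c t _ h3).
Qed.

Definition cont3_in (I : R -> Prop) (g : R -> R3) (t : R) : Prop :=
  cont_in I (fun s => xc (g s)) t /\ cont_in I (fun s => yc (g s)) t /\
  cont_in I (fun s => zc (g s)) t.

Lemma cont_in_mono (I J : R -> Prop) (f : R -> R) (t : R) :
  (forall s, J s -> I s) -> cont_in I f t -> cont_in J f t.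
Proof.
intros hIJ h eps he; destruct (h eps he) as [d [hd h']].
exists d; split; auto.
Qed.

Lemma cont_in_derive (I : R -> Prop) (f : R -> R) (t l : R) :
  is_derive f t l -> cont_in I f t.
Proof.
intros h; apply (cont_in_mono (fun _ => True)); [trivial|].
now apply continuity_pt_eps, (continuity_pt_of_derive f t l).
Qed.

Lemma solves_cont (mu H : R) (I : R -> Prop) (g : R -> R3) (t : R) :
  solves_at mu H g t -> cont3_in I g t.
Proof.
intros [h1 [h2 h3]]; repeat split; eapply cont_in_derive; eassumption.
Qed.

Lemma cont_in_limit (I : R -> Prop) (f : R -> R) (t : R) :
  cont_in I f t <-> limit1_in f I (f t) t.
Proof.
split; intros h eps he; destruct (h eps he) as [d [hd k]]; exists d;
  (split; [exact hd|]); [intros s [hs hst]|intros s hs hst]; now apply k.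
Qed.

Lemma cont_in_plus (I : R -> Prop) (f g : R -> R) (t : R) :
  cont_in I f t -> cont_in I g t -> cont_in I (fun s => f s + g s) t.
Proof. rewrite !cont_in_limit; apply limit_plus. Qed.

Lemma cont_in_mult (I : R -> Prop) (f g : R -> R) (t : R) :
  cont_in I f t -> cont_in I g t -> cont_in I (fun s => f s * g s) t.
Proof. rewrite !cont_in_limit; apply limit_mul. Qed.

Lemma cont_in_opp (I : R -> Prop) (f : R -> R) (t : R) :
  cont_in I f t -> cont_in I (fun s => - f s) t.
Proof. rewrite !cont_in_limit; apply limit_Ropp. Qed.

Lemma cont_in_const (I : R -> Prop) (c t : R) : cont_in I (fun _ => c) t.
Proof.
intros eps he; exists 1; split; [lra|]; intros.
now rewrite Rminus_diag, Rabs_R0.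
Qed.

(** The first quantity comes from the invariant plane [x - H y + 4 mu H z = 0] of
    rate [- 2 mu], the second from the focus, which rotates [(z, y - mu z)] while
    expanding it with rate [mu]. *)
Lemma homogeneous_invariants (mu H t : R) (x y z : R -> R) :
  is_derive x t (- 2 * mu * x t - H * (9 * mu ^ 2 + 1) * z t) ->
  is_derive y t (2 * mu * y t - (1 + mu ^ 2) * z t) ->
  is_derive z t (y t) ->
  is_derive (fun s => exp (2 * mu * s) *
    (x s + (- H) * y s + (4 * mu * H) * z s)) t 0 /\
  is_derive (fun s => exp (- 2 * mu * s) *
    (z s * z s + (y s + (- mu) * z s) * (y s + (- mu) * z s))) t 0.
Proof.
intros dx dy dz.
assert (ex : Derive (fun r : R => x r) t = _) by exact (is_derive_unique _ _ _ dx).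
assert (ey : Derive (fun r : R => y r) t = _) by exact (is_derive_unique _ _ _ dy).
assert (ez : Derive (fun r : R => z r) t = _) by exact (is_derive_unique _ _ _ dz).
split; auto_derive; try (repeat split; eexists; eassumption);
  rewrite ?ex, ey, ez; ring.
Qed.

(** The difference [(x,y,z)] of two solutions solves the homogeneous system. The
    two quantities constant along it vanish together only where the difference
    does, hence everywhere as soon as they vanish once. *)
Lemma solution_unique (mu H a b : R) (g h : R -> R3) :
  a <= b ->
  (forall t, a <= t <= b -> cont3_in (fun s => a <= s <= b) g t) ->
  (forall t, a <= t <= b -> cont3_in (fun s => a <= s <= b) h t) ->
  (forall t, a < t < b -> solves_at mu H g t) ->
  (forall t, a < t < b -> solves_at mu H h t) ->
  (g a = h a <-> g b = h b).
Proof.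
intros hab cg ch dg dh.
set (D := fun (c : R3 -> R) s => c (g s) + (-1) * c (h s)).
set (U := fun s => D xc s + (- H) * D yc s + (4 * mu * H) * D zc s).
set (V := fun s => D yc s + (- mu) * D zc s).
set (i1 := fun s => exp (2 * mu * s) * U s).
set (i2 := fun s => exp (- 2 * mu * s) * (D zc s * D zc s + V s * V s)).
assert (hder : forall t, a < t < b -> is_derive i1 t 0 /\ is_derive i2 t 0).
{ intros t ht; destruct (dg t ht) as [d1 [d2 d3]], (dh t ht) as [d4 [d5 d6]].
  assert (hD : forall (f k : R -> R) lf lk l, is_derive f t lf -> is_derive k t lk ->
    l = lf - lk -> is_derive (fun s => f s + (-1) * k s) t l).
  { intros f k lf lk l hf hk ->.
    apply (is_derive_ext (fun s => f s - k s)); [intros r; simpl; ring|].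
    exact (is_derive_minus f k t lf lk hf hk). }
  apply (homogeneous_invariants mu H t (D xc) (D yc) (D zc));
    unfold D; (eapply hD; [eassumption|eassumption|]);
    unfold X, xc, yc, zc; simpl; ring. }
assert (hcont : forall t, a <= t <= b ->
  cont_in (fun s => a <= s <= b) i1 t /\ cont_in (fun s => a <= s <= b) i2 t).
{ intros t ht; destruct (cg t ht) as [c1 [c2 c3]], (ch t ht) as [c4 [c5 c6]].
  unfold i1, i2, U, V, D.
  split; (apply cont_in_mult;
    [|repeat (apply cont_in_mult || apply cont_in_plus); auto using cont_in_const]).
  - apply (cont_in_derive _ _ _ (2 * mu * exp (2 * mu * t))).
    auto_derive; [trivial|ring].
  - apply (cont_in_derive _ _ _ (- 2 * mu * exp (- 2 * mu * t))).
    auto_derive; [trivial|ring]. }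
assert (e1 : i1 a = i1 b)
  by (apply derive_zero_const; [exact hab|apply hcont|apply hder]).
assert (e2 : i2 a = i2 b)
  by (apply derive_zero_const; [exact hab|apply hcont|apply hder]).
assert (key : forall t, g t = h t <-> (i1 t = 0 /\ i2 t = 0)).
{ intros t; split.
  - intros e; unfold i1, i2, U, V, D; rewrite e; split; ring.
  - unfold i1, i2; intros [h1 h2].
    apply Rmult_integral in h1; apply Rmult_integral in h2.
    generalize (exp_pos (2 * mu * t)) (exp_pos (- 2 * mu * t)); intros p1 p2.
    destruct h1 as [h1|h1]; [lra|]; destruct h2 as [h2|h2]; [lra|].
    assert (hz : D zc t = 0) by nra; assert (hv : V t = 0) by nra.
    assert (hy : D yc t = 0) by (unfold V in hv; rewrite hz in hv; lra).
    assert (hx : D xc t = 0) by (unfold U in h1; rewrite hz, hy in h1; lra).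
    unfold D in *; apply R3_eq; lra. }
rewrite !key, e1, e2; tauto.
Qed.

(** ** Arcs over the section *)

Lemma S_Sigma_invol (q : R2) : S_Sigma (S_Sigma q) = q.
Proof. destruct q as [a b]; unfold S_Sigma; simpl; f_equal; ring. Qed.

Lemma Sinv_invol (q : R3) : Sinv (Sinv q) = q.
Proof. apply R3_eq; unfold Sinv, xc, yc, zc; simpl; ring. Qed.

Lemma Sinv_emb (q : R2) : Sinv (emb q) = emb (S_Sigma q).
Proof. apply R3_eq; unfold Sinv, emb, S_Sigma, xc, yc, zc; simpl; ring. Qed.

Lemma emb_inj (p q : R2) : emb p = emb q -> p = q.
Proof.
intros h; unfold emb in h; destruct p, q; simpl in h; congruence.
Qed.

Lemma Sigma_emb (p : R3) : Sigma p -> p = emb (xc p, yc p).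
Proof. intros h; apply R3_eq; try reflexivity; exact h. Qed.

Lemma emb_coords (p : R2) : xc (emb p) = fst p /\ yc (emb p) = snd p /\ zc (emb p) = 0.
Proof. now unfold emb, xc, yc, zc. Qed.

Lemma flow_z_section (mu : R) (p : R2) (s : R) : sin s <> 0 ->
  flow_z mu (emb p) s = exp (mu * s) * sin s * (snd p - y0 mu s).
Proof.
intros hs; unfold flow_z, y0; destruct (emb_coords p) as [_ [-> ->]].
rewrite exp_neg_mul; generalize (exp_pos (mu * s)); intros.
field; split; [lra|exact hs].
Qed.

Lemma flow_z_short (mu : R) (p : R2) (s : R) : 0 < mu -> 0 < snd p ->
  0 < s <= PI -> 0 < flow_z mu (emb p) s.
Proof.
intros hmu hy hs; unfold flow_z; destruct (emb_coords p) as [_ [-> ->]].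
assert (hz := zeta_pos mu); assert (he := exp_pos (mu * s)).
assert (hsin : 0 <= sin s) by (apply sin_ge_0; lra).
(* [exp (mu s) (cos s - mu sin s)] starts at 1 and decreases on the half turn *)
assert (hk : exp (mu * s) * (cos s - mu * sin s) < exp (mu * 0) * (cos 0 - mu * sin 0)).
{ apply (strict_decr_of_derive (fun s => exp (mu * s) * (cos s - mu * sin s))
    (fun s => - ((1 + mu ^ 2) * (exp (mu * s) * sin s)))); [| | |lra].
  - intros; auto_derive; [trivial|ring].
  - intros t ht; assert (0 < sin t) by (apply sin_gt_0; lra).
    apply Ropp_lt_gt_0_contravar, Rmult_lt_0_compat; [nra|].
    apply Rmult_lt_0_compat; [apply exp_pos|assumption].
  - intros t _; eapply continuity_pt_of_derive; auto_derive; [trivial|reflexivity]. }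
rewrite Rmult_0_r, exp_0, cos_0, sin_0 in hk.
assert (0 <= exp (mu * s) * (snd p * sin s)) by (apply Rmult_le_pos; nra).
assert (0 < zeta mu * (1 - exp (mu * s) * (cos s - mu * sin s)))
  by (apply Rmult_lt_0_compat; lra).
nra.
Qed.

(** * Crossing trajectories *)

(** ** Coordinates *)

Definition deriv_in (I : R -> Prop) (f : R -> R) (t v : R) : Prop :=
  forall eps, 0 < eps ->
    exists del, 0 < del /\ forall s, I s -> Rabs (s - t) < del ->
      Rabs (f s - f t - (s - t) * v) <= eps * Rabs (s - t).

Lemma within_eps (I P : R -> Prop) (t : R) :
  within I (locally t) P <->
  exists del, 0 < del /\ forall s, I s -> Rabs (s - t) < del -> P s.
Proof.
split.
- intros [d h]; exists d; split; [apply cond_pos|]; intros s hI hs.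
  now apply h.
- intros [d [hd h]]; exists (mkposreal d hd); intros s hs hI; now apply h.
Qed.

Lemma within_lim_unique (I : R -> Prop) (t x : R) :
  I t -> is_filter_lim (within I (locally t)) x -> x = t.
Proof.
intros hI h.
destruct (Req_dec x t) as [e|hne]; [exact e|exfalso].
assert (hp : 0 < Rabs (t - x)) by (apply Rabs_pos_lt; lra).
assert (hl : locally x (fun y => Rabs (y - x) < Rabs (t - x)))
  by (exists (mkposreal _ hp); intros y hy; exact hy).
apply h in hl; apply within_eps in hl; destruct hl as [d [hd h']].
specialize (h' t hI); rewrite Rminus_diag, Rabs_R0 in h'.
specialize (h' hd); lra.
Qed.

Lemma within_lim (I : R -> Prop) (t : R) : is_filter_lim (within I (locally t)) t.
Proof. intros P [d h]; exists d; intros y hy _; now apply h. Qed.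

Lemma prod_norm_fst {U V : NormedModule R_AbsRing}
  (x : prod_NormedModule R_AbsRing U V) : norm (fst x) <= norm x.
Proof.
eapply Rle_trans; [|apply (proj1 (sqrt_plus_sqr (norm (fst x)) (norm (snd x))))].
rewrite (Rabs_pos_eq (norm (fst x))) by apply norm_ge_0; apply Rmax_l.
Qed.

Lemma prod_norm_snd {U V : NormedModule R_AbsRing}
  (x : prod_NormedModule R_AbsRing U V) : norm (snd x) <= norm x.
Proof.
eapply Rle_trans; [|apply (proj1 (sqrt_plus_sqr (norm (fst x)) (norm (snd x))))].
rewrite (Rabs_pos_eq (norm (snd x))) by apply norm_ge_0; apply Rmax_r.
Qed.

Lemma prod_norm_le {U V : NormedModule R_AbsRing}
  (x : prod_NormedModule R_AbsRing U V) : norm x <= norm (fst x) + norm (snd x).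
Proof.
generalize (norm_ge_0 (fst x)) (norm_ge_0 (snd x)); intros h1 h2.
apply Rsqr_incr_0_var; [|lra].
change (Rsqr (sqrt (norm (fst x) ^ 2 + norm (snd x) ^ 2))
        <= Rsqr (norm (fst x) + norm (snd x))).
rewrite Rsqr_sqrt by nra; unfold Rsqr; nra.
Qed.

Lemma derive_within_iff (I : R -> Prop) (g : R -> R3) (t : R) (v : R3) : I t ->
  derive_within I g t v <->
  deriv_in I (fun s => xc (g s)) t (xc v) /\
  deriv_in I (fun s => yc (g s)) t (yc v) /\
  deriv_in I (fun s => zc (g s)) t (zc v).
Proof.
intros hI; unfold derive_within; split.
- intros [_ h]; specialize (h t (within_lim I t)).
  assert (h' : forall eps : posreal, exists del, 0 < del /\
    forall s, I s -> Rabs (s - t) < del ->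
      Rabs (xc (g s) - xc (g t) - (s - t) * xc v) <= eps * Rabs (s - t) /\
      Rabs (yc (g s) - yc (g t) - (s - t) * yc v) <= eps * Rabs (s - t) /\
      Rabs (zc (g s) - zc (g t) - (s - t) * zc v) <= eps * Rabs (s - t)).
  { intros eps; specialize (h eps); apply within_eps in h.
    destruct h as [d [hd h]]; exists d; split; [exact hd|].
    intros s hs hst; specialize (h s hs hst).
    assert (h3 := Rle_trans _ _ _ (prod_norm_snd _) h).
    assert (h12 := Rle_trans _ _ _ (prod_norm_fst _) h).
    assert (h1 := Rle_trans _ _ _ (prod_norm_fst _) h12).
    assert (h2 := Rle_trans _ _ _ (prod_norm_snd _) h12).
    exact (conj h1 (conj h2 h3)). }
  repeat split; intros eps he; destruct (h' (mkposreal eps he)) as [d [hd hh]];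
    exists d; (split; [exact hd|]); intros s hs hst; now apply (hh s hs hst).
- intros [h1 [h2 h3]]; split.
  + exact (is_linear_scal_l (K := R_AbsRing) (V := prod_NormedModule R_AbsRing
       (prod_NormedModule R_AbsRing R_NormedModule R_NormedModule) R_NormedModule) v).
  + intros x hx eps; apply (within_lim_unique I t x hI) in hx; subst x.
    assert (he : 0 < eps / 3) by (generalize (cond_pos eps); lra).
    destruct (h1 _ he) as [d1 [hd1 k1]], (h2 _ he) as [d2 [hd2 k2]],
      (h3 _ he) as [d3 [hd3 k3]].
    apply within_eps; exists (Rmin d1 (Rmin d2 d3)).
    split; [repeat apply Rmin_glb_lt; assumption|]; intros s hs hst.
    assert (l1 : Rabs (s - t) < d1)
      by (eapply Rlt_le_trans; [exact hst|apply Rmin_l]).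
    assert (l2 : Rabs (s - t) < d2)
      by (eapply Rlt_le_trans; [exact hst|eapply Rle_trans; [apply Rmin_r|apply Rmin_l]]).
    assert (l3 : Rabs (s - t) < d3)
      by (eapply Rlt_le_trans; [exact hst|eapply Rle_trans; [apply Rmin_r|apply Rmin_r]]).
    specialize (k1 s hs l1); specialize (k2 s hs l2); specialize (k3 s hs l3).
    eapply Rle_trans; [apply prod_norm_le|].
    eapply Rle_trans; [apply Rplus_le_compat_r, prod_norm_le|].
    apply Rle_trans with (eps / 3 * Rabs (s - t) + eps / 3 * Rabs (s - t)
                          + eps / 3 * Rabs (s - t)).
    * exact (Rplus_le_compat _ _ _ _ (Rplus_le_compat _ _ _ _ k1 k2) k3).
    * right; change (norm (minus s t)) with (Rabs (s - t)); field.
Qed.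

Lemma is_derive_deriv_in (f : R -> R) (t l : R) :
  is_derive f t l <-> deriv_in (fun _ => True) f t l.
Proof.
split.
- intros [_ h] eps he.
  specialize (h t (fun P hP => hP) (mkposreal eps he)).
  destruct h as [d h]; exists d; split; [apply cond_pos|].
  intros s _ hs; exact (h s hs).
- intros h; split; [apply is_linear_scal_l|].
  intros x hx eps; 
  assert (e : x = t); [|subst x].
  { apply (within_lim_unique (fun _ => True) t x Logic.I).
    intros P hP; destruct (hx P hP) as [d hd]; exists d; auto. }
  destruct (h eps (cond_pos eps)) as [d [hd h']].
  exists (mkposreal d hd); intros s hs; exact (h' s Logic.I hs).
Qed.

Lemma cont3_iff (I : R -> Prop) (g : R -> R3) (t : R) :
  filterlim g (within I (locally t)) (locally (g t)) <-> cont3_in I g t.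
Proof.
split.
- intros h.
  assert (h' : forall eps : posreal, exists del, 0 < del /\
    forall s, I s -> Rabs (s - t) < del -> ball (g t) eps (g s)).
  { intros eps; apply within_eps, h; now exists eps. }
  repeat split; intros eps he; destruct (h' (mkposreal eps he)) as [d [hd hh]];
    exists d; (split; [exact hd|]); intros s hs hst;
    destruct (hh s hs hst) as [[k1 k2] k3]; assumption.
- intros [h1 [h2 h3]] P [eps hP].
  destruct (h1 eps (cond_pos eps)) as [d1 [hd1 k1]],
    (h2 eps (cond_pos eps)) as [d2 [hd2 k2]],
    (h3 eps (cond_pos eps)) as [d3 [hd3 k3]].
  apply within_eps; exists (Rmin d1 (Rmin d2 d3)).
  split; [repeat apply Rmin_glb_lt; assumption|]; intros s hs hst.
  apply hP; split; [split|].
  + apply k1; [exact hs|eapply Rlt_le_trans; [exact hst|apply Rmin_l]].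
  + apply k2; [exact hs|eapply Rlt_le_trans; [exact hst|]].
    eapply Rle_trans; [apply Rmin_r|apply Rmin_l].
  + apply k3; [exact hs|eapply Rlt_le_trans; [exact hst|]].
    eapply Rle_trans; [apply Rmin_r|apply Rmin_r].
Qed.

Lemma Xf_eq (mu H : R) (p : R3) : Xf mu H p = yc p.
Proof. reflexivity. Qed.

Lemma Yf_eq (mu H : R) (p : R3) : Yf mu H p = xc p.
Proof. unfold Yf, Y, X, Sinv, xc, yc, zc; simpl; ring. Qed.

Lemma Sigma_c_iff (mu H : R) (p : R3) :
  Sigma_c mu H p <-> zc p = 0 /\ xc p * yc p > 0.
Proof.
unfold Sigma_c, Sigma; rewrite Xf_eq, Yf_eq, (Rmult_comm (yc p)); tauto.
Qed.

(** The requirements at one time, with one sign condition for both directions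
    of crossing: [yc] is the vertical speed of [X]. *)
Definition crosses_at (I : R -> Prop) (g : R -> R3) (t : R) : Prop :=
  exists del, 0 < del /\ forall s, I s -> Rabs (s - t) < del ->
    (s < t -> yc (g t) * zc (g s) < 0) /\ (t < s -> yc (g t) * zc (g s) > 0).

Definition derives_in (I : R -> Prop) (g : R -> R3) (t : R) (v : R3) : Prop :=
  deriv_in I (fun s => xc (g s)) t (xc v) /\
  deriv_in I (fun s => yc (g s)) t (yc v) /\
  deriv_in I (fun s => zc (g s)) t (zc v).

Definition traj_at (mu H : R) (I : R -> Prop) (g : R -> R3) (t : R) : Prop :=
  cont3_in I g t /\
  (zc (g t) > 0 -> derives_in I g t (X mu H (g t))) /\
  (zc (g t) < 0 -> derives_in I g t (Y mu H (g t))) /\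
  (zc (g t) = 0 -> xc (g t) * yc (g t) > 0 /\ crosses_at I g t).

Lemma crossing_trajectory_iff (mu H : R) (I : R -> Prop) (g : R -> R3) :
  crossing_trajectory_on mu H I g <-> forall t, I t -> traj_at mu H I g t.
Proof.
unfold crossing_trajectory_on.
split; intros h t hI; specialize (h t hI); unfold traj_at in *.
- destruct h as [h1 [h2 [h3 h4]]].
  split; [now apply cont3_iff|]; split; [intros hz; now apply derive_within_iff, h2|].
  split; [intros hz; now apply derive_within_iff, h3|].
  intros hz; destruct (h4 hz) as [hc [hp hn]].
  apply Sigma_c_iff in hc; split; [apply hc|].
  rewrite Xf_eq in *; destruct (Rtotal_order (yc (g t)) 0) as [hy|[hy|hy]].
  + specialize (hn hy); apply within_eps in hn; destruct hn as [d [hd hn]].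
    exists d; split; [exact hd|]; intros s hs hst; destruct (hn s hs hst) as [k1 k2].
    split; intros hlt; [specialize (k1 hlt)|specialize (k2 hlt)]; nra.
  + exfalso; rewrite hy in hc; lra.
  + specialize (hp hy); apply within_eps in hp; destruct hp as [d [hd hp]].
    exists d; split; [exact hd|]; intros s hs hst; destruct (hp s hs hst) as [k1 k2].
    split; intros hlt; [specialize (k1 hlt)|specialize (k2 hlt)]; nra.
- destruct h as [h1 [h2 [h3 h4]]].
  split; [now apply cont3_iff|]; split; [intros hz; now apply derive_within_iff, h2|].
  split; [intros hz; now apply derive_within_iff, h3|].
  intros hz; destruct (h4 hz) as [hc [d [hd hs]]].
  split; [now apply Sigma_c_iff|]; rewrite Xf_eq.
  split; intros hy; apply within_eps; exists d; (split; [exact hd|]);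
    intros s hI' hst; destruct (hs s hI' hst) as [k1 k2];
    split; intros hlt; [specialize (k1 hlt)|specialize (k2 hlt)|
      specialize (k1 hlt)|specialize (k2 hlt)]; nra.
Qed.

(** ** Locality, translation in time, symmetry *)

(** Everything required at a time depends on the germ of the curve only; the
    set of times may shrink and time may be translated. *)
Lemma traj_at_transport (mu H : R) (I J : R -> Prop) (g h : R -> R3) (t c r : R) :
  0 < r -> J t ->
  (forall s, J s -> Rabs (s - t) < r -> I (s + c) /\ h s = g (s + c)) ->
  traj_at mu H I g (t + c) -> traj_at mu H J h t.
Proof.
intros hr hJ hl.
destruct (hl t hJ ltac:(rewrite Rminus_diag, Rabs_R0; exact hr)) as [hI ht].
assert (hpt : forall (Q : R -> Prop) (d : R), 0 < d ->
  (forall s, I s -> Rabs (s - (t + c)) < d -> Q s) ->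
  exists del, 0 < del /\ forall s, J s -> Rabs (s - t) < del ->
    Q (s + c) /\ h s = g (s + c)).
{ intros Q d hd hQ; exists (Rmin d r); split; [now apply Rmin_glb_lt|].
  intros s hs hst; destruct (hl s hs) as [k1 k2];
    [eapply Rlt_le_trans; [exact hst|apply Rmin_r]|].
  split; [|exact k2]; apply hQ; [exact k1|].
  replace (s + c - (t + c)) with (s - t) by ring.
  eapply Rlt_le_trans; [exact hst|apply Rmin_l]. }
assert (hcont : forall k : R3 -> R, cont_in I (fun s => k (g s)) (t + c) ->
  cont_in J (fun s => k (h s)) t).
{ intros k hk eps he; destruct (hk eps he) as [d [hd h']].
  destruct (hpt _ d hd h') as [d' [hd' h'']]; exists d'; split; [exact hd'|].
  intros s hs hst; destruct (h'' s hs hst) as [k1 k2]; now rewrite ht, k2. }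
assert (hder : forall (k : R3 -> R) v, deriv_in I (fun s => k (g s)) (t + c) v ->
  deriv_in J (fun s => k (h s)) t v).
{ intros k v hk eps he; destruct (hk eps he) as [d [hd h']].
  destruct (hpt _ d hd h') as [d' [hd' h'']]; exists d'; split; [exact hd'|].
  intros s hs hst; destruct (h'' s hs hst) as [k1 k2]; rewrite ht, k2.
  replace (s - t) with (s + c - (t + c)) by ring; exact k1. }
unfold traj_at, cont3_in, derives_in; rewrite ht.
intros [[c1 [c2 c3]] [h2 [h3 h4]]].
split; [split; [now apply hcont|split; now apply hcont]|].
split; [intros hz; destruct (h2 hz) as [d1 [d2 d3]];
        split; [now apply hder|split; now apply hder]|].
split; [intros hz; destruct (h3 hz) as [d1 [d2 d3]];
        split; [now apply hder|split; now apply hder]|].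
intros hz; destruct (h4 hz) as [k [d [hd hc]]]; split; [exact k|].
destruct (hpt _ d hd hc) as [d' [hd' h'']]; exists d'; split; [exact hd'|].
intros s hs hst; destruct (h'' s hs hst) as [[k1 k2] k3]; rewrite ht, k3.
split; intros hlt; [apply k1|apply k2]; lra.
Qed.

Lemma traj_at_mono (mu H : R) (I J : R -> Prop) (g : R -> R3) (t : R) :
  J t -> (forall s, J s -> I s) -> traj_at mu H I g t -> traj_at mu H J g t.
Proof.
intros hJ hIJ h; apply (traj_at_transport mu H I J g g t 0 1); [lra|exact hJ| |].
- intros s hs _; rewrite Rplus_0_r; auto.
- now rewrite Rplus_0_r.
Qed.

Lemma deriv_in_opp (I : R -> Prop) (f : R -> R) (t v : R) :
  deriv_in I f t v -> deriv_in I (fun s => - f s) t (- v).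
Proof.
intros h eps he; destruct (h eps he) as [d [hd h']]; exists d; split; [exact hd|].
intros s hs hst.
replace (- f s - - f t - (s - t) * - v) with (- (f s - f t - (s - t) * v)) by ring.
rewrite Rabs_Ropp; auto.
Qed.

Lemma xc_S (p : R3) : xc (Sinv p) = - yc p. Proof. reflexivity. Qed.
Lemma yc_S (p : R3) : yc (Sinv p) = - xc p. Proof. reflexivity. Qed.
Lemma zc_S (p : R3) : zc (Sinv p) = - zc p. Proof. reflexivity. Qed.

Lemma Y_S (mu H : R) (p : R3) : Y mu H (Sinv p) = Sinv (X mu H p).
Proof. unfold Y; now rewrite Sinv_invol. Qed.

Lemma X_S (mu H : R) (p : R3) : X mu H (Sinv p) = Sinv (Y mu H p).
Proof. unfold Y; now rewrite Sinv_invol. Qed.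

(** The symmetry exchanges the two fields and the two directions of crossing:
    it reduces lower arcs to upper arcs throughout. *)
Lemma traj_at_S (mu H : R) (I : R -> Prop) (g : R -> R3) (t : R) :
  traj_at mu H I g t -> traj_at mu H I (fun s => Sinv (g s)) t.
Proof.
intros [[c1 [c2 c3]] [h2 [h3 h4]]].
split; [split; [now apply cont_in_opp|split; now apply cont_in_opp]|].
rewrite !zc_S, X_S, Y_S.
split; [intros hz; destruct (h3 ltac:(lra)) as [d1 [d2 d3]];
  split; [now apply deriv_in_opp|split; now apply deriv_in_opp]|].
split; [intros hz; destruct (h2 ltac:(lra)) as [d1 [d2 d3]];
  split; [now apply deriv_in_opp|split; now apply deriv_in_opp]|].
intros hz; destruct (h4 ltac:(lra)) as [k [d [hd hc]]].
rewrite xc_S, yc_S; split; [nra|].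
exists d; split; [exact hd|]; intros s hs hst; destruct (hc s hs hst) as [k1 k2].
rewrite yc_S, zc_S.
(* [xc] and [yc] have the same sign on the crossing region *)
assert (hsg : (0 < xc (g t) /\ 0 < yc (g t)) \/ (xc (g t) < 0 /\ yc (g t) < 0)).
{ destruct (Rtotal_order (xc (g t)) 0) as [e|[e|e]]; [right|rewrite e in k; lra|left];
    split; nra. }
split; intros hlt; [specialize (k1 hlt)|specialize (k2 hlt)];
  destruct hsg as [[? ?]|[? ?]].
- assert (zc (g s) < 0) by nra; nra.
- assert (zc (g s) > 0) by nra; nra.
- assert (zc (g s) > 0) by nra; nra.
- assert (zc (g s) < 0) by nra; nra.
Qed.

Lemma traj_at_S_shift (mu H c : R) (I : R -> Prop) (g : R -> R3) :
  (forall t, I t -> traj_at mu H I g t) ->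
  forall t, I (t + c) ->
    traj_at mu H (fun s => I (s + c)) (fun s => Sinv (g (s + c))) t.
Proof.
intros h t ht; apply traj_at_S.
apply (traj_at_transport mu H I _ g _ t c 1); [lra|exact ht| |now apply h].
now intros s hs _.
Qed.

(** ** Uniqueness *)

Lemma deriv_in_interior (I : R -> Prop) (f : R -> R) (t v r : R) :
  0 < r -> (forall s, Rabs (s - t) < r -> I s) ->
  deriv_in I f t v -> is_derive f t v.
Proof.
intros hr hI h; apply is_derive_deriv_in; intros eps he.
destruct (h eps he) as [d [hd h']]; exists (Rmin d r); split;
  [now apply Rmin_glb_lt|].
intros s _ hst; apply h'.
- apply hI; eapply Rlt_le_trans; [exact hst|apply Rmin_r].
- eapply Rlt_le_trans; [exact hst|apply Rmin_l].
Qed.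

Lemma upper_segment_unique (mu H : R) (I : R -> Prop) (g h : R -> R3) (a b : R) :
  a <= b -> (forall t, a <= t <= b -> I t) ->
  (forall t, I t -> traj_at mu H I g t) -> (forall t, I t -> traj_at mu H I h t) ->
  (forall t, a < t < b -> zc (g t) > 0) -> (forall t, a < t < b -> zc (h t) > 0) ->
  (g a = h a <-> g b = h b).
Proof.
intros hab hI hg hh zg zh.
assert (hs : forall k : R -> R3, (forall t, I t -> traj_at mu H I k t) ->
  (forall t, a < t < b -> zc (k t) > 0) ->
  forall t, a < t < b -> solves_at mu H k t).
{ intros k hk zk t ht; destruct (hk t (hI t ltac:(lra))) as [_ [hd _]].
  destruct (hd (zk t ht)) as [d1 [d2 d3]].
  assert (hr : 0 < Rmin (t - a) (b - t)) by (apply Rmin_glb_lt; lra).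
  assert (hin : forall s, Rabs (s - t) < Rmin (t - a) (b - t) -> I s).
  { intros s hst; apply hI; apply Rabs_lt_between' in hst.
    generalize (Rmin_l (t - a) (b - t)) (Rmin_r (t - a) (b - t)); lra. }
  split; [|split]; eapply deriv_in_interior; eassumption. }
assert (hc : forall k : R -> R3, (forall t, I t -> traj_at mu H I k t) ->
  forall t, a <= t <= b -> cont3_in (fun s => a <= s <= b) k t).
{ intros k hk t ht; destruct (hk t (hI t ht)) as [[c1 [c2 c3]] _].
  split; [|split]; now apply (cont_in_mono I). }
apply (solution_unique mu H); auto.
Qed.

Lemma Sinv_inj (p q : R3) : Sinv p = Sinv q -> p = q.
Proof. intros h; rewrite <- (Sinv_invol p), h; apply Sinv_invol. Qed.

Lemma lower_segment_unique (mu H : R) (I : R -> Prop) (g h : R -> R3) (a b : R) :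
  a <= b -> (forall t, a <= t <= b -> I t) ->
  (forall t, I t -> traj_at mu H I g t) -> (forall t, I t -> traj_at mu H I h t) ->
  (forall t, a < t < b -> zc (g t) < 0) -> (forall t, a < t < b -> zc (h t) < 0) ->
  (g a = h a <-> g b = h b).
Proof.
intros hab hI hg hh zg zh.
assert (e := upper_segment_unique mu H I (fun s => Sinv (g s)) (fun s => Sinv (h s))
  a b hab hI (fun t ht => traj_at_S _ _ _ _ _ (hg t ht))
  (fun t ht => traj_at_S _ _ _ _ _ (hh t ht))
  ltac:(intros t ht; cbv beta; rewrite zc_S; specialize (zg t ht); lra)
  ltac:(intros t ht; cbv beta; rewrite zc_S; specialize (zh t ht); lra)).
split; intros k; apply Sinv_inj, e; now f_equal.
Qed.

Definition convex (I : R -> Prop) : Prop :=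
  forall a b c, I a -> I c -> a <= b <= c -> I b.

Lemma cont_in_pos (I : R -> Prop) (f : R -> R) (t : R) :
  cont_in I f t -> f t > 0 ->
  exists d, 0 < d /\ forall s, I s -> Rabs (s - t) < d -> f s > 0.
Proof.
intros h hp; destruct (h (f t) hp) as [d [hd h']].
exists d; split; [exact hd|]; intros s hs hst; specialize (h' s hs hst).
apply Rabs_lt_between' in h'; lra.
Qed.

Lemma segment_within (I : R -> Prop) (t r d1 d2 : R) :
  convex I -> I t -> I r -> Rabs (r - t) < Rmin d1 d2 ->
  forall s, (r <= s <= t \/ t <= s <= r) ->
    I s /\ Rabs (s - t) < d1 /\ Rabs (s - t) < d2.
Proof.
intros hcv hI hr hrt s hs.
assert (l1 := Rlt_le_trans _ _ _ hrt (Rmin_l _ _)).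
assert (l2 := Rlt_le_trans _ _ _ hrt (Rmin_r _ _)).
split; [destruct hs as [hs|hs]; [apply (hcv r s t)|apply (hcv t s r)]; auto|].
apply Rabs_lt_between' in l1; apply Rabs_lt_between' in l2.
split; apply Rabs_lt_between'; lra.
Qed.

(** At a crossing point the two trajectories agree on both sides: they enter
    [z > 0] together and have left [z < 0] together. *)
Lemma local_unique_up (mu H : R) (I : R -> Prop) (g h : R -> R3) (t : R) :
  convex I -> I t ->
  (forall t, I t -> traj_at mu H I g t) -> (forall t, I t -> traj_at mu H I h t) ->
  g t = h t -> (zc (g t) > 0 \/ (zc (g t) = 0 /\ yc (g t) > 0)) ->
  exists d, 0 < d /\ forall r, I r -> Rabs (r - t) < d -> g r = h r.
Proof.
intros hcv hI hg hh e [hz|[hz hy]].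
- destruct (hg t hI) as [[_ [_ cg]] _]; destruct (hh t hI) as [[_ [_ ch]] _].
  destruct (cont_in_pos _ _ _ cg hz) as [d1 [hd1 h1]].
  rewrite e in hz.
  destruct (cont_in_pos _ _ _ ch hz) as [d2 [hd2 h2]].
  exists (Rmin d1 d2); split; [now apply Rmin_glb_lt|]; intros r hr hrt.
  assert (hseg := segment_within I t r d1 d2 hcv hI hr hrt).
  destruct (Rle_lt_dec r t) as [hle|hlt].
  + apply (upper_segment_unique mu H I g h r t hle); auto; intros s hs;
      destruct (hseg s ltac:(lra)) as [? [? ?]]; auto.
  + apply (upper_segment_unique mu H I g h t r ltac:(lra)); auto; intros s hs;
      destruct (hseg s ltac:(lra)) as [? [? ?]]; auto.
- destruct (hg t hI) as [_ [_ [_ cg]]]; destruct (hh t hI) as [_ [_ [_ ch]]].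
  destruct (cg hz) as [_ [d1 [hd1 h1]]].
  rewrite e in hz, hy; destruct (ch hz) as [_ [d2 [hd2 h2]]].
  exists (Rmin d1 d2); split; [now apply Rmin_glb_lt|]; intros r hr hrt.
  assert (hseg := segment_within I t r d1 d2 hcv hI hr hrt).
  rewrite e in h1.
  destruct (Rle_lt_dec r t) as [hle|hlt].
  + apply (lower_segment_unique mu H I g h r t hle); auto; intros s hs.
    * apply hseg; lra.
    * destruct (hseg s ltac:(lra)) as [? [? ?]].
      destruct (h1 s) as [k _]; auto; specialize (k ltac:(lra)); nra.
    * destruct (hseg s ltac:(lra)) as [? [? ?]].
      destruct (h2 s) as [k _]; auto; specialize (k ltac:(lra)); nra.
  + apply (upper_segment_unique mu H I g h t r ltac:(lra)); auto; intros s hs.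
    * apply hseg; lra.
    * destruct (hseg s ltac:(lra)) as [? [? ?]].
      destruct (h1 s) as [_ k]; auto; specialize (k ltac:(lra)); nra.
    * destruct (hseg s ltac:(lra)) as [? [? ?]].
      destruct (h2 s) as [_ k]; auto; specialize (k ltac:(lra)); nra.
Qed.

Lemma local_unique (mu H : R) (I : R -> Prop) (g h : R -> R3) (t : R) :
  convex I -> I t ->
  (forall t, I t -> traj_at mu H I g t) -> (forall t, I t -> traj_at mu H I h t) ->
  g t = h t ->
  exists d, 0 < d /\ forall r, I r -> Rabs (r - t) < d -> g r = h r.
Proof.
intros hcv hI hg hh e.
assert (hsg : (zc (g t) > 0 \/ (zc (g t) = 0 /\ yc (g t) > 0)) \/
  (zc (Sinv (g t)) > 0 \/ (zc (Sinv (g t)) = 0 /\ yc (Sinv (g t)) > 0))).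
{ rewrite zc_S, yc_S.
  destruct (Rtotal_order (zc (g t)) 0) as [hz|[hz|hz]];
    [right; left; lra| |left; left; lra].
  destruct (hg t hI) as [_ [_ [_ c]]]; destruct (c hz) as [hc _].
  destruct (Rtotal_order (yc (g t)) 0) as [hy|[hy|hy]];
    [right; right; nra|rewrite hy in hc; lra|left; right; lra]. }
destruct hsg as [hup|hdown]; [now apply (local_unique_up mu H I g h t)|].
destruct (local_unique_up mu H I (fun s => Sinv (g s)) (fun s => Sinv (h s)) t)
  as [d [hd hk]]; auto using traj_at_S; [now rewrite e|].
exists d; split; [exact hd|]; intros r hr hrt; apply Sinv_inj; auto.
Qed.

Lemma cont_in_neq (I : R -> Prop) (f k : R -> R) (t : R) :
  cont_in I f t -> cont_in I k t -> f t <> k t ->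
  exists d, 0 < d /\ forall r, I r -> Rabs (r - t) < d -> f r <> k r.
Proof.
intros hf hk hne.
assert (he : 0 < Rabs (f t - k t) / 2)
  by (apply Rdiv_lt_0_compat; [apply Rabs_pos_lt|]; lra).
destruct (hf _ he) as [d1 [hd1 h1]], (hk _ he) as [d2 [hd2 h2]].
exists (Rmin d1 d2); split; [now apply Rmin_glb_lt|]; intros r hr hrt e.
specialize (h1 r hr (Rlt_le_trans _ _ _ hrt (Rmin_l _ _))).
specialize (h2 r hr (Rlt_le_trans _ _ _ hrt (Rmin_r _ _))).
rewrite e in h1; revert he h1 h2.
unfold Rabs; repeat destruct Rcase_abs; lra.
Qed.

(** Agreement of two trajectories is locally constant in time, whichever sides
    of the section they are on. *)
Lemma crossing_trajectory_unique (mu H : R) (I : R -> Prop) (g h : R -> R3) (a : R) :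
  convex I -> I a ->
  (forall t, I t -> traj_at mu H I g t) -> (forall t, I t -> traj_at mu H I h t) ->
  g a = h a -> forall t, I t -> g t = h t.
Proof.
intros hcv ha hg hh e.
assert (hloc : forall s, I s -> exists d, 0 < d /\
  forall r, I r -> Rabs (r - s) < d -> (g r = h r <-> g s = h s)).
{ intros s hs; destruct (excluded_middle_informative (g s = h s)) as [es|ns].
  - destruct (local_unique mu H I g h s hcv hs hg hh es) as [d [hd hk]].
    exists d; split; [exact hd|]; intros r hr hrs; split; auto.
  - destruct (hg s hs) as [[g1 [g2 g3]] _], (hh s hs) as [[h1 [h2 h3]] _].
    assert (hn : exists c : R3 -> R, cont_in I (fun r => c (g r)) s /\
      cont_in I (fun r => c (h r)) s /\ c (g s) <> c (h s)).
    { destruct (Req_dec (xc (g s)) (xc (h s))); [|now exists xc].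
      destruct (Req_dec (yc (g s)) (yc (h s))); [|now exists yc].
      exists zc; split; [exact g3|split; [exact h3|]].
      intros ez; apply ns; now apply R3_eq. }
    destruct hn as [c [cg [ch hn]]].
    destruct (cont_in_neq _ _ _ _ cg ch hn) as [d [hd hk]]; exists d.
    split; [exact hd|]; intros r hr hrs; split; intros er; [exfalso|tauto].
    apply (hk r hr hrs); now rewrite er. }
intros t ht.
destruct (Rle_lt_dec a t) as [hle|hlt].
- apply (locally_constant_interval (fun s => g s = h s) a t); auto.
  intros s hs; destruct (hloc s (hcv a s t ha ht hs)) as [d [hd hk]].
  exists d; split; [exact hd|]; intros r hr; apply hk; now apply (hcv a r t).
- apply (locally_constant_interval (fun s => g s = h s) t a); auto; [lra|].
  intros s hs; destruct (hloc s (hcv t s a ht ha hs)) as [d [hd hk]].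
  exists d; split; [exact hd|]; intros r hr; apply hk; now apply (hcv t r a).
Qed.

(** ** Following and gluing arcs *)

(** On the section, [X] points upwards where [0 < yc p], and the crossing
    condition then requires [0 < xc p]. *)
Definition up_start (p : R3) : Prop :=
  zc p > 0 \/ (zc p = 0 /\ 0 < xc p /\ 0 < yc p).

Lemma flow_traj (mu H b : R) (p : R3) : up_start p ->
  (forall s, 0 < s < b -> 0 < zc (flow mu H p s)) ->
  forall t, 0 <= t < b -> traj_at mu H (fun s => 0 <= s) (flow mu H p) t.
Proof.
intros hp hpos t ht.
assert (hsol := flow_solves mu H p t).
split; [now apply (solves_cont mu H)|].
assert (hz : 0 <= zc (flow mu H p t)).
{ destruct (Req_dec t 0) as [->|hne]; [|left; apply hpos; lra].
  rewrite flow_0; destruct hp as [?|[? _]]; lra. }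
split; [|split; [lra|]].
- intros _; destruct hsol as [h1 [h2 h3]].
  assert (hmono : forall f v, is_derive f t v -> deriv_in (fun s => 0 <= s) f t v).
  { intros f v hf; apply is_derive_deriv_in in hf; intros eps he.
    destruct (hf eps he) as [d [hd hk]]; exists d; auto. }
  split; [now apply hmono|split; now apply hmono].
- intros h0; assert (t = 0); [|subst t].
  { destruct (Req_dec t 0) as [e|hne]; [exact e|].
    specialize (hpos t ltac:(lra)); lra. }
  rewrite flow_0 in *; destruct hp as [hp|[_ [hx hy]]]; [lra|].
  split; [nra|]; exists b; split; [lra|]; intros s hs hst.
  rewrite flow_0; split; intros hlt; [lra|].
  rewrite Rminus_0_r, Rabs_pos_eq in hst by lra.
  specialize (hpos s ltac:(lra)); nra.
Qed.

(** The flow is itself a trajectory up to its landing, where it might fail to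
    cross; the landing point is reached by continuity. *)
Lemma follow_flow (mu H b : R) (I : R -> Prop) (g : R -> R3) :
  0 <= b -> (forall t, 0 <= t <= b -> I t) ->
  (forall t, I t -> traj_at mu H I g t) ->
  up_start (g 0) -> (forall s, 0 < s < b -> 0 < zc (flow mu H (g 0) s)) ->
  forall t, 0 <= t <= b -> g t = flow mu H (g 0) t.
Proof.
intros hb hI hg hup hpos.
assert (hopen : forall t, 0 <= t < b -> g t = flow mu H (g 0) t).
{ intros t ht.
  apply (crossing_trajectory_unique mu H (fun s => 0 <= s < b) g
           (flow mu H (g 0)) 0); try lra.
  - intros x y z hx hz hy; lra.
  - intros s hs; apply (traj_at_mono mu H I); [lra| |apply hg, hI; lra].
    intros r hr; apply hI; lra.
  - intros s hs; apply (traj_at_mono mu H (fun s => 0 <= s)); [lra|intros; lra|].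
    now apply (flow_traj mu H b).
  - now rewrite flow_0. }
intros t ht; destruct (Req_dec t b) as [->|hne]; [|apply hopen; lra].
destruct (Req_dec b 0) as [->|hb0]; [now rewrite flow_0|].
destruct (hg b (hI b ltac:(lra))) as [[g1 [g2 g3]] _].
destruct (solves_cont mu H I (flow mu H (g 0)) b (flow_solves _ _ _ _))
  as [f1 [f2 f3]].
assert (hlim : forall c : R3 -> R, cont_in I (fun s => c (g s)) b ->
  cont_in I (fun s => c (flow mu H (g 0) s)) b ->
  c (g b) = c (flow mu H (g 0) b)).
{ intros c hc hf; destruct (Req_dec (c (g b)) (c (flow mu H (g 0) b))) as [e|hn];
    [exact e|exfalso].
  destruct (cont_in_neq _ _ _ _ hc hf hn) as [d [hd hk]].
  set (r := Rmax 0 (b - d / 2)).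
  assert (hr : 0 <= r < b /\ Rabs (r - b) < d).
  { assert (hr0 : 0 <= r) by apply Rmax_l.
    assert (hr1 : b - d / 2 <= r) by apply Rmax_r.
    assert (hr2 : r < b) by (apply Rmax_lub_lt; lra).
    split; [lra|]; rewrite Rabs_left1; lra. }
  apply (hk r); [apply hI; lra|lra|]; now rewrite hopen. }
now apply R3_eq; apply hlim.
Qed.

(** Where a piece in [z < 0] takes over from an upper arc: the symmetry turns
    it into a trajectory [h] that starts in the positive quadrant. *)
Definition glue (sigma : R) (c h : R -> R3) (t : R) : R3 :=
  if Rle_dec t sigma then c t else Sinv (h (t - sigma)).

Lemma glue_left (sigma : R) (c h : R -> R3) (t : R) :
  t <= sigma -> glue sigma c h t = c t.
Proof. intros ht; unfold glue; destruct Rle_dec; [easy|lra]. Qed.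

Lemma glue_right (sigma : R) (c h : R -> R3) (t : R) :
  c sigma = Sinv (h 0) -> sigma <= t -> glue sigma c h t = Sinv (h (t - sigma)).
Proof.
intros hc ht; unfold glue; destruct Rle_dec; [|easy].
replace t with sigma by lra; now rewrite Rminus_diag.
Qed.

Definition posq (q : R2) : Prop := 0 < fst q /\ 0 < snd q.

Lemma posq_up (q : R2) : posq q -> up_start (emb q).
Proof. intros [h1 h2]; right; destruct (emb_coords q) as [-> [-> ->]]; lra. Qed.

Lemma glue_traj (mu H sigma b : R) (p : R3) (q : R2) (h : R -> R3) :
  up_start p -> 0 < sigma -> 0 < b ->
  (forall s, 0 < s < sigma -> 0 < zc (flow mu H p s)) ->
  flow mu H p sigma = Sinv (emb q) -> posq q -> h 0 = emb q ->
  (forall t, 0 <= t < b -> traj_at mu H (fun s => 0 <= s) h t) ->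
  forall t, 0 <= t < sigma + b ->
    traj_at mu H (fun s => 0 <= s) (glue sigma (flow mu H p) h) t.
Proof.
intros hp hs hb hpos hland hq h0 hh t ht.
assert (hglue : flow mu H p sigma = Sinv (h 0)) by (now rewrite hland, h0).
destruct (Rtotal_order t sigma) as [hlt|[->|hgt]].
- apply (traj_at_transport mu H (fun s => 0 <= s) _ (flow mu H p) _ t 0 (sigma - t));
    [lra|lra| |rewrite Rplus_0_r; apply (flow_traj mu H sigma); auto; lra].
  intros s hs' hst; rewrite Rplus_0_r; split; [exact hs'|].
  apply Rabs_lt_between' in hst; apply glue_left; lra.
- assert (hcont : forall c : R3 -> R,
    cont_in (fun _ => True) (fun s => c (flow mu H p s)) sigma ->
    cont_in (fun s => 0 <= s) (fun s => c (Sinv (h s))) 0 ->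
    cont_in (fun s => 0 <= s) (fun s => c (glue sigma (flow mu H p) h s)) sigma).
  { intros c h1 h2 eps he; destruct (h1 eps he) as [d1 [hd1 k1]].
    destruct (h2 eps he) as [d2 [hd2 k2]].
    exists (Rmin d1 d2); split; [now apply Rmin_glb_lt|]; intros s hs' hst.
    rewrite (glue_left sigma _ _ sigma) by lra.
    destruct (Rle_lt_dec s sigma) as [hle|hlt].
    - rewrite glue_left by lra; apply k1; [trivial|].
      eapply Rlt_le_trans; [exact hst|apply Rmin_l].
    - rewrite glue_right, hglue by (auto; lra); apply k2; [lra|].
      rewrite Rminus_0_r; eapply Rlt_le_trans; [exact hst|apply Rmin_r]. }
  destruct (solves_cont mu H (fun _ => True) (flow mu H p) sigma
              (flow_solves _ _ _ _)) as [f1 [f2 f3]].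
  assert (hS := traj_at_S _ _ _ _ _ (hh 0 ltac:(lra))).
  destruct hS as [[c1 [c2 c3]] _].
  split; [split; [now apply hcont|split; now apply hcont]|].
  rewrite glue_left, hland by lra.
  destruct (emb_coords q) as [e1 [e2 e3]]; destruct hq as [hq1 hq2].
  rewrite xc_S, yc_S, zc_S, e1, e2, e3.
  split; [lra|split; [lra|]]; intros _; split; [nra|].
  destruct (hh 0 ltac:(lra)) as [_ [_ [_ hc]]]; rewrite h0, e3 in hc.
  destruct (hc eq_refl) as [_ [d [hd hk]]].
  exists (Rmin d sigma); split; [now apply Rmin_glb_lt|]; intros s hs' hst.
  assert (l1 := Rlt_le_trans _ _ _ hst (Rmin_l _ _)).
  assert (l2 := Rlt_le_trans _ _ _ hst (Rmin_r _ _)).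
  rewrite (glue_left _ _ _ sigma), hland, yc_S, e1 by lra.
  apply Rabs_lt_between' in l2.
  split; intros hlt.
  + rewrite glue_left by lra; specialize (hpos s ltac:(lra)); nra.
  + rewrite glue_right, zc_S by (auto; lra).
    destruct (hk (s - sigma) ltac:(lra) ltac:(now rewrite Rminus_0_r)) as [_ k].
    specialize (k ltac:(lra)); rewrite h0, e2 in k.
    assert (0 < zc (h (s - sigma))) by nra; nra.
- assert (hS := traj_at_S _ _ _ _ _ (hh (t + - sigma) ltac:(lra))).
  apply (traj_at_transport mu H (fun s => 0 <= s) _ (fun s => Sinv (h s)) _ t
           (- sigma) (t - sigma)); [lra|lra| |exact hS].
  intros s hs' hst; apply Rabs_lt_between' in hst; split; [lra|].
  apply glue_right; [exact hglue|lra].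
Qed.

(** * Planar linear maps of spectral radius less than one *)

Definition companion (b e T : R) (h : R2) : R2 := (b * snd h, - e * fst h + T * snd h).

Definition sub2 (p q : R2) : R2 := (fst p - fst q, snd p - snd q).
Definition add2 (p q : R2) : R2 := (fst p + fst q, snd p + snd q).
Definition sq2 (h : R2) : R := fst h ^ 2 + snd h ^ 2.

(** A positive definite quadratic form contracted by [L]; the clause on [add2]
    is the convexity estimate that stands for the triangle inequality. *)
Definition lyapunov (L : R2 -> R2) (Q : R2 -> R) (kappa c C : R) : Prop :=
  0 < kappa < 1 /\ 0 < c /\ 0 < C /\
  (forall h, Q (L h) <= kappa * Q h) /\
  (forall h k s, 0 < s -> Q (add2 h k) <= (1 + s) * Q h + (1 + / s) * Q k) /\
  (forall h, c * sq2 h <= Q h <= C * sq2 h).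

(** Along an orbit of the companion recursion, with consecutive second
    coordinates [v] and [w], this form drops by a square at each step as long as
    Jury's conditions hold; they still hold for the map divided by some
    [k < 1], which makes the contraction strict. *)
Lemma companion_lyapunov (b e T : R) : 0 < e -> 0 < b * e < 1 ->
  Rabs T < 1 + b * e -> exists Q kappa c C, lyapunov (companion b e T) Q kappa c C.
Proof.
intros he hD hT; set (D := b * e) in *.
set (d := Rmin ((1 + D - Rabs T) / 4) ((1 - D) / 4)).
assert (hd0 : 0 < d) by (apply Rmin_glb_lt; lra).
assert (hd1 : d <= (1 + D - Rabs T) / 4) by apply Rmin_l.
assert (hd2 : d <= (1 - D) / 4) by apply Rmin_r.
set (k := 1 - d); assert (hTp := Rabs_pos T).
assert (hk : 0 < k < 1) by (unfold k; lra).
assert (hkD : D < k ^ 2) by (unfold k; nra).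
assert (hkT : Rabs T * k < k ^ 2 + D) by (unfold k; nra).
set (Qf := fun v w => (k ^ 2 + D) * (k ^ 2 * v ^ 2 + w ^ 2) - 2 * T * k ^ 2 * v * w).
set (W := fun h : R2 => - e * fst h + T * snd h).
set (m := (k ^ 2 + D - Rabs T * k) * k ^ 2).
assert (hm : 0 < m) by (unfold m; apply Rmult_lt_0_compat; nra).
assert (hlow : forall v w, m * (v ^ 2 + w ^ 2) <= Qf v w).
{ intros v w; unfold Qf, m.
  assert (hvw : 2 * T * k ^ 2 * v * w <= Rabs T * k * (k ^ 2 * v ^ 2 + w ^ 2)).
  { unfold Rabs; destruct Rcase_abs as [h|h].
    - assert (0 <= - T * k * (k * v + w) ^ 2)
        by (apply Rmult_le_pos; [nra|apply pow2_ge_0]); lra.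
    - assert (0 <= T * k * (k * v - w) ^ 2)
        by (apply Rmult_le_pos; [nra|apply pow2_ge_0]); lra. }
  assert (0 < k ^ 2 + D - Rabs T * k) by lra.
  assert (k ^ 2 * (v ^ 2 + w ^ 2) <= k ^ 2 * v ^ 2 + w ^ 2).
  { assert (0 <= (1 - k ^ 2) * w ^ 2)
      by (apply Rmult_le_pos; [nra|apply pow2_ge_0]); nra. }
  assert ((k ^ 2 + D - Rabs T * k) * (k ^ 2 * (v ^ 2 + w ^ 2))
          <= (k ^ 2 + D - Rabs T * k) * (k ^ 2 * v ^ 2 + w ^ 2))
    by (apply Rmult_le_compat_l; lra).
  nra. }
set (c := m / (1 + 2 * (T ^ 2 + 1) / e ^ 2)).
assert (he2 : 0 < e ^ 2) by nra.
assert (hM : 0 < 1 + 2 * (T ^ 2 + 1) / e ^ 2).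
{ assert (0 < 2 * (T ^ 2 + 1) / e ^ 2) by (apply Rdiv_lt_0_compat; nra); lra. }
exists (fun h => Qf (snd h) (W h)), (k ^ 2), c,
  (4 * (1 + Rabs T) * (1 + 2 * (e ^ 2 + T ^ 2))).
split; [nra|split; [unfold c; now apply Rdiv_lt_0_compat|split; [|split; [|split]]]].
- apply Rmult_lt_0_compat; nra.
- intros [x y]; unfold companion, W; simpl fst; simpl snd; unfold Qf.
  set (w := - e * x + T * y).
  replace (- e * (b * y) + T * w) with (T * w - D * y) by (unfold D; ring).
  assert (0 <= (k ^ 2 - D) * (T * w - (k ^ 2 + D) * y) ^ 2)
    by (apply Rmult_le_pos; [lra|apply pow2_ge_0]).
  lra.
- intros [x y] [x' y'] s hs; unfold add2, W; simpl fst; simpl snd.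
  replace (- e * (x + x') + T * (y + y'))
    with ((- e * x + T * y) + (- e * x' + T * y')) by ring.
  set (w := - e * x + T * y); set (w' := - e * x' + T * y').
  apply Rminus_le; apply Rmult_le_reg_l with s; [exact hs|].
  replace (s * (Qf (y + y') (w + w') - ((1 + s) * Qf y w + (1 + / s) * Qf y' w')))
    with (- Qf (s * y - y') (s * w - w')) by (unfold Qf; field; lra).
  assert (h0 := hlow (s * y - y') (s * w - w')).
  assert (0 <= m * ((s * y - y') ^ 2 + (s * w - w') ^ 2))
    by (apply Rmult_le_pos; [left; exact hm|apply Rplus_le_le_0_compat; apply pow2_ge_0]).
  lra.
- intros [x y]; unfold sq2, W; simpl fst; simpl snd.
  set (w := - e * x + T * y); split.
  + apply Rle_trans with (m * (y ^ 2 + w ^ 2)); [|apply hlow].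
    set (M := 1 + 2 * (T ^ 2 + 1) / e ^ 2) in *.
    apply Rle_trans with (m / M * (M * (y ^ 2 + w ^ 2))); [|right; field; lra].
    unfold c; apply Rmult_le_compat_l; [left; now apply Rdiv_lt_0_compat|].
    unfold M.
    assert (hx : x ^ 2 <= 2 * (T ^ 2 + 1) / e ^ 2 * (y ^ 2 + w ^ 2)).
    { apply Rmult_le_reg_r with (e ^ 2); [exact he2|].
      replace (2 * (T ^ 2 + 1) / e ^ 2 * (y ^ 2 + w ^ 2) * e ^ 2)
        with (2 * (T ^ 2 + 1) * (y ^ 2 + w ^ 2)) by (field; lra).
      replace (x ^ 2 * e ^ 2) with ((T * y - w) ^ 2) by (unfold w; ring).
      assert (0 <= (T * y + w) ^ 2) by apply pow2_ge_0.
      assert (0 <= (T * w) ^ 2) by apply pow2_ge_0.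
      assert (0 <= y ^ 2) by apply pow2_ge_0; nra. }
    assert (0 <= w ^ 2) by apply pow2_ge_0; nra.
  + assert (hTv : Rabs T ^ 2 = T ^ 2) by apply pow2_abs.
    assert (hk2 : 0 < k ^ 2 < 1) by nra.
    apply Rle_trans with (4 * (1 + Rabs T) * (y ^ 2 + w ^ 2)).
    * unfold Qf.
      assert (h1 : - (2 * (T * (y * w))) <= Rabs T * (y ^ 2 + w ^ 2)).
      { unfold Rabs; destruct Rcase_abs as [h|h].
        - assert (0 <= - T * (y - w) ^ 2)
            by (apply Rmult_le_pos; [lra|apply pow2_ge_0]); lra.
        - assert (0 <= T * (y + w) ^ 2)
            by (apply Rmult_le_pos; [lra|apply pow2_ge_0]); lra. }
      assert (hy2 : 0 <= y ^ 2) by apply pow2_ge_0.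
      assert (hw2 : 0 <= w ^ 2) by apply pow2_ge_0.
      assert (h3 : k ^ 2 * (- (2 * (T * (y * w)))) <= Rabs T * (y ^ 2 + w ^ 2)).
      { apply Rle_trans with (k ^ 2 * (Rabs T * (y ^ 2 + w ^ 2)));
          [apply Rmult_le_compat_l; lra|].
        assert (0 <= Rabs T * (y ^ 2 + w ^ 2)) by (apply Rmult_le_pos; lra); nra. }
      assert (h4 : (k ^ 2 + D) * (k ^ 2 * y ^ 2 + w ^ 2) <= 2 * (y ^ 2 + w ^ 2))
        by (apply Rmult_le_compat; nra).
      assert (0 <= Rabs T * (y ^ 2 + w ^ 2)) by (apply Rmult_le_pos; lra).
      nra.
    * rewrite (Rmult_assoc (4 * (1 + Rabs T))).
      apply Rmult_le_compat_l; [lra|].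
      assert (0 <= (e * x + T * y) ^ 2) by apply pow2_ge_0.
      assert (0 <= (e * y) ^ 2) by apply pow2_ge_0.
      assert (0 <= (T * x) ^ 2) by apply pow2_ge_0.
      assert (0 <= x ^ 2) by apply pow2_ge_0.
      unfold w; nra.
Qed.

(** ** Differentials of planar maps *)

Lemma filterdiff_pair (f1 f2 l1 l2 : R2 -> R) (p : R2) :
  filterdiff (K := R_AbsRing) (U := prod_NormedModule R_AbsRing R_NormedModule R_NormedModule)
    (V := R_NormedModule) f1 (locally p) l1 ->
  filterdiff (K := R_AbsRing) (U := prod_NormedModule R_AbsRing R_NormedModule R_NormedModule)
    (V := R_NormedModule) f2 (locally p) l2 ->
  is_differential (fun q => (f1 q, f2 q)) p (fun h => (l1 h, l2 h)).
Proof.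
intros [[a1 b1 [M1 [c1 d1]]] e1] [[a2 b2 [M2 [c2 d2]]] e2]; split.
- constructor.
  + intros x y; rewrite a1, a2; reflexivity.
  + intros k x; rewrite b1, b2; reflexivity.
  + exists (M1 + M2); split; [lra|]; intros x.
    eapply Rle_trans; [apply prod_norm_le|].
    rewrite Rmult_plus_distr_r; apply Rplus_le_compat; [apply d1|apply d2].
- intros x hx eps.
  assert (he : 0 < eps / 2) by (generalize (cond_pos eps); lra).
  specialize (e1 x hx (mkposreal _ he)); specialize (e2 x hx (mkposreal _ he)).
  generalize (filter_and _ _ e1 e2); apply filter_imp; intros y [h1 h2].
  eapply Rle_trans; [apply prod_norm_le|].
  eapply Rle_trans; [exact (Rplus_le_compat _ _ _ _ h1 h2)|].
  simpl pos; right; field.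
Qed.

Lemma is_differential_eps (f : R2 -> R2) (p : R2) (L : R2 -> R2) (eps : R) :
  is_differential f p L -> 0 < eps ->
  exists del, 0 < del /\ forall q,
    Rabs (fst q - fst p) < del -> Rabs (snd q - snd p) < del ->
    let r := sub2 (sub2 (f q) (f p)) (L (sub2 q p)) in
    let n := Rabs (fst q - fst p) + Rabs (snd q - snd p) in
    Rabs (fst r) <= eps * n /\ Rabs (snd r) <= eps * n.
Proof.
intros [_ h] he; specialize (h p (fun P hP => hP) (mkposreal eps he)).
destruct h as [d h]; exists d; split; [apply cond_pos|]; intros q h1 h2 r n.
specialize (h q (conj h1 h2)).
assert (hn : eps * norm (minus q p) <= eps * n).
{ apply Rmult_le_compat_l; [lra|]; exact (prod_norm_le (minus q p)). }
split; (eapply Rle_trans; [|exact hn]); (eapply Rle_trans; [|exact h]).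
- exact (prod_norm_fst (U := R_NormedModule) (V := R_NormedModule) r).
- exact (prod_norm_snd (U := R_NormedModule) (V := R_NormedModule) r).
Qed.

Lemma sub2_self_eq (f : R2 -> R2) (p q : R2) (L : R2 -> R2) : f p = p ->
  sub2 (f q) p = add2 (L (sub2 q p)) (sub2 (sub2 (f q) (f p)) (L (sub2 q p))).
Proof.
intros ->; destruct (f q), p, (L (sub2 q (r1, r2))); unfold add2, sub2; simpl.
f_equal; ring.
Qed.

Definition contracts (f : R2 -> R2) (p : R2) (Q : R2 -> R) (r kappa : R) : Prop :=
  0 < kappa < 1 /\ 0 < r /\
  forall q, Q (sub2 q p) < r -> Q (sub2 (f q) p) <= kappa * Q (sub2 q p).

(** By [Q (h + k) <= (1 + s) Q h + (1 + 1/s) Q k] the remainder costs a small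
    multiple of [Q], once [s] has been chosen with [(1 + s) kappa < 1]. *)
Lemma fixed_point_contraction (f : R2 -> R2) (p : R2) (L : R2 -> R2)
  (Q : R2 -> R) (kappa c C : R) :
  is_differential f p L -> f p = p -> lyapunov L Q kappa c C ->
  exists r kappa', contracts f p Q r kappa'.
Proof.
intros hd hf [hk [hc [hC [hL [hconv hQ]]]]].
set (s := (1 - kappa) / 2); assert (hs : 0 < s) by (unfold s; lra).
set (A := 4 * (1 + / s) * C / c).
assert (hs' : 0 < / s) by now apply Rinv_0_lt_compat.
assert (hA : 0 < A).
{ unfold A; apply Rdiv_lt_0_compat; [|exact hc]; apply Rmult_lt_0_compat; lra. }
set (eps := Rmin 1 ((1 - kappa) / (4 * A))).
assert (heps : 0 < eps).
{ apply Rmin_glb_lt; [lra|apply Rdiv_lt_0_compat; lra]. }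
assert (heps2 : A * eps ^ 2 <= (1 - kappa) / 4).
{ assert (h1 : eps <= 1) by apply Rmin_l.
  assert (h2 : eps <= (1 - kappa) / (4 * A)) by apply Rmin_r.
  apply Rle_trans with (A * eps); [apply Rmult_le_compat_l; [left; exact hA|nra]|].
  apply Rle_trans with (A * ((1 - kappa) / (4 * A)));
    [apply Rmult_le_compat_l; [left; exact hA|exact h2]|right; field].
  apply Rgt_not_eq; exact hA. }
destruct (is_differential_eps f p L eps hd heps) as [del [hdel h]].
exists (c * del ^ 2), ((3 + kappa) / 4).
split; [lra|split; [apply Rmult_lt_0_compat; [exact hc|now apply pow_lt]|]]; intros q hq.
set (n2 := sq2 (sub2 q p)).
assert (hn : n2 < del ^ 2).
{ apply Rmult_lt_reg_l with c; [exact hc|].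
  eapply Rle_lt_trans; [apply hQ|exact hq]. }
unfold n2, sq2, sub2 in hn; simpl fst in hn; simpl snd in hn.
assert (hb : forall a, a ^ 2 < del ^ 2 -> Rabs a < del).
{ intros a ha; apply Rabs_def1; nra. }
assert (h1 : Rabs (fst q - fst p) < del).
{ apply hb; generalize (pow2_ge_0 (snd q - snd p)); lra. }
assert (h2 : Rabs (snd q - snd p) < del).
{ apply hb; generalize (pow2_ge_0 (fst q - fst p)); lra. }
specialize (h q h1 h2); cbv zeta in h.
rewrite (sub2_self_eq f p q L hf).
set (rr := sub2 (sub2 (f q) (f p)) (L (sub2 q p))) in *.
set (n := Rabs (fst q - fst p) + Rabs (snd q - snd p)) in *.
eapply Rle_trans; [apply (hconv _ _ s hs)|].
assert (hn2 : n ^ 2 <= 2 * n2).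
{ unfold n, n2, sq2, sub2; simpl fst; simpl snd.
  rewrite <- (pow2_abs (fst q - fst p)), <- (pow2_abs (snd q - snd p)).
  generalize (pow2_ge_0 (Rabs (fst q - fst p) - Rabs (snd q - snd p))); nra. }
assert (hrr : sq2 rr <= 4 * eps ^ 2 * n2).
{ unfold sq2; rewrite <- (pow2_abs (fst rr)), <- (pow2_abs (snd rr)).
  assert (k : forall a, 0 <= a -> a <= eps * n -> a ^ 2 <= eps ^ 2 * n ^ 2).
  { intros a ha1 ha2; replace (eps ^ 2 * n ^ 2) with ((eps * n) ^ 2) by ring.
    now apply pow_incr. }
  assert (k1 := k _ (Rabs_pos _) (proj1 h)); assert (k2 := k _ (Rabs_pos _) (proj2 h)).
  assert (eps ^ 2 * n ^ 2 <= eps ^ 2 * (2 * n2)) by (apply Rmult_le_compat_l; nra).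
  lra. }
assert (hn2Q : n2 <= Q (sub2 q p) / c).
{ apply Rmult_le_reg_l with c; [exact hc|].
  replace (c * (Q (sub2 q p) / c)) with (Q (sub2 q p)) by (field; lra); apply hQ. }
assert (hQ0 : 0 <= Q (sub2 q p)).
{ eapply Rle_trans; [|apply hQ]; apply Rmult_le_pos; [lra|].
  unfold sq2; generalize (pow2_ge_0 (fst (sub2 q p))) (pow2_ge_0 (snd (sub2 q p))); lra. }
set (Q0 := Q (sub2 q p)) in *.
assert (t1 : (1 + s) * Q (L (sub2 q p)) <= (1 + s) * (kappa * Q0))
  by (apply Rmult_le_compat_l; [lra|apply hL]).
assert (t2 : (1 + / s) * Q rr <= A * eps ^ 2 * Q0).
{ apply Rle_trans with ((1 + / s) * (C * (4 * eps ^ 2 * (Q0 / c)))).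
  - apply Rmult_le_compat_l; [lra|].
    eapply Rle_trans; [apply hQ|]; apply Rmult_le_compat_l; [lra|].
    eapply Rle_trans; [exact hrr|]; apply Rmult_le_compat_l; [nra|exact hn2Q].
  - right; unfold A; field; lra. }
assert (t3 : A * eps ^ 2 * Q0 <= (1 - kappa) / 4 * Q0)
  by (apply Rmult_le_compat_r; lra).
assert (t4 : (1 + s) * (kappa * Q0) <= (1 + kappa) / 2 * Q0).
{ assert (s * kappa <= s) by nra; unfold s in *.
  assert (((1 + (1 - kappa) / 2) * kappa) * Q0 <= (1 + kappa) / 2 * Q0)
    by (apply Rmult_le_compat_r; lra).
  lra. }
lra.
Qed.

(** ** Roots in the unit disc *)

Lemma charpoly_companion (b e T : R) (z : C) :
  charpoly (companion b e T) z = (z * z - RtoC T * z + RtoC (b * e))%C.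
Proof.
unfold charpoly, companion; simpl fst; simpl snd.
apply injective_projections; simpl; ring.
Qed.

Lemma charpoly_roots_companion (b e T : R) (l1 l2 : C) :
  charpoly_roots (companion b e T) l1 l2 <->
  (l1 + l2 = RtoC T /\ l1 * l2 = RtoC (b * e))%C.
Proof.
unfold charpoly_roots; split.
- intros h; assert (h0 := h (RtoC 0)); assert (h1 := h (RtoC 1)).
  rewrite charpoly_companion in h0, h1.
  assert (e0 : (l1 * l2 = RtoC (b * e))%C).
  { transitivity ((RtoC 0 - l1) * (RtoC 0 - l2))%C; [ring|].
    rewrite <- h0; ring. }
  split; [|exact e0].
  transitivity (RtoC 1 + l1 * l2 - (RtoC 1 - l1) * (RtoC 1 - l2))%C; [ring|].
  rewrite <- h1, e0; ring.
- intros [h1 h2] z; rewrite charpoly_companion, <- h1, <- h2; ring.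
Qed.

(** A non-real root has modulus [sqrt D]; real roots are confined because their
    product is [D < 1] and the polynomial is positive at [1] and [-1]. *)
Lemma jury_disc (D T : R) (l1 l2 : C) : 0 < D < 1 -> Rabs T < 1 + D ->
  (l1 + l2 = RtoC T)%C -> (l1 * l2 = RtoC D)%C -> Cmod l1 < 1.
Proof.
intros hD hT h1 h2; destruct l1 as [a b], l2 as [a' b'].
apply (f_equal fst) in h1 as h1r; apply (f_equal snd) in h1 as h1i.
apply (f_equal fst) in h2 as h2r; apply (f_equal snd) in h2 as h2i.
simpl in h1r, h1i, h2r, h2i.
assert (hb : b' = - b) by lra; assert (ha : a' = T - a) by lra; subst a' b'.
apply Rabs_def2 in hT.
unfold Cmod; simpl fst; simpl snd; rewrite <- sqrt_1; apply sqrt_lt_1; [nra|lra|].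
destruct (Req_dec b 0) as [->|hb].
- assert (-1 < a < 1) by (split; nra); nra.
- assert (T = 2 * a) by nra; subst T; nra.
Qed.

Lemma real_quadratic_roots (D T : R) :
  exists l1 l2 : C, (l1 + l2 = RtoC T /\ l1 * l2 = RtoC D)%C.
Proof.
destruct (Rle_lt_dec 0 (T ^ 2 - 4 * D)) as [h|h].
- set (s := sqrt (T ^ 2 - 4 * D)); assert (hs : s * s = T ^ 2 - 4 * D) by now apply sqrt_def.
  exists (RtoC ((T + s) / 2)), (RtoC ((T - s) / 2)); split;
    apply injective_projections; simpl; try field; nra.
- set (s := sqrt (4 * D - T ^ 2)).
  assert (hs : s * s = 4 * D - T ^ 2) by (apply sqrt_def; lra).
  exists (T / 2, s / 2), (T / 2, - s / 2); split;
    apply injective_projections; simpl; try field; nra.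
Qed.

(** Gives the same multipliers at the two crossing points, where the
    differentials are conjugate by the symmetry. *)
Lemma charpoly_trace_det (L M : R2 -> R2) :
  fst (L (1, 0)) + snd (L (0, 1)) = fst (M (1, 0)) + snd (M (0, 1)) ->
  fst (L (1, 0)) * snd (L (0, 1)) - fst (L (0, 1)) * snd (L (1, 0)) =
  fst (M (1, 0)) * snd (M (0, 1)) - fst (M (0, 1)) * snd (M (1, 0)) ->
  forall z, charpoly L z = charpoly M z.
Proof.
intros ht hd z; unfold charpoly.
assert (e : forall a b c d : R,
  ((z - RtoC a) * (z - RtoC d) - RtoC b * RtoC c =
   z * z - RtoC (a + d) * z + RtoC (a * d - b * c))%C).
{ intros; rewrite RtoC_plus, RtoC_minus, !RtoC_mult; ring. }
now rewrite !e, ht, hd.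
Qed.

Lemma charpoly_roots_square (b e T : R) (l1 l2 : C) :
  charpoly_roots (companion b e T) l1 l2 ->
  charpoly_roots (fun h => companion b e T (companion b e T h)) (l1 ^ 2)%C (l2 ^ 2)%C.
Proof.
intros h; apply charpoly_roots_companion in h; destruct h as [h1 h2]; intros z.
assert (hz : charpoly (fun h => companion b e T (companion b e T h)) z
  = (z * z - RtoC (T * T - 2 * (b * e)) * z + RtoC ((b * e) * (b * e)))%C).
{ unfold charpoly, companion; simpl fst; simpl snd.
  apply injective_projections; simpl; ring. }
rewrite hz, RtoC_minus, !RtoC_mult, <- (RtoC_mult b e), <- h1, <- h2.
simpl; ring.
Qed.

(** ** Derivative of an inverse function *)

(** Monotonicity makes [g] continuous at [f t]; the difference quotient of [g]
    is then the inverse of that of [f]. *)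
Lemma is_derive_inverse_decr (f g : R -> R) (a b t c : R) :
  a < t < b -> (forall r s, a < r -> r < s -> s < b -> f s < f r) ->
  c < 0 -> is_derive f t c ->
  (forall y s, a < s < b -> f s = y -> g y = s) ->
  (exists del, 0 < del /\ forall y, Rabs (y - f t) < del -> a < g y < b /\ f (g y) = y) ->
  is_derive g (f t) (/ c).
Proof.
intros ht hdec hc hf hg [d0 [hd0 hr]].
apply is_derive_deriv_in; apply is_derive_deriv_in in hf; intros eps heps.
set (e := Rmin (- c / 2) (eps * c ^ 2 / 2)).
assert (hc2 : 0 < c ^ 2) by nra.
assert (he : 0 < e) by (apply Rmin_glb_lt; [lra|]; nra).
assert (he1 : e <= - c / 2) by apply Rmin_l.
assert (he2 : e <= eps * c ^ 2 / 2) by apply Rmin_r.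
destruct (hf e he) as [d [hd h]].
set (m := Rmin (d / 2) (Rmin ((t - a) / 2) ((b - t) / 2))).
assert (hm : 0 < m) by (repeat apply Rmin_glb_lt; lra).
assert (hm1 : m <= d / 2) by apply Rmin_l.
assert (hm2 : m <= (t - a) / 2)
  by min_upper.
assert (hm3 : m <= (b - t) / 2)
  by min_upper.
assert (f1 := hdec (t - m) t ltac:(lra) ltac:(lra) ltac:(lra)).
assert (f2 := hdec t (t + m) ltac:(lra) ltac:(lra) ltac:(lra)).
exists (Rmin d0 (Rmin (f (t - m) - f t) (f t - f (t + m)))).
split; [repeat apply Rmin_glb_lt; lra|]; intros y _ hy.
assert (l0 := Rlt_le_trans _ _ _ hy (Rmin_l _ _)).
assert (l := Rlt_le_trans _ _ _ hy (Rmin_r _ _)).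
assert (l1 := Rlt_le_trans _ _ _ l (Rmin_l _ _)).
assert (l2 := Rlt_le_trans _ _ _ l (Rmin_r _ _)).
destruct (hr y l0) as [hs hfs]; rewrite (hg (f t) t ht eq_refl).
set (s := g y) in *.
apply Rabs_lt_between' in l1; apply Rabs_lt_between' in l2.
assert (s1 : t - m < s).
{ apply Rnot_le_lt; intros [hle|hle]; [|rewrite hle in hfs; lra].
  specialize (hdec s (t - m) ltac:(lra) hle ltac:(lra)); lra. }
assert (s2 : s < t + m).
{ apply Rnot_le_lt; intros [hle|hle]; [|rewrite <- hle in hfs; lra].
  specialize (hdec (t + m) s ltac:(lra) hle ltac:(lra)); lra. }
assert (hst : Rabs (s - t) < d) by (apply Rabs_lt_between'; lra).
specialize (h s Logic.I hst); rewrite hfs in h.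
set (u := s - t) in *; set (v := y - f t) in *.
assert (h' : Rabs (u - v * / c) * - c <= e * Rabs u).
{ replace (Rabs (u - v * / c) * - c) with (Rabs (v - u * c)); [exact h|].
  rewrite <- (Rabs_pos_eq (- c)) at 1 by lra; rewrite <- Rabs_mult.
  f_equal; field; lra. }
assert (hu : Rabs u * - c <= 2 * Rabs v).
{ assert (Rabs u * - c = Rabs (u * c))
    by (rewrite Rabs_mult, (Rabs_left c) by lra; ring).
  assert (Rabs (u * c) <= Rabs v + Rabs (v - u * c)).
  { replace (u * c) with (v - (v - u * c)) at 1 by ring.
    eapply Rle_trans; [apply Rabs_triang|]; rewrite Rabs_Ropp; lra. }
  assert (e * Rabs u <= - c / 2 * Rabs u)
    by (apply Rmult_le_compat_r; [apply Rabs_pos|lra]).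
  lra. }
apply Rmult_le_reg_r with (c ^ 2); [exact hc2|].
replace (Rabs (u - v * / c) * c ^ 2) with (Rabs (u - v * / c) * - c * - c) by ring.
apply Rle_trans with (e * Rabs u * - c); [apply Rmult_le_compat_r; lra|].
rewrite Rmult_assoc; apply Rle_trans with (e * (2 * Rabs v));
  [apply Rmult_le_compat_l; lra|].
assert (e * Rabs v <= eps * c ^ 2 / 2 * Rabs v)
  by (apply Rmult_le_compat_r; [apply Rabs_pos|lra]).
lra.
Qed.

(** * Continuous dependence on the starting point *)

Definition close3 (eps : R) (p q : R3) : Prop :=
  Rabs (xc p - xc q) < eps /\ Rabs (yc p - yc q) < eps /\ Rabs (zc p - zc q) < eps.

Lemma close3_mono (e e' : R) (p q : R3) : e <= e' -> close3 e p q -> close3 e' p q.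
Proof. intros h [h1 [h2 h3]]; repeat split; lra. Qed.

Lemma close3_trans (e e' : R) (p q r : R3) :
  close3 e p q -> close3 e' q r -> close3 (e + e') p r.
Proof.
assert (k : forall a b c : R, Rabs (a - b) < e -> Rabs (b - c) < e' -> Rabs (a - c) < e + e').
{ intros a b c; unfold Rabs; repeat destruct Rcase_abs; lra. }
intros [h1 [h2 h3]] [k1 [k2 k3]]; repeat split; eapply k; eassumption.
Qed.

Lemma close3_S (e : R) (p q : R3) : close3 e p q -> close3 e (Sinv p) (Sinv q).
Proof.
intros [h1 [h2 h3]]; unfold close3; rewrite !xc_S, !yc_S, !zc_S.
assert (k : forall a b : R, - a - - b = - (a - b)) by (intros; ring).
rewrite !k, !Rabs_Ropp; tauto.
Qed.

Lemma flow_add (mu H : R) (p : R3) (s r : R) : 0 <= r ->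
  flow mu H (flow mu H p s) r = flow mu H p (s + r).
Proof.
intros hr; replace (s + r) with (r - - s) by ring.
apply (solution_unique mu H 0 r (flow mu H (flow mu H p s))
         (fun t => flow mu H p (t - - s))); [exact hr| | | | |].
- intros t _; apply (solves_cont mu H), flow_solves.
- intros t _; apply (solves_cont mu H), solves_shift, flow_solves.
- intros t _; apply flow_solves.
- intros t _; apply solves_shift, flow_solves.
- rewrite flow_0; f_equal; ring.
Qed.

Lemma bounded_on (f : R -> R) (S : R) : 0 <= S -> (forall s, ex_derive f s) ->
  exists A, 0 < A /\ forall s, 0 <= s <= S -> Rabs (f s) <= A.
Proof.
intros hS hf.
assert (hc : forall s, 0 <= s <= S -> continuity_pt f s)
  by (intros s _; destruct (hf s) as [l hl]; exact (continuity_pt_of_derive f s l hl)).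
destruct (continuity_ab_maj f 0 S hS hc) as [u [hu _]].
destruct (continuity_ab_min f 0 S hS hc) as [v [hv _]].
exists (1 + Rabs (f u) + Rabs (f v)); split.
- generalize (Rabs_pos (f u)) (Rabs_pos (f v)); lra.
- intros s hs; specialize (hu s hs); specialize (hv s hs); revert hu hv.
  unfold Rabs; repeat destruct Rcase_abs; lra.
Qed.

Lemma combination_bounded (f1 f2 f3 : R -> R) (S : R) : 0 <= S ->
  (forall s, ex_derive f1 s) -> (forall s, ex_derive f2 s) ->
  (forall s, ex_derive f3 s) ->
  exists C, 0 < C /\ forall a b c d s, 0 <= s <= S ->
    Rabs a < d -> Rabs b < d -> Rabs c < d ->
    Rabs (f1 s * a + f2 s * b + f3 s * c) < C * d.
Proof.
intros hS h1 h2 h3.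
destruct (bounded_on f1 S hS h1) as [A1 [p1 k1]], (bounded_on f2 S hS h2) as [A2 [p2 k2]],
  (bounded_on f3 S hS h3) as [A3 [p3 k3]].
exists (1 + A1 + A2 + A3); split; [lra|]; intros a b c d s hs ha hb hc.
assert (hd : 0 < d) by (eapply Rle_lt_trans; [apply Rabs_pos|exact ha]).
assert (k : forall f A x, Rabs (f s) <= A -> Rabs x < d -> Rabs (f s * x) <= A * d).
{ intros f A x hf hx; rewrite Rabs_mult.
  apply Rmult_le_compat; try apply Rabs_pos; lra. }
assert (m1 := k f1 A1 a (k1 s hs) ha); assert (m2 := k f2 A2 b (k2 s hs) hb).
assert (m3 := k f3 A3 c (k3 s hs) hc).
eapply Rle_lt_trans; [apply Rabs_triang|].
eapply Rle_lt_trans; [apply Rplus_le_compat_r, Rabs_triang|lra].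
Qed.

Lemma flow_lipschitz (mu H S : R) : 0 <= S ->
  exists C, 0 < C /\ forall p p' d s, 0 <= s <= S -> close3 d p p' ->
    close3 (C * d) (flow mu H p s) (flow mu H p' s).
Proof.
intros hS.
set (yy := fun s => exp (mu * s) * (cos s + mu * sin s)).
set (yz := fun s => - exp (mu * s) * (1 + mu ^ 2) * sin s).
set (zy := fun s => exp (mu * s) * sin s).
set (zz := fun s => exp (mu * s) * (cos s - mu * sin s)).
set (xx := fun s => exp (- 2 * mu * s)).
destruct (combination_bounded (fun _ => 0) zy zz S hS) as [Cz [pz kz]];
  try (intros s; unfold zy, zz; auto_derive; trivial).
destruct (combination_bounded (fun _ => 0) yy yz S hS) as [Cy [py ky]];
  try (intros s; unfold yy, yz; auto_derive; trivial).
destruct (combination_bounded xx (fun s => - H * xx s + H * yy s - 4 * mu * H * zy s)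
  (fun s => 4 * mu * H * xx s + H * yz s - 4 * mu * H * zz s) S hS) as [Cx [px kx]];
  try (intros s; unfold xx, yy, yz, zy, zz; auto_derive; trivial).
exists (Cx + Cy + Cz); split; [lra|]; intros p p' d s hs [hx [hy hz]].
assert (hd : 0 < d) by (eapply Rle_lt_trans; [apply Rabs_pos|exact hx]).
specialize (kx _ _ _ _ s hs hx hy hz); specialize (ky _ _ _ _ s hs hx hy hz).
specialize (kz _ _ _ _ s hs hx hy hz); cbv beta in kx, ky, kz.
assert (le1 : Cx * d <= (Cx + Cy + Cz) * d) by (apply Rmult_le_compat_r; lra).
assert (le2 : Cy * d <= (Cx + Cy + Cz) * d) by (apply Rmult_le_compat_r; lra).
assert (le3 : Cz * d <= (Cx + Cy + Cz) * d) by (apply Rmult_le_compat_r; lra).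
split; [|split].
- change (Rabs (flow_x mu H p s - flow_x mu H p' s) < (Cx + Cy + Cz) * d).
  eapply Rlt_le_trans; [|exact le1]; eapply Rle_lt_trans; [|exact kx].
  right; apply f_equal.
  unfold flow_x, flow_y, flow_z, xx, yy, yz, zy, zz; ring.
- change (Rabs (flow_y mu p s - flow_y mu p' s) < (Cx + Cy + Cz) * d).
  eapply Rlt_le_trans; [|exact le2]; eapply Rle_lt_trans; [|exact ky].
  right; apply f_equal.
  unfold flow_y, yy, yz; ring.
- change (Rabs (flow_z mu p s - flow_z mu p' s) < (Cx + Cy + Cz) * d).
  eapply Rlt_le_trans; [|exact le3]; eapply Rle_lt_trans; [|exact kz].
  right; apply f_equal.
  unfold flow_z, zy, zz; ring.
Qed.

Lemma flow_continuous (mu H : R) (p : R3) (t eps : R) : 0 < eps ->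
  exists d, 0 < d /\ forall s, Rabs (s - t) < d ->
    close3 eps (flow mu H p s) (flow mu H p t).
Proof.
intros he.
destruct (solves_cont mu H (fun _ => True) (flow mu H p) t (flow_solves _ _ _ _))
  as [c1 [c2 c3]].
destruct (c1 eps he) as [d1 [hd1 k1]], (c2 eps he) as [d2 [hd2 k2]],
  (c3 eps he) as [d3 [hd3 k3]].
exists (Rmin d1 (Rmin d2 d3)); split; [repeat apply Rmin_glb_lt; assumption|].
intros s hs.
assert (l1 := Rlt_le_trans _ _ _ hs (Rmin_l _ _)).
assert (l := Rlt_le_trans _ _ _ hs (Rmin_r _ _)).
assert (l2 := Rlt_le_trans _ _ _ l (Rmin_l _ _)).
assert (l3 := Rlt_le_trans _ _ _ l (Rmin_r _ _)).
repeat split; [now apply k1|now apply k2|now apply k3].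
Qed.

Lemma derive_sign_incr (f df : R -> R) (a b : R) : a < b ->
  (forall t, is_derive f t (df t)) -> (forall t, a < t < b -> 0 < df t) -> f a < f b.
Proof.
intros hab hd hpos.
assert (h : - f b < - f a).
{ apply (strict_decr_of_derive (fun t => - f t) (fun t => - df t)); [| | |exact hab].
  - intros t _; exact (is_derive_opp f t _ (hd t)).
  - intros t ht; specialize (hpos t ht); lra.
  - intros t _; apply (continuity_pt_opp f); eapply continuity_pt_of_derive, hd. }
lra.
Qed.

Lemma derive_sign_decr (f df : R -> R) (a b : R) : a < b ->
  (forall t, is_derive f t (df t)) -> (forall t, a < t < b -> df t < 0) -> f b < f a.
Proof.
intros hab hd hneg; apply (strict_decr_of_derive f df); auto.
intros t _; eapply continuity_pt_of_derive, hd.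
Qed.

Lemma is_derive_flow_zc (mu H : R) (p : R3) (s : R) :
  is_derive (fun s => zc (flow mu H p s)) s (yc (flow mu H p s)).
Proof. exact (is_derive_flow_z mu p s). Qed.

Section ZeroDivergence.

Context (mu tg : R) (hmu : 0 < mu) (htg : is_t_g mu tg).

(** * The parameter along the curve of crossing points *)

Lemma tg_bounds : PI < tg < 2 * PI.
Proof. exact (proj1 htg). Qed.

Lemma y0_tg : y0 mu tg = 0.
Proof.
unfold y0; rewrite (proj2 htg); ring.
Qed.

Lemma y0_pos (t : R) : PI < t < tg -> 0 < y0 mu t.
Proof.
intros ht; rewrite <- y0_tg; generalize tg_bounds; intros.
apply y0_decr; lra.
Qed.

Lemma num_y_neg (t : R) : PI <= t < tg -> num_y mu t < 0.
Proof.
intros ht; generalize tg_bounds; intros hb.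
destruct (Req_dec t PI) as [->|hne].
{ unfold num_y; rewrite cos_PI, sin_PI; generalize (exp_pos (- mu * PI)); lra. }
assert (hy := y0_pos t ltac:(lra)); assert (hs := sin_neg_arc t ltac:(lra)).
rewrite y0_num in hy by lra; assert (hz := zeta_pos mu).
destruct (Rlt_le_dec (num_y mu t) 0) as [h|h]; [exact h|exfalso].
assert (hq : 0 <= zeta mu * num_y mu t / - sin t) by (apply Rdiv_le_0_compat; nra).
rewrite Rdiv_opp_r in hq; lra.
Qed.

Lemma x0_decr (s t : R) : PI < s -> s < t -> t <= tg -> x0 mu t < x0 mu s.
Proof.
intros h1 h2 h3; generalize tg_bounds; intros hb.
apply (strict_decr_of_derive (x0 mu)
         (fun r => y0 mu r * exp (mu * r) / sin r)); [| | |exact h2].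
- intros r hr; apply is_derive_x0; generalize (sin_neg_arc r); lra.
- intros r hr; assert (hs := sin_neg_arc r ltac:(lra)).
  assert (hx := y0_pos r ltac:(lra)); assert (he := exp_pos (mu * r)).
  apply Rdiv_pos_neg; [nra|exact hs].
- intros r hr; eapply continuity_pt_of_derive, is_derive_x0.
  generalize (sin_neg_arc r); lra.
Qed.

Lemma y0_surj (y : R) : 0 < y -> exists t, PI < t < tg /\ y0 mu t = y.
Proof.
intros hy; generalize tg_bounds; intros hb; assert (hz := zeta_pos mu).
set (f := fun t => zeta mu * num_y mu t - y * sin t).
destruct (Ranalysis5.IVT_interv f PI tg) as [t [ht h0]].
- intros a _.
  apply (continuity_pt_of_derive _ _
    (zeta mu * (- sin a + mu * exp (- mu * a) - mu * cos a) - y * cos a)).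
  unfold f, num_y; auto_derive; [trivial|ring].
- lra.
- unfold f; rewrite sin_PI; generalize (num_y_neg PI ltac:(lra)); nra.
- unfold f; rewrite (proj2 (proj1 (is_t_g_iff mu tg) htg)).
  generalize (sin_neg_arc tg hb); nra.
- unfold f in h0.
  assert (h1 : t <> PI).
  { intros ->; rewrite sin_PI in h0; generalize (num_y_neg PI ltac:(lra)); nra. }
  assert (h2 : t <> tg).
  { intros ->; rewrite (proj2 (proj1 (is_t_g_iff mu tg) htg)) in h0.
    generalize (sin_neg_arc tg hb); nra. }
  assert (hs := sin_neg_arc t ltac:(lra)).
  exists t; split; [lra|].
  rewrite y0_num by lra; replace (zeta mu * num_y mu t) with (y * sin t) by lra.
  field; lra.
Qed.

(** The ratio [x0 / y0] exceeds the growth factor [exp (mu t)] of the focus,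
    because the flight lasts more than half a period; the limits of the two are
    equal at [t = PI]. *)
Lemma num_growth (t : R) : PI < t < 2 * PI ->
  - num_y mu t * exp (mu * t) < - num_x mu t.
Proof.
intros ht; unfold num_y, num_x; rewrite exp_neg_mul.
assert (hp := PI_RGT_0); assert (he := exp_gt_1 (mu * t) ltac:(nra)).
assert (hc := COS_bound t); assert (hs := sin_neg_arc t ht).
replace (- (cos t - / exp (mu * t) - mu * sin t) * exp (mu * t))
  with (- (cos t - mu * sin t) * exp (mu * t) + 1) by (field; lra).
assert (0 <= (1 + cos t) * (exp (mu * t) - 1)) by (apply Rmult_le_pos; lra).
assert (0 < mu * (- sin t) * (1 + exp (mu * t)))
  by (repeat apply Rmult_lt_0_compat; lra).
nra.
Qed.

Lemma x0_y0_growth (t : R) : PI < t < 2 * PI ->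
  y0 mu t * exp (mu * t) < x0 mu t.
Proof.
intros ht; assert (hs := sin_neg_arc t ht).
rewrite x0_num, y0_num by lra.
assert (hg := num_growth t ht); assert (hz := zeta_pos mu).
replace (zeta mu * num_x mu t / sin t)
  with (zeta mu / (- sin t) * (- num_x mu t)) by (field; lra).
replace (zeta mu * num_y mu t / sin t * exp (mu * t))
  with (zeta mu / (- sin t) * (- num_y mu t * exp (mu * t))) by (field; lra).
apply Rmult_lt_compat_l; [apply Rdiv_lt_0_compat; lra|exact hg].
Qed.

Lemma y0_lt_x0 (t : R) : PI < t < tg -> y0 mu t < x0 mu t.
Proof.
intros ht; generalize tg_bounds; intros hb.
assert (hg := x0_y0_growth t ltac:(lra)); assert (hy := y0_pos t ht).
assert (he := exp_gt_1 (mu * t) ltac:(generalize PI_RGT_0; nra)); nra.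
Qed.

Definition ratio (t : R) : R := num_y mu t / num_x mu t.

Lemma is_derive_ratio (t : R) : PI < t < 2 * PI ->
  is_derive ratio t
    ((num_x mu t ^ 2 * exp (- mu * t) - num_y mu t ^ 2 * exp (mu * t))
     / (sin t * num_x mu t ^ 2)).
Proof.
intros ht; assert (hs := sin_neg_arc t ht).
assert (hx := num_x_neg mu t hmu ltac:(lra)).
unfold ratio, num_y, num_x in *; auto_derive; [lra|].
rewrite !exp_neg_mul; assert (he := exp_pos (mu * t)).
assert (hc : cos t * cos t = 1 - sin t * sin t)
  by (generalize (sin2_cos2 t); unfold Rsqr; lra).
field_simplify_eq; [|repeat split; lra].
revert hc; generalize (exp (mu * t)) (cos t) (sin t); intros e c s hcs.
assert (h2 : c ^ 2 = 1 - s ^ 2) by (simpl; rewrite !Rmult_1_r; exact hcs).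
assert (h3 : c ^ 3 = c * (1 - s ^ 2)) by (rewrite <- h2; ring).
assert (h4 : c ^ 4 = (1 - s ^ 2) ^ 2) by (rewrite <- h2; ring).
rewrite ?h4, ?h3, ?h2; ring.
Qed.

Lemma ratio_derive_neg (t : R) : PI < t < tg ->
  (num_x mu t ^ 2 * exp (- mu * t) - num_y mu t ^ 2 * exp (mu * t))
     / (sin t * num_x mu t ^ 2) < 0.
Proof.
intros ht; generalize tg_bounds; intros hb.
assert (hs := sin_neg_arc t ltac:(lra)).
assert (hx := num_x_neg mu t hmu ltac:(lra)).
assert (hy := num_y_neg t ltac:(lra)).
assert (hg := num_growth t ltac:(lra)).
rewrite exp_neg_mul; assert (he := exp_pos (mu * t)).
set (e := exp (mu * t)) in *; set (a := - num_x mu t) in *.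
set (b := - num_y mu t) in *.
replace (num_x mu t) with (- a) by (unfold a; ring).
replace (num_y mu t) with (- b) by (unfold b; ring).
assert (0 < a) by (unfold a; lra); assert (0 < b) by (unfold b; lra).
replace (((- a) ^ 2 * / e - (- b) ^ 2 * e) / (sin t * (- a) ^ 2))
  with (- ((a - b * e) * (a + b * e) / (e * a ^ 2 * - sin t)))
  by (field; repeat split; lra).
apply Ropp_lt_gt_0_contravar, Rdiv_lt_0_compat.
- apply Rmult_lt_0_compat; nra.
- repeat apply Rmult_lt_0_compat; simpl; nra.
Qed.

Lemma continuity_ratio (t : R) : PI <= t < 2 * PI -> continuity_pt ratio t.
Proof.
intros ht; assert (hx := num_x_neg mu t hmu ht).
unfold ratio, num_y, num_x in *.
eapply continuity_pt_of_derive; auto_derive; [lra|reflexivity].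
Qed.

Lemma ratio_decr (s t : R) : PI <= s -> s < t -> t <= tg -> ratio t < ratio s.
Proof.
intros h1 h2 h3; generalize tg_bounds; intros hb.
apply (strict_decr_of_derive ratio (fun t =>
  (num_x mu t ^ 2 * exp (- mu * t) - num_y mu t ^ 2 * exp (mu * t))
     / (sin t * num_x mu t ^ 2))); [| | |exact h2].
- intros r hr; apply is_derive_ratio; lra.
- intros r hr; apply ratio_derive_neg; lra.
- intros r hr; apply continuity_ratio; lra.
Qed.

Lemma ratio_PI : ratio PI = exp (- mu * PI).
Proof.
unfold ratio, num_y, num_x; rewrite cos_PI, sin_PI, exp_neg_mul.
generalize (exp_pos (mu * PI)); intros; field; lra.
Qed.

Lemma ratio_tg : ratio tg = 0.
Proof.
unfold ratio; rewrite (proj2 (proj1 (is_t_g_iff mu tg) htg)).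
unfold Rdiv; ring.
Qed.

Lemma ratio_bounds (t : R) : PI <= t <= tg -> 0 <= ratio t < 1.
Proof.
intros ht; generalize tg_bounds PI_RGT_0; intros hb hp; split.
- destruct (Req_dec t tg) as [->|hne]; [rewrite ratio_tg; lra|].
  rewrite <- ratio_tg; left; apply ratio_decr; lra.
- apply Rle_lt_trans with (ratio PI).
  + destruct (Req_dec t PI) as [->|hne]; [lra|].
    left; apply ratio_decr; lra.
  + rewrite ratio_PI; apply exp_lt_1; nra.
Qed.

(** The continuous extension of [eta] to the closed interval; it is the
    addition law of the hyperbolic tangent applied to [ratio] and to the
    contraction factor of a half turn, both of which decrease. *)
Definition eta_ext (t : R) : R :=
  (ratio t + exp (- 2 * mu * t)) / (1 + ratio t * exp (- 2 * mu * t)).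

Lemma E_bounds (t : R) : 0 < t -> 0 < exp (- 2 * mu * t) < 1.
Proof.
intros ht; split; [apply exp_pos|apply exp_lt_1; nra].
Qed.

Lemma decay_small (t : R) : PI < t -> 2 * mu * exp (- mu * t) < 1.
Proof.
intros ht; assert (hPI := PI2_1); assert (he := exp_pos (mu * t)).
rewrite exp_neg_mul; apply Rmult_lt_reg_r with (exp (mu * t)); [exact he|].
rewrite Rmult_assoc, Rinv_l by lra.
assert (hl := exp_ineq1 (mu * t) ltac:(nra)); nra.
Qed.

Lemma eta_ext_decr (s t : R) : PI <= s -> s < t -> t <= tg -> eta_ext t < eta_ext s.
Proof.
intros h1 h2 h3; generalize PI_RGT_0; intros hp; unfold eta_ext.
assert (hr := ratio_decr s t h1 h2 h3).
assert (hr1 := ratio_bounds s ltac:(lra)); assert (hr2 := ratio_bounds t ltac:(lra)).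
assert (he1 := E_bounds s ltac:(lra)); assert (he2 := E_bounds t ltac:(lra)).
assert (he : exp (- 2 * mu * t) < exp (- 2 * mu * s))
  by (apply exp_increasing; nra).
set (r := ratio s) in *; set (r' := ratio t) in *.
set (e := exp (- 2 * mu * s)) in *; set (e' := exp (- 2 * mu * t)) in *.
assert (0 < 1 + r * e) by nra; assert (0 < 1 + r' * e') by nra.
apply Rminus_gt_0_lt.
replace ((r + e) / (1 + r * e) - (r' + e') / (1 + r' * e'))
  with (((r - r') * (1 - e * e') + (e - e') * (1 - r * r'))
        / ((1 + r * e) * (1 + r' * e'))) by (field; lra).
apply Rdiv_lt_0_compat; [|nra].
assert (e * e' < 1) by nra; assert (r * r' < 1) by nra; nra.
Qed.

Lemma continuity_eta_ext (t : R) : PI <= t <= tg -> continuity_pt eta_ext t.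
Proof.
intros ht; generalize PI_RGT_0 tg_bounds; intros hp hb.
assert (hc := continuity_ratio t ltac:(lra)).
assert (hE : continuity_pt (fun t => exp (- 2 * mu * t)) t)
  by (eapply continuity_pt_of_derive, is_derive_E).
assert (hr := ratio_bounds t ht); assert (he := E_bounds t ltac:(lra)).
unfold eta_ext.
apply (continuity_pt_div (fun t => ratio t + exp (- 2 * mu * t))
  (fun t => 1 + ratio t * exp (- 2 * mu * t))); [| |nra].
- now apply (continuity_pt_plus ratio).
- apply (continuity_pt_plus (fun _ => 1));
    [now apply continuity_pt_const|now apply (continuity_pt_mult ratio)].
Qed.

Lemma eta_ext_PI : eta_ext PI = H_crit mu.
Proof.
unfold eta_ext, H_crit, cosh; rewrite ratio_PI.
replace (exp (- 2 * mu * PI)) with (exp (- mu * PI) * exp (- mu * PI))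
  by (rewrite <- exp_plus; f_equal; ring).
replace (- (PI * mu)) with (- mu * PI) by ring.
rewrite (Rmult_comm PI mu), exp_neg_mul.
assert (he := exp_gt_1 (mu * PI) ltac:(generalize PI_RGT_0; nra)).
set (e := exp (mu * PI)) in *.
assert (1 - e + e ^ 2 <> 0) by nra; assert (e ^ 3 + 1 <> 0) by (simpl; nra).
field; repeat split; try nra.
Qed.

Lemma eta_ext_tg : eta_ext tg = H_g mu tg.
Proof.
unfold eta_ext, H_g; rewrite ratio_tg; field.
Qed.

(** The quadratic form [y^2 + beta y + zeta] is the squared distance to the focus
    on the section, in the coordinates that rotate; a flight of length [t]
    multiplies it by [exp (2 mu t)]. *)
Lemma growth_identity (t : R) : sin t <> 0 ->
  y0 mu t ^ 2 + beta mu * y0 mu t + zeta mu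
  = exp (- 2 * mu * t) * (x0 mu t ^ 2 - beta mu * x0 mu t + zeta mu).
Proof.
intros hs; rewrite x0_num, y0_num by exact hs.
replace (exp (- 2 * mu * t)) with (exp (- mu * t) * exp (- mu * t))
  by (rewrite <- exp_plus; f_equal; ring).
unfold num_x, num_y; rewrite exp_neg_mul; assert (he := exp_pos (mu * t)).
assert (hc : cos t * cos t = 1 - sin t * sin t)
  by (generalize (sin2_cos2 t); unfold Rsqr; lra).
unfold beta, zeta; field_simplify_eq; [|repeat split; try nra; try lra].
revert hc; generalize (exp (mu * t)) (cos t) (sin t); intros e c s hcs.
assert (h2 : c ^ 2 = 1 - s ^ 2) by (simpl; rewrite !Rmult_1_r; exact hcs).
rewrite ?h2; ring.
Qed.

(** The right-hand side is [H] solved from the fixed-point equation of the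
    half-return map; [growth_identity] removes the exponential from it. *)
Lemma eta_fixed_form (t : R) : PI < t < tg ->
  eta mu t = (y0 mu t + exp (- 2 * mu * t) * x0 mu t)
             / (x0 mu t + exp (- 2 * mu * t) * y0 mu t).
Proof.
intros ht; generalize tg_bounds; intros hb.
assert (hs := sin_neg_arc t ltac:(lra)).
assert (hx := x0_pos mu t hmu ltac:(lra)); assert (hy := y0_pos t ht).
assert (hE := exp_pos (- 2 * mu * t)); assert (hid := growth_identity t ltac:(lra)).
unfold eta; set (x := x0 mu t) in *; set (y := y0 mu t) in *.
set (E := exp (- 2 * mu * t)) in *.
assert (hQ : 0 < y ^ 2 + beta mu * y + zeta mu).
{ generalize (zeta_pos mu); intros.
  assert (0 < beta mu) by (unfold beta; apply Rdiv_lt_0_compat; nra); nra. }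
set (P := x ^ 2 - beta mu * x + zeta mu) in *.
assert (hP : 0 < P) by (rewrite hid in hQ; nra).
assert (hA : x * y + zeta mu = P * (y + E * x) / (x + y)).
{ replace (P * (y + E * x)) with (y * P + x * (E * P)) by ring.
  rewrite <- hid; unfold P; field; lra. }
assert (hB : x ^ 2 + y ^ 2 - x * y - beta mu * (x - y) + zeta mu
             = P * (x + E * y) / (x + y)).
{ replace (P * (x + E * y)) with (x * P + y * (E * P)) by ring.
  rewrite <- hid; unfold P; field; lra. }
rewrite hA, hB; field; repeat split; nra.
Qed.

Lemma eta_eq_ext (t : R) : PI < t < tg -> eta mu t = eta_ext t.
Proof.
intros ht; generalize tg_bounds; intros hb.
rewrite eta_fixed_form by exact ht.
assert (hs := sin_neg_arc t ltac:(lra)).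
assert (hx := x0_pos mu t hmu ltac:(lra)); assert (hy := y0_pos t ht).
assert (hE := exp_pos (- 2 * mu * t)).
assert (hnx := num_x_neg mu t hmu ltac:(lra)); assert (hz := zeta_pos mu).
assert (hr : ratio t = y0 mu t / x0 mu t).
{ rewrite y0_num, x0_num by lra; unfold ratio; field; repeat split; lra. }
unfold eta_ext; rewrite hr; field; repeat split; nra.
Qed.

Lemma eta_decr (s t : R) : PI < s -> s < t -> t < tg -> eta mu t < eta mu s.
Proof.
intros; rewrite !eta_eq_ext by lra; apply eta_ext_decr; lra.
Qed.

Lemma eta_in_I (t : R) : PI < t < tg -> I_mu mu tg (eta mu t).
Proof.
intros ht; unfold I_mu; rewrite <- eta_ext_PI, <- eta_ext_tg, eta_eq_ext by lra.
split; apply eta_ext_decr; lra.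
Qed.

Lemma eta_surj (H : R) : I_mu mu tg H -> exists t, PI < t < tg /\ eta mu t = H.
Proof.
unfold I_mu; rewrite <- eta_ext_PI, <- eta_ext_tg; intros hH.
generalize tg_bounds; intros hb.
destruct (Ranalysis5.IVT_interv (fun t => H - eta_ext t) PI tg) as [t [ht h0]].
- intros a ha; apply (continuity_pt_minus (fun _ => H));
    [now apply continuity_pt_const|now apply continuity_eta_ext].
- lra.
- lra.
- lra.
- assert (t <> PI) by (intros ->; lra); assert (t <> tg) by (intros ->; lra).
  exists t; split; [lra|]; rewrite eta_eq_ext; lra.
Qed.

Lemma I_mu_unit (H : R) : I_mu mu tg H -> 0 < H < 1.
Proof.
unfold I_mu, H_g; intros [h1 h2]; generalize (exp_pos (- 2 * mu * tg)); intros.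
split; [lra|]; eapply Rlt_le_trans; [exact h2|].
rewrite <- eta_ext_PI; unfold eta_ext.
generalize PI_RGT_0 tg_bounds; intros hp hb.
assert (hr := ratio_bounds PI ltac:(lra)); assert (he := E_bounds PI hp).
left; apply Rmult_lt_reg_r with (1 + ratio PI * exp (- 2 * mu * PI)); [nra|].
unfold Rdiv; rewrite Rmult_assoc, Rinv_l by nra; nra.
Qed.

(** * The half-return map *)

Lemma flow_z_pos_before (p : R2) (t s : R) :
  PI < t < tg -> snd p = y0 mu t -> 0 < s < t -> 0 < flow_z mu (emb p) s.
Proof.
intros ht hp hs; generalize (tg_bounds); intros hb.
destruct (Rle_lt_dec s PI) as [h|h].
- apply flow_z_short; [exact hmu| |lra].
  rewrite hp; now apply (y0_pos).
- assert (hn := sin_neg_arc s ltac:(lra)).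
  rewrite flow_z_section by lra.
  assert (hy := y0_decr mu s t hmu ltac:(lra) ltac:(lra) ltac:(lra)).
  generalize (exp_pos (mu * s)); intros he.
  assert (0 < (- (sin s)) * (y0 mu s - snd p)) by (apply Rmult_lt_0_compat; lra).
  replace (exp (mu * s) * sin s * (snd p - y0 mu s))
    with (exp (mu * s) * ((- (sin s)) * (y0 mu s - snd p))) by ring.
  now apply Rmult_lt_0_compat.
Qed.

(** Flight time of the half turn, as a function of the second coordinate of the
    starting point. *)
Definition tau (y : R) : R :=
  epsilon (inhabits 0) (fun t => PI < t < tg /\ y0 mu t = y).

Lemma tau_spec (y : R) : 0 < y -> PI < tau y < tg /\ y0 mu (tau y) = y.
Proof.
intros hy; apply (epsilon_spec (inhabits 0) (fun t => PI < t < tg /\ y0 mu t = y)).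
now apply (y0_surj).
Qed.

Lemma tau_y0 (t : R) : PI < t < tg -> tau (y0 mu t) = t.
Proof.
intros ht; generalize (tg_bounds); intros hb.
destruct (tau_spec (y0 mu t) (y0_pos t ht)) as [h1 h2].
destruct (Rtotal_order (tau (y0 mu t)) t) as [h|[h|h]]; [|exact h|].
- generalize (y0_decr mu _ _ hmu (proj1 h1) h ltac:(lra)); lra.
- generalize (y0_decr mu _ _ hmu (proj1 ht) h ltac:(lra)); lra.
Qed.

(** The half-return map in closed form: [F] on the half plane [y > 0]. *)
Definition half_return (H : R) (p : R2) : R2 :=
  let t := tau (snd p) in
  (x0 mu t, H * x0 mu t - exp (- 2 * mu * t) * (fst p - H * snd p)).

Lemma flow_lands (H t : R) (p : R2) : PI < t < tg -> snd p = y0 mu t ->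
  flow mu H (emb p) t =
  Sinv (emb (x0 mu t, H * x0 mu t - exp (- 2 * mu * t) * (fst p - H * snd p))).
Proof.
intros ht hp; generalize (tg_bounds); intros hb.
assert (hs := sin_neg_arc t ltac:(lra)).
assert (hz : flow_z mu (emb p) t = 0)
  by (rewrite flow_z_section, hp by lra; ring).
assert (hy : flow_y mu (emb p) t = - x0 mu t).
{ unfold flow_y; destruct (emb_coords p) as [_ [-> ->]]; rewrite hp.
  unfold x0, y0; rewrite exp_neg_mul; generalize (exp_pos (mu * t)); intros he.
  assert (hc : cos t * cos t = 1 - sin t * sin t)
    by (generalize (sin2_cos2 t); unfold Rsqr; lra).
  replace (1 + mu ^ 2) with (/ zeta mu) by (unfold zeta; field; nra).
  assert (hzt := zeta_spec mu); assert (hzp := zeta_pos mu).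
  assert (hm : mu * mu = / zeta mu - 1) by (unfold zeta; field; nra).
  field_simplify_eq; [|repeat split; lra].
  revert hc hm; generalize (exp (mu * t)) (cos t) (sin t) (zeta mu) hzp;
    intros e c s z hz' hcs hm.
  assert (hc2 : c ^ 2 = 1 - s ^ 2) by (simpl; rewrite !Rmult_1_r; exact hcs).
  assert (hm2 : z * mu ^ 2 = 1 - z)
    by (simpl; rewrite Rmult_1_r, hm; field; lra).
  rewrite hc2; replace (e * z ^ 2 * s ^ 2 * mu ^ 2)
    with (e * z * s ^ 2 * (z * mu ^ 2)) by ring.
  rewrite hm2; ring. }
apply R3_eq.
- change (flow_x mu H (emb p) t
    = - (H * x0 mu t - exp (- 2 * mu * t) * (fst p - H * snd p))).
  unfold flow_x; rewrite hy, hz; destruct (emb_coords p) as [-> [-> ->]]; ring.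
- exact hy.
- change (flow_z mu (emb p) t = - 0); rewrite hz; ring.
Qed.

Lemma flow_half_return (H : R) (p : R2) : 0 < snd p ->
  PI < tau (snd p) < tg /\
  flow mu H (emb p) (tau (snd p)) = Sinv (emb (half_return H p)) /\
  forall s, 0 < s < tau (snd p) -> 0 < zc (flow mu H (emb p) s).
Proof.
intros hp; destruct (tau_spec (snd p) hp) as [h1 h2].
split; [exact h1|split].
- now apply flow_lands.
- intros s hs; now apply (flow_z_pos_before p (tau (snd p)) s).
Qed.

(** * Half turns and periodic orbits *)

Definition nat_above (t : R) : nat := Z.to_nat (up t).

Lemma nat_above_spec (t : R) : t < INR (nat_above t).
Proof.
unfold nat_above; destruct (archimed t) as [h _].
destruct (Z_lt_le_dec 0 (up t)) as [hz|hz].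
- rewrite INR_IZR_INZ, Z2Nat.id by lia; exact h.
- eapply Rlt_le_trans; [|apply pos_INR].
  apply IZR_le in hz; lra.
Qed.

Notation Fwd g H := (forall t, 0 <= t -> traj_at mu H (fun s => 0 <= s) g t).

Lemma tau_pos (y : R) : 0 < y -> PI < tau y < tg.
Proof. intros hy; now apply (tau_spec). Qed.

(** A first landing is recognised by the sign of [z] before it. *)
Lemma first_zero_tau (H sigma : R) (q : R2) : 0 < snd q -> 0 < sigma ->
  (forall s, 0 < s < sigma -> 0 < zc (flow mu H (emb q) s)) ->
  zc (flow mu H (emb q) sigma) = 0 -> sigma = tau (snd q).
Proof.
intros hq hs hpos h0.
destruct (flow_half_return H q hq) as [h1 [h2 h3]].
assert (hp := PI_RGT_0).
destruct (Rtotal_order sigma (tau (snd q))) as [h|[h|h]]; [|exact h|].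
- specialize (h3 sigma ltac:(lra)); lra.
- specialize (hpos (tau (snd q)) ltac:(lra)).
  rewrite h2, zc_S in hpos; destruct (emb_coords (half_return H q)) as [_ [_ e]]; lra.
Qed.

Lemma first_return_half_return (H : R) (p q : R2) : 0 < snd p ->
  first_return_X mu H p q <-> q = S_Sigma (half_return H p).
Proof.
intros hp; destruct (flow_half_return H p hp) as [h1 [h2 h3]].
assert (hPI := PI_RGT_0); split.
- intros [g [t [hg [g0 [ht [gt gpos]]]]]].
  assert (hsol : forall s, solves_at mu H g s).
  { intros s; specialize (hg s); apply derive_within_iff in hg; [|trivial].
    destruct hg as [d1 [d2 d3]].
    split; [|split]; now apply is_derive_deriv_in. }
  assert (hflow : forall s, 0 <= s -> g s = flow mu H (emb p) s).
  { intros s hs; apply (solution_unique mu H 0 s); auto.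
    - intros r _; now apply (solves_cont mu H).
    - intros r _; apply (solves_cont mu H), flow_solves.
    - intros r _; apply flow_solves.
    - now rewrite flow_0. }
  assert (e : t = tau (snd p)).
  { apply (first_zero_tau H); auto.
    - intros s hs; rewrite <- hflow by lra; apply gpos; lra.
    - rewrite <- hflow, gt by lra; apply emb_coords. }
  rewrite hflow, e, h2, Sinv_emb in gt by lra.
  symmetry; now apply emb_inj.
- intros ->; exists (flow mu H (emb p)), (tau (snd p)).
  split; [|split; [apply flow_0|split; [lra|split]]].
  + intros t; apply derive_within_iff; [trivial|].
    destruct (flow_solves mu H (emb p) t) as [d1 [d2 d3]].
    split; [|split]; now apply is_derive_deriv_in.
  + now rewrite <- Sinv_emb.
  + intros s hs; now apply h3.
Qed.

Lemma F_half_return (H : R) (p : R2) : 0 < snd p -> F mu H p = half_return H p.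
Proof.
intros hp; unfold F, Pi_X.
assert (h : first_return_X mu H p (epsilon (inhabits (0, 0)) (first_return_X mu H p))).
{ apply epsilon_spec; exists (S_Sigma (half_return H p)).
  now apply first_return_half_return. }
apply first_return_half_return in h; [|exact hp].
rewrite h; apply S_Sigma_invol.
Qed.

(** A trajectory leaving the positive quadrant of the section performs exactly
    one half turn, and lands in the crossing region only. *)
Lemma half_turn (H : R) (I : R -> Prop) (g : R -> R3) (q : R2) : posq q ->
  (forall t, 0 <= t <= tau (snd q) -> I t) ->
  (forall t, I t -> traj_at mu H I g t) -> g 0 = emb q ->
  (forall t, 0 <= t <= tau (snd q) -> g t = flow mu H (emb q) t) /\
  g (tau (snd q)) = Sinv (emb (half_return H q)) /\
  (forall t, 0 < t < tau (snd q) -> 0 < zc (g t)) /\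
  posq (half_return H q).
Proof.
intros hq hI hg g0; destruct hq as [hx hy].
destruct (flow_half_return H q hy) as [h1 [h2 h3]].
assert (hPI := PI_RGT_0).
assert (hf : forall t, 0 <= t <= tau (snd q) -> g t = flow mu H (emb q) t).
{ rewrite <- g0; apply (follow_flow mu H _ I); auto; [lra| |].
  - rewrite g0; now apply posq_up.
  - rewrite g0; exact h3. }
assert (hl : g (tau (snd q)) = Sinv (emb (half_return H q))).
{ rewrite hf by lra; exact h2. }
split; [exact hf|split; [exact hl|split]].
- intros t ht; rewrite hf by lra; now apply h3.
- destruct (hg (tau (snd q)) (hI (tau (snd q)) ltac:(lra))) as [_ [_ [_ hc]]].
  rewrite hl in hc; revert hc; rewrite xc_S, yc_S, zc_S.
  destruct (emb_coords (half_return H q)) as [-> [-> ->]]; intros hc.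
  destruct (hc ltac:(lra)) as [hxy _].
  assert (hx1 : 0 < fst (half_return H q)).
  { simpl; apply x0_pos; [exact hmu|].
    generalize (tg_bounds); lra. }
  split; [exact hx1|nra].
Qed.

(** ** Existence *)

Definition forever (H : R) (q : R2) : Prop :=
  forall n, posq (Nat.iter n (half_return H) q).

Lemma forever_step (H : R) (q : R2) :
  forever H q -> posq q /\ forever H (half_return H q).
Proof.
intros h; split; [exact (h 0%nat)|]; intros n.
rewrite <- Nat.iter_succ_r; exact (h (S n)).
Qed.

(** Unfolded by the symmetry, all half turns are upper arcs; after the [n]-th
    one the flow continues without crossing, so that only times below
    [(n + 1) PI] are meaningful. *)
Fixpoint half_turns (H : R) (n : nat) (q : R2) (t : R) : R3 :=
  match n with
  | O => flow mu H (emb q) t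
  | S m => glue (tau (snd q)) (flow mu H (emb q)) (half_turns H m (half_return H q)) t
  end.

Lemma half_turns_0 (H : R) (n : nat) (q : R2) : 0 < snd q ->
  half_turns H n q 0 = emb q.
Proof.
intros hq; assert (hPI := PI_RGT_0); assert (ht := tau_pos _ hq).
destruct n; simpl; [|rewrite glue_left by lra]; apply flow_0.
Qed.

Lemma half_turns_traj (H : R) (n : nat) : forall q, forever H q ->
  forall t, 0 <= t < (INR n + 1) * PI ->
    traj_at mu H (fun s => 0 <= s) (half_turns H n q) t.
Proof.
assert (hPI := PI_RGT_0).
induction n as [|n IH]; intros q hq t ht;
  destruct (forever_step H q hq) as [hq0 hq1];
  destruct (flow_half_return H q (proj2 hq0)) as [h1 [h2 h3]].
- simpl in *; apply (flow_traj mu H PI); [now apply posq_up| |lra].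
  intros s hs; apply h3; lra.
- change (half_turns H (S n) q) with
    (glue (tau (snd q)) (flow mu H (emb q)) (half_turns H n (half_return H q))).
  rewrite S_INR in ht.
  assert (hn := pos_INR n).
  apply (glue_traj mu H (tau (snd q)) ((INR n + 1) * PI) (emb q) (half_return H q));
    auto; try nra.
  + now apply posq_up.
  + exact (proj1 (forever_step _ _ hq1)).
  + apply half_turns_0, (forever_step _ _ hq1).
Qed.

Lemma half_turns_succ (H : R) (n : nat) : forall q, forever H q ->
  forall t, t < (INR n + 1) * PI -> half_turns H (S n) q t = half_turns H n q t.
Proof.
assert (hPI := PI_RGT_0).
induction n as [|n IH]; intros q hq t ht;
  destruct (forever_step H q hq) as [hq0 hq1];
  destruct (flow_half_return H q (proj2 hq0)) as [h1 [h2 h3]].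
- simpl in *; apply glue_left; lra.
- rewrite S_INR in ht.
  change (glue (tau (snd q)) (flow mu H (emb q)) (half_turns H (S n) (half_return H q)) t
    = glue (tau (snd q)) (flow mu H (emb q)) (half_turns H n (half_return H q)) t).
  unfold glue; destruct Rle_dec; [reflexivity|].
  rewrite IH; auto; lra.
Qed.

Lemma half_turns_stable (H : R) (n m : nat) (q : R2) (t : R) : forever H q ->
  (n <= m)%nat -> t < (INR n + 1) * PI -> half_turns H m q t = half_turns H n q t.
Proof.
intros hq hnm ht; induction hnm as [|m hnm IH]; [reflexivity|].
rewrite half_turns_succ, IH; auto.
apply le_INR in hnm; assert (hPI := PI_RGT_0); nra.
Qed.

Lemma forward_exists (H : R) (q : R2) : forever H q ->
  exists g, Fwd g H /\ g 0 = emb q.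
Proof.
intros hq; exists (fun t => half_turns H (nat_above t) q t).
assert (hPI : 2 < PI) by (generalize PI2_1; lra).
assert (hN : forall t, t < (INR (nat_above t) + 1) * PI).
{ intros t; generalize (nat_above_spec t) (pos_INR (nat_above t)); nra. }
split.
- intros t ht; set (n := nat_above (t + 1)).
  apply (traj_at_transport mu H (fun s => 0 <= s) _ (half_turns H n q) _ t 0 1);
    [lra|exact ht| |].
  + intros s hs hst; rewrite Rplus_0_r; split; [exact hs|].
    apply Rabs_lt_between' in hst.
    destruct (Nat.le_ge_cases (nat_above s) n) as [hle|hge].
    * symmetry; now apply half_turns_stable.
    * apply half_turns_stable; auto.
      apply Rlt_trans with (t + 1); [lra|apply hN].
  + rewrite Rplus_0_r; apply half_turns_traj; [exact hq|split; [exact ht|]].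
    apply Rlt_trans with (t + 1); [lra|apply hN].
- apply half_turns_0, (proj2 (proj1 (forever_step H q hq))).
Qed.

Lemma forward_unique (H : R) (g h : R -> R3) : Fwd g H -> Fwd h H -> g 0 = h 0 ->
  forall t, 0 <= t -> g t = h t.
Proof.
intros hg hh e t ht.
apply (crossing_trajectory_unique mu H (fun s => 0 <= s) g h 0); auto; try lra.
intros a b c ha hc hb; lra.
Qed.

Lemma forward_step (H : R) (g : R -> R3) (q : R2) : Fwd g H -> g 0 = emb q -> posq q ->
  (forall t, 0 <= t <= tau (snd q) -> g t = flow mu H (emb q) t) /\
  posq (half_return H q) /\
  Fwd (fun s => Sinv (g (s + tau (snd q)))) H /\
  Sinv (g (0 + tau (snd q))) = emb (half_return H q).
Proof.
intros hg g0 hq; assert (hPI := PI_RGT_0).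
assert (ht := tau_pos _ (proj2 hq)).
destruct (half_turn H (fun s => 0 <= s) g q hq) as [h1 [h2 [h3 h4]]];
  auto; [intros; lra|].
split; [exact h1|split; [exact h4|split]].
- intros t hpos.
  apply (traj_at_mono mu H (fun s => 0 <= s + tau (snd q))); [lra|intros; lra|].
  apply (traj_at_S_shift mu H _ (fun s => 0 <= s)); [exact hg|lra].
- rewrite Rplus_0_l, h2; apply Sinv_invol.
Qed.

(** ** Symmetric closed orbits *)

Lemma fixed_forever (H : R) (q : R2) : posq q -> half_return H q = q -> forever H q.
Proof.
intros hq hf n; replace (Nat.iter n (half_return H) q) with q; [exact hq|].
induction n as [|n IH]; [reflexivity|]; simpl; now rewrite <- IH, hf.
Qed.

(** Times are moved to the far future by a multiple of the period, where the
    forward trajectory is at hand. *)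
Lemma periodic_extension (H T : R) (g : R -> R3) : 1 <= T -> Fwd g H -> g T = g 0 ->
  exists k, (forall t, traj_at mu H (fun _ => True) k t) /\ k 0 = g 0.
Proof.
intros hT hg hper.
assert (hper1 : forall t, 0 <= t -> g (t + T) = g t).
{ intros t ht; symmetry; apply (forward_unique H g (fun s => g (s + T))); auto.
  - intros s hs; apply (traj_at_transport mu H (fun s => 0 <= s) _ g _ s T 1);
      [lra|exact hs|intros r hr _; split; [lra|reflexivity]|apply hg; lra].
  - now rewrite Rplus_0_l. }
assert (hpern : forall n t, 0 <= t -> g (t + INR n * T) = g t).
{ induction n as [|n IH]; intros t ht; [f_equal; simpl; ring|].
  rewrite S_INR; replace (t + (INR n + 1) * T) with (t + INR n * T + T) by ring.
  rewrite hper1; [now apply IH|]; assert (hn := pos_INR n); nra. }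
set (N := fun s => nat_above (- s)).
assert (hN : forall s n, (N s <= n)%nat -> 0 <= s + INR n * T).
{ intros s n hn; apply le_INR in hn; unfold N in hn.
  generalize (nat_above_spec (- s)) (pos_INR (nat_above (- s))); nra. }
assert (hk : forall s n, 0 <= s + INR n * T ->
   g (s + INR n * T) = g (s + INR (N s) * T)).
{ intros s n hn; destruct (Nat.le_ge_cases (N s) n) as [hle|hge].
  - replace n with (N s + (n - N s))%nat by lia; rewrite plus_INR.
    replace (s + (INR (N s) + INR (n - N s)) * T)
      with (s + INR (N s) * T + INR (n - N s) * T) by ring.
    apply hpern, hN; lia.
  - replace (N s) with (n + (N s - n))%nat by lia; rewrite plus_INR.
    replace (s + (INR n + INR (N s - n)) * T)
      with (s + INR n * T + INR (N s - n) * T) by ring.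
    symmetry; now apply hpern. }
exists (fun s => g (s + INR (N s) * T)); split.
- intros t; set (n := N (t - 1)).
  assert (hn : 0 <= t - 1 + INR n * T) by (apply hN; unfold n; lia).
  apply (traj_at_transport mu H (fun s => 0 <= s) _ g _ t (INR n * T) 1);
    [lra|trivial| |apply hg; lra].
  intros s _ hst; apply Rabs_lt_between' in hst; split; [lra|].
  symmetry; apply hk; lra.
- rewrite <- (hk 0 0%nat); [f_equal|]; simpl; lra.
Qed.

Lemma fixed_trajectory_exists (H : R) (q : R2) : posq q -> half_return H q = q ->
  exists g, (forall t, traj_at mu H (fun _ => True) g t) /\ g 0 = emb q.
Proof.
intros hq hf; assert (hPI := PI2_1).
assert (ht := tau_pos _ (proj2 hq)).
destruct (forward_exists H q (fixed_forever H q hq hf)) as [g [hg g0]].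
destruct (forward_step H g q hg g0 hq) as [_ [_ [hg1 h1]]].
rewrite hf in h1.
destruct (forward_step H _ q hg1 h1 hq) as [_ [_ [_ h2]]].
rewrite hf, !Sinv_invol in h2.
destruct (periodic_extension H (0 + tau (snd q) + tau (snd q)) g) as [k [hk k0]];
  [lra|exact hg|now rewrite h2|].
exists k; split; [exact hk|now rewrite k0].
Qed.

Section FixedOrbit.

Context (H : R) (q : R2) (g : R -> R3).
Context (hq : posq q) (hfix : half_return H q = q).
Context (hg : forall t, traj_at mu H (fun _ => True) g t) (g0 : g 0 = emb q).

Notation T := (tau (snd q)).

Lemma T_bounds : PI < T < tg.
Proof. apply tau_pos, hq. Qed.

Lemma orbit_arc : (forall t, 0 <= t <= T -> g t = flow mu H (emb q) t) /\
  g T = Sinv (emb q) /\ forall t, 0 < t < T -> 0 < zc (g t).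
Proof.
destruct (half_turn H (fun _ => True) g q hq) as [h1 [h2 [h3 _]]]; auto.
rewrite hfix in h2; auto.
Qed.

(** Both sides are trajectories through [emb q] at time [0]. *)
Lemma orbit_symmetry (s : R) : g (s + T) = Sinv (g s).
Proof.
apply Sinv_inj; rewrite Sinv_invol.
apply (crossing_trajectory_unique mu H (fun _ => True)
         (fun s => Sinv (g (s + T))) g 0); auto.
- intros a b c _ _ _; trivial.
- intros t _; now apply (traj_at_S_shift mu H _ (fun _ => True)).
- rewrite Rplus_0_l, (proj1 (proj2 orbit_arc)), Sinv_invol; now symmetry.
Qed.

Lemma orbit_period (s : R) : g (s + 2 * T) = g s.
Proof.
replace (s + 2 * T) with (s + T + T) by ring.
now rewrite !orbit_symmetry, Sinv_invol.
Qed.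

Lemma orbit_reduce (s : R) :
  exists r, 0 <= r < T /\ (g s = g r \/ g s = Sinv (g r)).
Proof.
assert (hT := T_bounds); assert (hPI := PI_RGT_0).
assert (hup : forall n r, g (r + INR n * T) = g r \/ g (r + INR n * T) = Sinv (g r)).
{ induction n as [|n IH]; intros r; [left; f_equal; simpl; ring|].
  rewrite S_INR; replace (r + (INR n + 1) * T) with (r + INR n * T + T) by ring.
  rewrite orbit_symmetry; destruct (IH r) as [-> | ->]; [now right|left].
  apply Sinv_invol. }
assert (hk : forall k r, g (r + IZR k * T) = g r \/ g (r + IZR k * T) = Sinv (g r)).
{ intros k r; destruct (Z_le_gt_dec 0 k) as [h|h].
  - rewrite <- (Z2Nat.id k h), <- INR_IZR_INZ; apply hup.
  - destruct (hup (Z.to_nat (- k)) (r + IZR k * T)) as [e|e];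
      rewrite INR_IZR_INZ, Z2Nat.id, opp_IZR in e by lia;
      replace (r + IZR k * T + - IZR k * T) with r in e by ring; [now left|right].
    now rewrite e, Sinv_invol. }
set (k := Int_part (s / T)); exists (s - IZR k * T).
destruct (base_Int_part (s / T)) as [b1 b2]; fold k in b1, b2.
split.
- replace s with (s / T * T) at 1 2 by (field; lra); nra.
- destruct (hk k (s - IZR k * T)) as [e|e];
    replace (s - IZR k * T + IZR k * T) with s in e by ring; auto.
Qed.

Lemma orbit_S (p : R3) : orbit g p -> orbit g (Sinv p).
Proof. intros [s <-]; exists (s + T); apply orbit_symmetry. Qed.

Lemma orbit_Sigma (p : R3) :
  (orbit g p /\ Sigma p) <-> (p = emb q \/ p = Sinv (emb q)).
Proof.
assert (hT := T_bounds); assert (hPI := PI_RGT_0).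
destruct orbit_arc as [_ [hl hpos]]; split.
- intros [[s <-] hs]; unfold Sigma in hs.
  destruct (orbit_reduce s) as [r [hr e]].
  assert (hz : zc (g r) = 0).
  { destruct e as [e|e]; rewrite e in hs; [exact hs|rewrite zc_S in hs; lra]. }
  assert (r = 0); [|subst r; rewrite g0 in e; exact e].
  destruct (Req_dec r 0) as [h|h]; [exact h|].
  specialize (hpos r ltac:(lra)); lra.
- intros [->| ->]; (split; [|apply emb_coords || (unfold Sigma; rewrite zc_S;
    destruct (emb_coords q) as [_ [_ ->]]; ring)]).
  + now exists 0.
  + now exists T.
Qed.

Lemma emb_neq_S : emb q <> Sinv (emb q).
Proof.
intros h; apply (f_equal xc) in h; rewrite xc_S in h.
destruct (emb_coords q) as [e1 [e2 _]]; rewrite e1, e2 in h.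
destruct hq; lra.
Qed.

Lemma orbit_simple : simple_crossing_periodic_orbit mu H (orbit g).
Proof.
assert (hT := T_bounds); assert (hPI := PI_RGT_0).
split; [split; [|split]|].
- exists g; split; [apply crossing_trajectory_iff; auto|split; [|split]].
  + exists 0, T; rewrite g0, (proj1 (proj2 orbit_arc)); exact emb_neq_S.
  + exists (2 * T); split; [lra|]; intros t; apply orbit_period.
  + intros p; tauto.
- exists (emb q); split; [now exists 0|apply emb_coords].
- intros p [s <-] hs; destruct (hg s) as [_ [_ [_ hc]]].
  apply Sigma_c_iff; split; [exact hs|now apply hc].
- exists (emb q), (Sinv (emb q)); split; [exact emb_neq_S|exact orbit_Sigma].
Qed.

Lemma orbit_least_period : least_period g (2 * T).
Proof.
assert (hT := T_bounds); assert (hPI := PI_RGT_0).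
split; [lra|split; [intros t; apply orbit_period|]].
intros T' hT' hper; apply Rnot_lt_le; intros hlt.
assert (e : g T' = emb q) by (rewrite <- (Rplus_0_l T'), hper; exact g0).
destruct orbit_arc as [_ [hl hpos]].
assert (hz : zc (g T') = 0) by (rewrite e; apply emb_coords).
destruct (Rtotal_order T' T) as [h|[h|h]].
- specialize (hpos T' ltac:(lra)); lra.
- subst T'; rewrite hl in e; apply emb_neq_S; now symmetry.
- replace T' with (T' - T + T) in hz by ring.
  rewrite orbit_symmetry, zc_S in hz; specialize (hpos (T' - T) ltac:(lra)); lra.
Qed.

End FixedOrbit.

(** ** Every orbit of simple period is symmetric *)

(** The gap [y0 r - E(r) x] shrinks strictly with [r], because
    [2 mu exp (- mu r) < 1] beyond a half turn. *)
Lemma two_cycle_gap (s s' : R) : PI < s' -> s' < s -> s < tg ->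
  y0 mu s - exp (- 2 * mu * s) * x0 mu s < y0 mu s' - exp (- 2 * mu * s') * x0 mu s.
Proof.
intros h1 h2 h3; generalize (tg_bounds) PI2_1; intros hb hPI.
apply (strict_decr_of_derive (fun r => y0 mu r - exp (- 2 * mu * r) * x0 mu s)
  (fun r => x0 mu r * exp (- mu * r) / sin r + 2 * mu * exp (- 2 * mu * r) * x0 mu s));
  [| | |exact h2].
- intros r hr; assert (hs := sin_neg_arc r ltac:(lra)).
  assert (hd := is_derive_y0 mu r ltac:(lra)).
  assert (e : Derive (fun x : R => y0 mu x) r = _) by exact (is_derive_unique _ _ _ hd).
  auto_derive; [now (eexists; exact hd)|rewrite e; ring].
- intros r hr; assert (hs := sin_neg_arc r ltac:(lra)).
  assert (hx := x0_pos mu s hmu ltac:(lra)).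
  assert (hxr := x0_decr r s ltac:(lra) ltac:(lra) ltac:(lra)).
  replace (exp (- 2 * mu * r)) with (exp (- mu * r) * exp (- mu * r))
    by (rewrite <- exp_plus; f_equal; ring).
  assert (he := decay_small r ltac:(lra)).
  assert (hep := exp_pos (- mu * r)); set (e := exp (- mu * r)) in *.
  assert (hsb := SIN_bound r).
  assert (hq : x0 mu r / sin r <= - x0 mu r).
  { apply Rmult_le_reg_r with (- sin r); [lra|].
    replace (x0 mu r / sin r * - sin r) with (- x0 mu r) by (field; lra); nra. }
  replace (x0 mu r * e / sin r + 2 * mu * (e * e) * x0 mu s)
    with (e * (x0 mu r / sin r + 2 * mu * e * x0 mu s)) by (field; lra).
  assert (2 * mu * e * x0 mu s < 1 * x0 mu s) by (apply Rmult_lt_compat_r; lra).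
  nra.
- intros r hr; eapply continuity_pt_of_derive.
  assert (hs := sin_neg_arc r ltac:(lra)).
  assert (hd := is_derive_y0 mu r ltac:(lra)).
  auto_derive; [now (eexists; exact hd)|reflexivity].
Qed.

(** The two equations read [y' + E x' = H (x + E y)] and, after exchange,
    [y + E' x = H (x' + E' y')]. For flights [s' < s] the second right-hand side
    is the larger one, whereas the gap makes the first left-hand side larger. *)
Lemma no_two_cycle_aux (H s s' : R) : 0 < H -> PI < s' -> s' < s -> s < tg ->
  y0 mu s' = H * x0 mu s - exp (- 2 * mu * s) * (x0 mu s' - H * y0 mu s) ->
  y0 mu s = H * x0 mu s' - exp (- 2 * mu * s') * (x0 mu s - H * y0 mu s') -> False.
Proof.
intros hH h1 h2 h3 e1 e2; generalize (tg_bounds) PI_RGT_0; intros hb hPI.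
assert (hgap := two_cycle_gap s s' h1 h2 h3).
assert (hx := x0_decr s' s h1 h2 ltac:(lra)).
assert (hy := y0_decr mu s' s hmu h1 h2 ltac:(lra)).
assert (hx0 := x0_pos mu s hmu ltac:(lra)).
assert (hy0 := y0_pos s ltac:(lra)).
assert (hE := exp_pos (- 2 * mu * s)).
assert (hEE : exp (- 2 * mu * s) < exp (- 2 * mu * s'))
  by (apply exp_increasing; nra).
set (E := exp (- 2 * mu * s)) in *; set (E' := exp (- 2 * mu * s')) in *.
set (x := x0 mu s) in *; set (x' := x0 mu s') in *.
set (y := y0 mu s) in *; set (y' := y0 mu s') in *.
assert (H * (x + E * y) < H * (x' + E' * y')) by (apply Rmult_lt_compat_l; nra).
assert (E * x <= E * x') by nra.
nra.
Qed.

Lemma no_two_cycle (H : R) (q : R2) : 0 < H -> posq q -> posq (half_return H q) ->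
  half_return H (half_return H q) = q -> half_return H q = q.
Proof.
intros hH hq hq' h2.
destruct (tau_spec (snd q) (proj2 hq)) as [t1 t2].
destruct (tau_spec (snd (half_return H q)) (proj2 hq')) as [s1 s2].
set (q' := half_return H q) in *.
assert (e1 : fst q' = x0 mu (tau (snd q))) by reflexivity.
assert (e2 : snd q' = H * x0 mu (tau (snd q))
  - exp (- 2 * mu * tau (snd q)) * (fst q - H * snd q)) by reflexivity.
assert (e3 : fst q = x0 mu (tau (snd q'))) by (rewrite <- h2; reflexivity).
assert (e4 : snd q = H * x0 mu (tau (snd q'))
  - exp (- 2 * mu * tau (snd q')) * (fst q' - H * snd q')).
{ rewrite <- h2 at 1; reflexivity. }
clearbody q'.
set (s := tau (snd q)) in *; set (s' := tau (snd q')) in *.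
rewrite e3, <- t2 in e2; rewrite e1, <- s2 in e4.
rewrite <- s2 in e2; rewrite <- t2 in e4.
destruct (Rtotal_order s s') as [h|[h|h]].
- exfalso; apply (no_two_cycle_aux H s' s hH); tauto || lra.
- destruct q as [x y], q' as [x' y']; simpl in *; f_equal; congruence.
- exfalso; apply (no_two_cycle_aux H s s' hH); tauto || lra.
Qed.

Lemma orbit_shift (g : R -> R3) (c : R) :
  same_set (orbit g) (orbit (fun s => g (s + c))).
Proof.
intros p; split; intros [s <-].
- exists (s - c); f_equal; ring.
- now exists (s + c).
Qed.

Lemma trajectory_shift (H c : R) (g : R -> R3) :
  (forall t, traj_at mu H (fun _ => True) g t) ->
  forall t, traj_at mu H (fun _ => True) (fun s => g (s + c)) t.
Proof.
intros hg t; apply (traj_at_transport mu H (fun _ => True) _ g _ t c 1);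
  [lra|trivial|now intros|apply hg].
Qed.

Lemma posq_neq_S (a b : R2) : posq a -> posq b -> a <> S_Sigma b.
Proof.
destruct a, b; unfold posq, S_Sigma; simpl; intros [h1 _] [_ h2] e.
injection e; intros; lra.
Qed.

(** If one of the crossings is in the negative quadrant, the next one is in the
    positive quadrant: the origin of time can be chosen there. *)
Lemma simple_orbit_fixed (H : R) (gam : R3 -> Prop) : 0 < H ->
  simple_crossing_periodic_orbit mu H gam ->
  exists g q, (forall t, traj_at mu H (fun _ => True) g t) /\ g 0 = emb q /\
    posq q /\ half_return H q = q /\ same_set gam (orbit g).
Proof.
intros hH [[[g [hg [_ [_ hgam]]]] [[p [hp hs]] hc]] [pa [pb [hab hpts]]]].
assert (hg' : forall t, traj_at mu H (fun _ => True) g t)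
  by (intros t; now apply crossing_trajectory_iff).
clear hg; rename hg' into hg.
assert (hpos : exists c q, g c = emb q /\ posq q).
{ destruct (proj1 (hgam p) hp) as [c hgc].
  assert (hpc := proj1 (Sigma_c_iff _ _ _) (hc p hp hs)).
  destruct hpc as [hz hxy]; assert (he := Sigma_emb p hs).
  destruct (Rtotal_order (xc p) 0) as [hx|[hx|hx]]; [|rewrite hx in hxy; lra|].
  - assert (hq : posq (- yc p, - xc p)) by (split; simpl; nra).
    destruct (half_turn H (fun _ => True) (fun s => Sinv (g (s + c))) _ hq)
      as [_ [h2 [_ h4]]]; auto.
    + intros t _; now apply (traj_at_S_shift mu H c (fun _ => True)).
    + rewrite Rplus_0_l, hgc, he, Sinv_emb; reflexivity.
    + exists (tau (snd (- yc p, - xc p)) + c), (half_return H (- yc p, - xc p)).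
      split; [now apply Sinv_inj|exact h4].
  - exists c, (xc p, yc p); split; [now rewrite hgc|].
    split; simpl; nra. }
destruct hpos as [c [q [hgc hq]]].
set (k := fun s => g (s + c)).
assert (hk := trajectory_shift H c g hg); fold k in hk.
assert (k0 : k 0 = emb q) by (unfold k; now rewrite Rplus_0_l).
destruct (half_turn H (fun _ => True) k q hq) as [_ [h2 [_ h4]]]; auto.
set (q1 := half_return H q) in *.
destruct (half_turn H (fun _ => True) (fun s => Sinv (k (s + tau (snd q)))) q1 h4)
  as [_ [h6 [_ h8]]]; auto.
{ intros t _; now apply (traj_at_S_shift mu H _ (fun _ => True)). }
{ rewrite Rplus_0_l, h2; apply Sinv_invol. }
apply Sinv_inj in h6.
assert (hin : forall s, Sigma (k s) -> k s = pa \/ k s = pb).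
{ intros s hsig; apply hpts; split; [|exact hsig]; apply hgam; now exists (s + c). }
assert (hfix : half_return H q1 = q).
{ assert (a1 := hin 0); rewrite k0 in a1.
  assert (a2 := hin (tau (snd q))); rewrite h2, Sinv_emb in a2.
  assert (a3 := hin (tau (snd q1) + tau (snd q))); rewrite h6 in a3.
  specialize (a1 (proj2 (proj2 (emb_coords _)))).
  specialize (a2 (proj2 (proj2 (emb_coords _)))).
  specialize (a3 (proj2 (proj2 (emb_coords _)))).
  (* the middle crossing is in the other quadrant *)
  assert (n1 : forall r, posq r -> emb r <> emb (S_Sigma q1)).
  { intros r hr e; apply emb_inj in e; now apply (posq_neq_S r q1). }
  assert (n2 := n1 q hq); assert (n3 := n1 _ h8).
  apply emb_inj; destruct a1, a2, a3; congruence. }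
exists k, q; split; [exact hk|split; [exact k0|split; [exact hq|split]]].
- now apply no_two_cycle.
- intros r; rewrite (hgam r); apply orbit_shift.
Qed.

Lemma p0_posq (t : R) : PI < t < tg -> posq (p0 mu t).
Proof.
intros ht; generalize (tg_bounds); intros hb; split; simpl.
- apply x0_pos; [exact hmu|lra].
- now apply (y0_pos).
Qed.

Lemma p0_fixed_iff (H t : R) : PI < t < tg ->
  half_return H (p0 mu t) = p0 mu t <-> H = eta mu t.
Proof.
intros ht; destruct (p0_posq t ht) as [hx hy]; simpl in hx, hy.
rewrite (eta_fixed_form t ht).
assert (hE := exp_pos (- 2 * mu * t)).
assert (hd : 0 < x0 mu t + exp (- 2 * mu * t) * y0 mu t) by nra.
unfold half_return, p0; simpl fst; simpl snd.
rewrite (tau_y0 t ht); split; intros h.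
- injection h; intros h'.
  replace (y0 mu t + exp (- 2 * mu * t) * x0 mu t)
    with (H * (x0 mu t + exp (- 2 * mu * t) * y0 mu t)) by lra.
  field; lra.
- f_equal.
  assert (h' : H * (x0 mu t + exp (- 2 * mu * t) * y0 mu t)
    = y0 mu t + exp (- 2 * mu * t) * x0 mu t) by (rewrite h; field; lra).
  lra.
Qed.

Lemma fixed_is_p0 (H : R) (q : R2) : posq q -> half_return H q = q ->
  PI < tau (snd q) < tg /\ q = p0 mu (tau (snd q)) /\ H = eta mu (tau (snd q)).
Proof.
intros hq hf; destruct (tau_spec (snd q) (proj2 hq)) as [h1 h2].
assert (e : q = p0 mu (tau (snd q))).
{ unfold p0; rewrite h2; rewrite <- hf at 1.
  destruct q as [x y]; unfold half_return; simpl in *; f_equal.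
  injection hf; auto. }
split; [exact h1|split; [exact e|]].
apply p0_fixed_iff; [exact h1|]; now rewrite <- e.
Qed.

Lemma eta_inj (s t : R) : PI < s < tg -> PI < t < tg -> eta mu s = eta mu t -> s = t.
Proof.
intros hs ht e; destruct (Rtotal_order s t) as [h|[h|h]]; [|exact h|].
- generalize (eta_decr s t); lra.
- generalize (eta_decr t s); lra.
Qed.

Lemma same_set_orbit (H : R) (g k : R -> R3) :
  (forall t, traj_at mu H (fun _ => True) g t) ->
  (forall t, traj_at mu H (fun _ => True) k t) -> g 0 = k 0 ->
  same_set (orbit g) (orbit k).
Proof.
intros hg hk e.
assert (h : forall t, g t = k t).
{ intros t; apply (crossing_trajectory_unique mu H (fun _ => True) g k 0); auto.
  intros a b c; trivial. }
intros p; split; intros [s <-]; exists s; auto.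
Qed.

Lemma simple_same_set (H : R) (A B : R3 -> Prop) : same_set A B ->
  simple_crossing_periodic_orbit mu H B -> simple_crossing_periodic_orbit mu H A.
Proof.
intros e [[[g [h1 [h2 [h3 h4]]]] [[p [hp hs]] hc]] [pa [pb [hab hpts]]]].
split; [split; [|split]|].
- exists g; split; [exact h1|split; [exact h2|split; [exact h3|]]].
  intros r; rewrite (e r); apply h4.
- exists p; split; [now apply e|exact hs].
- intros r hr; apply hc; now apply e.
- exists pa, pb; split; [exact hab|]; intros r; rewrite (e r); apply hpts.
Qed.

(** * The half-return map near its fixed point *)

(** With [t = tau y], [dphi] and [dE] are the derivatives of [x0 t] and of the
    contraction factor [exp (- 2 mu t)] with respect to [y]. *)
Definition dphi (t : R) : R := y0 mu t * exp (2 * mu * t) / x0 mu t.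
Definition dE (t : R) : R := - 2 * mu * exp (- mu * t) * sin t / x0 mu t.
Definition trace_N (H t : R) : R :=
  H * dphi t + exp (- 2 * mu * t) * H - dE t * (x0 mu t - H * y0 mu t).

Lemma is_derive_tau (t : R) : PI < t < tg ->
  is_derive tau (y0 mu t) (sin t * exp (mu * t) / x0 mu t).
Proof.
intros ht; generalize (tg_bounds); intros hb.
assert (hs := sin_neg_arc t ltac:(lra)); assert (hx := x0_pos mu t hmu ltac:(lra)).
assert (hy := y0_pos t ht); assert (he := exp_pos (mu * t)).
replace (sin t * exp (mu * t) / x0 mu t)
  with (/ (x0 mu t * exp (- mu * t) / sin t))
  by (rewrite exp_neg_mul; field; repeat split; lra).
apply (is_derive_inverse_decr (y0 mu) tau PI tg t); [exact ht| | | | |].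
- intros r s h1 h2 h3; apply y0_decr; lra.
- apply Rdiv_pos_neg; [|exact hs]; apply Rmult_lt_0_compat; [lra|apply exp_pos].
- apply is_derive_y0; lra.
- intros y s h1 <-; now apply (tau_y0).
- exists (y0 mu t); split; [exact hy|]; intros y hy'.
  apply Rabs_lt_between' in hy'; apply (tau_spec); lra.
Qed.

Lemma is_derive_x0_tau (t : R) : PI < t < tg ->
  is_derive (fun y => x0 mu (tau y)) (y0 mu t) (dphi t).
Proof.
intros ht; generalize (tg_bounds); intros hb.
assert (hs := sin_neg_arc t ltac:(lra)); assert (hx := x0_pos mu t hmu ltac:(lra)).
assert (h1 := is_derive_x0 mu t ltac:(lra)).
rewrite <- (tau_y0 t ht) in h1 at 1.
assert (h := is_derive_comp (x0 mu) tau (y0 mu t) _ _ h1 (is_derive_tau t ht)).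
replace (dphi t) with (scal (sin t * exp (mu * t) / x0 mu t)
  (y0 mu t * exp (mu * t) / sin t)); [exact h|].
unfold dphi, scal; simpl; unfold mult; simpl.
replace (2 * mu * t) with (mu * t + mu * t) by ring; rewrite exp_plus.
field; split; lra.
Qed.

Lemma is_derive_E_tau (t : R) : PI < t < tg ->
  is_derive (fun y => exp (- 2 * mu * tau y)) (y0 mu t) (dE t).
Proof.
intros ht; generalize (tg_bounds); intros hb.
assert (hx := x0_pos mu t hmu ltac:(lra)).
assert (h1 := is_derive_E mu t).
rewrite <- (tau_y0 t ht) in h1 at 1.
assert (h := is_derive_comp (fun r => exp (- 2 * mu * r)) tau (y0 mu t) _ _ h1
               (is_derive_tau t ht)).
replace (dE t) with (scal (sin t * exp (mu * t) / x0 mu t)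
  (- 2 * mu * exp (- 2 * mu * t))); [exact h|].
unfold dE, scal; simpl; unfold mult; simpl.
replace (- 2 * mu * t) with (- mu * t + - mu * t) by ring.
rewrite exp_plus, exp_neg_mul; assert (he := exp_pos (mu * t)).
field; split; lra.
Qed.

Lemma half_return_differential (H t : R) : PI < t < tg ->
  is_differential (half_return H) (p0 mu t)
    (companion (dphi t) (exp (- 2 * mu * t)) (trace_N H t)).
Proof.
intros ht.
assert (hphi := is_derive_x0_tau t ht); assert (hE := is_derive_E_tau t ht).
set (f1 := fun y => x0 mu (tau y)) in *.
set (f2 := fun y => exp (- 2 * mu * tau y)) in *.
assert (e1 : Derive (fun y : R => f1 y) (y0 mu t) = dphi t)
  by exact (is_derive_unique _ _ _ hphi).
assert (e2 : Derive (fun y : R => f2 y) (y0 mu t) = dE t)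
  by exact (is_derive_unique _ _ _ hE).
assert (hext : forall (l : R2 -> R2) l',
  is_differential (half_return H) (p0 mu t) l -> (forall h, l h = l' h) ->
  is_differential (half_return H) (p0 mu t) l').
{ intros l l' hl he; exact (filterdiff_ext_lin _ _ _ hl he). }
apply (hext (fun h => (plus (scal (fst h) 0) (scal (snd h) (dphi t)),
  plus (scal (fst h) (- f2 (y0 mu t))) (scal (snd h) (trace_N H t))))).
2: { intros [h1 h2]; unfold companion, plus, scal; simpl; unfold mult; simpl.
     unfold f2; rewrite (tau_y0 t ht); f_equal; ring. }
apply (filterdiff_pair (fun q => f1 (snd q))
  (fun q => H * f1 (snd q) - f2 (snd q) * (fst q - H * snd q))).
- apply (is_derive_filterdiff (fun _ y => f1 y) (x0 mu t) (y0 mu t) (fun _ _ => 0)).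
  + apply filter_forall; intros [a b]; apply (is_derive_const (f1 b)).
  + exact hphi.
  + apply continuous_const.
- apply (is_derive_filterdiff (fun x y => H * f1 y - f2 y * (x - H * y))
    (x0 mu t) (y0 mu t) (fun _ y => - f2 y)).
  + apply filter_forall; intros [a b]; simpl fst; simpl snd.
    auto_derive; [trivial|ring].
  + auto_derive; [split; [now exists (dphi t)|split; [now exists (dE t)|trivial]]|].
    rewrite e1, e2; unfold trace_N, f2; rewrite (tau_y0 t ht); ring.
  + apply (continuous_comp snd (fun y => - f2 y)); [apply continuous_snd|].
    apply (ex_derive_continuous (fun y => - f2 y)); auto_derive.
    now exists (dE t).
Qed.

(** For the determinant [D] and the trace [T], the bound [T < 1 + D] is the
    strict monotonicity of [eta] in disguise: [1 - T + D] is, up to a positive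
    factor, the derivative of the fixed-point parameter with respect to [y]. The bounds [D < 1] and [- 1 < T] hold by the size of the terms. *)
Lemma jury_conditions (t : R) : PI < t < tg ->
  dphi t * exp (- 2 * mu * t) = y0 mu t / x0 mu t /\
  0 < dphi t * exp (- 2 * mu * t) < 1 /\
  Rabs (trace_N (eta mu t) t) < 1 + dphi t * exp (- 2 * mu * t).
Proof.
intros ht; generalize (tg_bounds) PI2_1; intros hb hPI.
assert (hs := sin_neg_arc t ltac:(lra)); assert (hx := x0_pos mu t hmu ltac:(lra)).
assert (hy := y0_pos t ht).
assert (hyx := y0_lt_x0 t ht).
assert (hgr := x0_y0_growth t ltac:(lra)).
assert (heta := eta_fixed_form t ht).
assert (heta0 := proj1 (I_mu_unit _ (eta_in_I t ht))).
assert (hE := E_bounds t ltac:(lra)).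
assert (heE : exp (2 * mu * t) * exp (- 2 * mu * t) = 1).
{ rewrite <- exp_plus; replace (2 * mu * t + - 2 * mu * t) with 0 by ring; apply exp_0. }
assert (hdet : dphi t * exp (- 2 * mu * t) = y0 mu t / x0 mu t).
{ unfold dphi; replace (y0 mu t * exp (2 * mu * t) / x0 mu t * exp (- 2 * mu * t))
    with (y0 mu t * (exp (2 * mu * t) * exp (- 2 * mu * t)) / x0 mu t) by (field; lra).
  rewrite heE; f_equal; ring. }
split; [exact hdet|].
assert (hd01 : 0 < y0 mu t / x0 mu t < 1).
{ split; [now apply Rdiv_lt_0_compat|].
  apply Rmult_lt_reg_r with (x0 mu t); [exact hx|]; unfold Rdiv.
  rewrite Rmult_assoc, Rinv_l by lra; lra. }
rewrite hdet; split; [exact hd01|].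
assert (hdE : 0 < dE t * x0 mu t < 1).
{ unfold dE; replace (- 2 * mu * exp (- mu * t) * sin t / x0 mu t * x0 mu t)
    with (2 * mu * exp (- mu * t) * - sin t) by (field; lra).
  assert (hep := exp_pos (- mu * t)); split; [repeat apply Rmult_lt_0_compat; lra|].
  assert (he := decay_small t ltac:(lra)).
  assert (hsb := SIN_bound t).
  assert (0 < 2 * mu * exp (- mu * t)) by (repeat apply Rmult_lt_0_compat; lra).
  nra. }
assert (hdE0 : 0 < dE t) by nra.
assert (hdphi : 0 < dphi t).
{ unfold dphi; apply Rdiv_lt_0_compat; [|exact hx].
  apply Rmult_lt_0_compat; [exact hy|apply exp_pos]. }
assert (hphiy : dphi t * y0 mu t < x0 mu t).
{ unfold dphi; apply Rmult_lt_reg_r with (x0 mu t); [exact hx|].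
  replace (y0 mu t * exp (2 * mu * t) / x0 mu t * y0 mu t * x0 mu t)
    with ((y0 mu t * exp (mu * t)) * (y0 mu t * exp (mu * t))).
  - assert (0 < y0 mu t * exp (mu * t))
      by (apply Rmult_lt_0_compat; [lra|apply exp_pos]).
    now apply Rmult_gt_0_lt_compat.
  - replace (2 * mu * t) with (mu * t + mu * t) by ring; rewrite exp_plus.
    field; lra. }
unfold trace_N; set (E := exp (- 2 * mu * t)) in *.
set (h := eta mu t) in *; set (x := x0 mu t) in *; set (y := y0 mu t) in *.
set (p := dphi t) in *; set (q := dE t) in *.
apply Rabs_def1.
- assert (hden : 0 < x + E * y) by nra.
  assert (hh : h * (x + E * y) = y + E * x) by (rewrite heta; field; lra).
  assert (hpE : p * E * x = y) by (rewrite hdet; field; lra).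
  apply Rmult_lt_reg_r with (x + E * y); [exact hden|].
  assert (key : (1 + y / x) * (x + E * y) - (h * p + E * h - q * (x - h * y)) * (x + E * y)
    = (1 - E * E) * (x - p * y) + q * (x * x - y * y)).
  { replace ((h * p + E * h - q * (x - h * y)) * (x + E * y))
      with ((h * (x + E * y)) * (p + E + q * y) - q * x * (x + E * y)) by ring.
    rewrite hh, <- hdet; ring. }
  assert (E * E < 1 * 1) by (apply Rmult_le_0_lt_compat; lra).
  assert (y * y < x * x) by (apply Rmult_le_0_lt_compat; lra).
  assert (0 < (1 - E * E) * (x - p * y)) by (apply Rmult_lt_0_compat; lra).
  assert (0 < q * (x * x - y * y)) by (apply Rmult_lt_0_compat; lra).
  lra.
- assert (0 < h * p) by nra; assert (0 < E * h) by nra.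
  assert (0 < q * (h * y))
    by (apply Rmult_lt_0_compat; [lra|apply Rmult_lt_0_compat; lra]).
  nra.
Qed.

Lemma contraction_exists (t : R) : PI < t < tg ->
  exists Q r kappa c C,
    lyapunov (companion (dphi t) (exp (- 2 * mu * t)) (trace_N (eta mu t) t)) Q kappa c C /\
    exists kappa', contracts (half_return (eta mu t)) (p0 mu t) Q r kappa'.
Proof.
intros ht; destruct (jury_conditions t ht) as [_ [hd hT]].
destruct (companion_lyapunov _ _ _ (exp_pos (- 2 * mu * t)) hd hT)
  as [Q [kappa [c [C hQ]]]].
assert (hfix := proj2 (p0_fixed_iff (eta mu t) t ht) eq_refl).
destruct (fixed_point_contraction _ _ _ Q kappa c C
  (half_return_differential (eta mu t) t ht) hfix hQ) as [r [kappa' hc]].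
now exists Q, r, kappa, c, C; split; [exact hQ|exists kappa'].
Qed.

(** ** The Poincaré map and its multipliers *)

Lemma stays_up (H b : R) (I : R -> Prop) (g : R -> R3) (q : R2) : posq q ->
  0 < b < tau (snd q) -> (forall t, 0 <= t <= b -> I t) ->
  (forall t, I t -> traj_at mu H I g t) -> g 0 = emb q -> 0 < zc (g b).
Proof.
intros hq hb hI hg g0.
destruct (flow_half_return H q (proj2 hq)) as [_ [_ h3]].
rewrite (follow_flow mu H b I g); auto; try lra.
- rewrite g0; apply h3; exact hb.
- rewrite g0; now apply posq_up.
- rewrite g0; intros s hs; apply h3; lra.
Qed.

Lemma poincare_return_unique (H : R) (p q : R2) : posq p ->
  poincare_return mu H p q -> q = half_return H (half_return H p).
Proof.
intros hp [g [t1 [t2 [ht [hg [g0 [hs1 [g2 hns]]]]]]]].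
assert (hPI := PI_RGT_0).
set (I := fun t => 0 <= t <= t2) in *.
assert (hg' := proj1 (crossing_trajectory_iff _ _ _ _) hg); clear hg.
assert (hT := tau_pos _ (proj2 hp)).
assert (hle : tau (snd p) <= t1).
{ apply Rnot_lt_le; intros hlt.
  assert (h := stays_up H t1 I g p hp ltac:(lra) ltac:(unfold I; intros; lra) hg' g0).
  unfold Sigma in hs1; lra. }
destruct (half_turn H I g p hp) as [_ [h2 [h3 h4]]]; auto.
{ unfold I; intros; lra. }
assert (e1 : t1 = tau (snd p)).
{ destruct (Req_dec (tau (snd p)) t1) as [e|hne]; [now symmetry|exfalso].
  apply (hns (tau (snd p))); [lra|exact hne|].
  rewrite h2, Sinv_emb; apply emb_coords. }
set (q1 := half_return H p) in *; set (T := tau (snd p)) in *.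
set (k := fun s => Sinv (g (s + T))).
assert (hk : forall s, I (s + T) -> traj_at mu H (fun s => I (s + T)) k s)
  by now apply traj_at_S_shift.
assert (k0 : k 0 = emb q1) by (unfold k; rewrite Rplus_0_l, h2; apply Sinv_invol).
assert (hT1 := tau_pos _ (proj2 h4)).
assert (hle1 : tau (snd q1) <= t2 - T).
{ apply Rnot_lt_le; intros hlt.
  assert (h := stays_up H (t2 - T) (fun s => I (s + T)) k q1 h4 ltac:(lra)
    ltac:(unfold I; intros; lra) hk k0).
  unfold k in h; replace (t2 - T + T) with t2 in h by ring.
  rewrite g2, zc_S in h; destruct (emb_coords q) as [_ [_ e]]; lra. }
destruct (half_turn H (fun s => I (s + T)) k q1 h4) as [_ [h5 _]]; auto.
{ unfold I; intros; lra. }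
apply Sinv_inj in h5.
assert (e2 : t2 = tau (snd q1) + T).
{ destruct (Req_dec (tau (snd q1) + T) t2) as [e|hne]; [now symmetry|exfalso].
  apply (hns (tau (snd q1) + T)); [lra|lra|].
  rewrite h5; apply emb_coords. }
apply emb_inj; now rewrite <- g2, e2.
Qed.

Lemma poincare_return_exists (H : R) (p : R2) : forever H p ->
  poincare_return mu H p (half_return H (half_return H p)).
Proof.
intros hp; assert (hPI := PI_RGT_0).
destruct (forward_exists H p hp) as [g [hg g0]].
destruct (forever_step H p hp) as [p1 hp1].
destruct (forever_step H _ hp1) as [p2 _].
destruct (forward_step H g p hg g0 p1) as [f1 [_ [f2 f3]]].
set (T := tau (snd p)) in *; set (q1 := half_return H p) in *.
set (k := fun s => Sinv (g (s + T))) in *.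
assert (f3' : k 0 = emb q1) by exact f3.
destruct (half_turn H (fun s => 0 <= s) g p p1 ltac:(intros; lra) hg g0)
  as [_ [a1 [a2 _]]].
destruct (half_turn H (fun s => 0 <= s) k q1 p2 ltac:(intros; lra) f2 f3')
  as [_ [b1 [b2 _]]].
assert (hT := tau_pos _ (proj2 p1)).
assert (hT1 := tau_pos _ (proj2 p2)).
fold T in a1, a2, hT.
exists g, T, (tau (snd q1) + T).
split; [lra|split; [|split; [exact g0|split; [|split]]]].
- apply crossing_trajectory_iff; intros t ht.
  apply (traj_at_mono mu H (fun s => 0 <= s)); [exact ht|intros; lra|apply hg; lra].
- rewrite a1, Sinv_emb; apply emb_coords.
- now apply Sinv_inj.
- intros s hs hne hz; unfold Sigma in hz.
  destruct (Rlt_le_dec s T) as [hlt|hge].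
  + specialize (a2 s ltac:(lra)); lra.
  + specialize (b2 (s - T) ltac:(lra)); unfold k in b2.
    replace (s - T + T) with s in b2 by ring; rewrite zc_S in b2; lra.
Qed.

Lemma poincare_map_eq (H : R) (p : R2) : forever H p ->
  poincare_map mu H p = half_return H (half_return H p).
Proof.
intros hp; apply poincare_return_unique; [exact (hp 0%nat)|].
apply (epsilon_spec (inhabits (0, 0)) (poincare_return mu H p)).
exists (half_return H (half_return H p)); now apply poincare_return_exists.
Qed.

Lemma poincare_return_S (H : R) (p q : R2) :
  poincare_return mu H p q -> poincare_return mu H (S_Sigma p) (S_Sigma q).
Proof.
intros [g [t1 [t2 [ht [hg [g0 [hs1 [g2 hns]]]]]]]].
exists (fun s => Sinv (g s)), t1, t2.
split; [exact ht|split; [|split; [|split; [|split]]]].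
- apply crossing_trajectory_iff; intros t hI; apply traj_at_S.
  revert t hI; now apply crossing_trajectory_iff.
- now rewrite g0, Sinv_emb.
- unfold Sigma in *; rewrite zc_S; lra.
- now rewrite g2, Sinv_emb.
- intros s hs hne hz; apply (hns s hs hne); unfold Sigma in *.
  rewrite zc_S in hz; lra.
Qed.

Lemma poincare_map_S_eq (H : R) (p : R2) : forever H (S_Sigma p) ->
  poincare_map mu H p = S_Sigma (half_return H (half_return H (S_Sigma p))).
Proof.
intros hp.
assert (h : poincare_return mu H p (poincare_map mu H p)).
{ apply (epsilon_spec (inhabits (0, 0)) (poincare_return mu H p)).
  exists (S_Sigma (half_return H (half_return H (S_Sigma p)))).
  rewrite <- (S_Sigma_invol p) at 1.
  now apply poincare_return_S, poincare_return_exists. }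
apply poincare_return_S, poincare_return_unique in h; [|exact (hp 0%nat)].
rewrite <- h; now rewrite S_Sigma_invol.
Qed.

(** ** A basin of attraction on the section *)

Lemma lyapunov_lt_close (L : R2 -> R2) (Q : R2 -> R) (kappa c C eps : R) (h : R2) :
  lyapunov L Q kappa c C -> 0 < eps -> Q h < c * eps ^ 2 ->
  Rabs (fst h) < eps /\ Rabs (snd h) < eps.
Proof.
intros [_ [hc [_ [_ [_ hQ]]]]] he hlt.
assert (hs : sq2 h < eps ^ 2).
{ apply Rmult_lt_reg_l with c; [exact hc|].
  eapply Rle_lt_trans; [apply hQ|exact hlt]. }
unfold sq2 in hs; generalize (pow2_ge_0 (fst h)) (pow2_ge_0 (snd h)); intros.
split; apply Rabs_def1; nra.
Qed.

Lemma lyapunov_close_lt (L : R2 -> R2) (Q : R2 -> R) (kappa c C r : R) :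
  lyapunov L Q kappa c C -> 0 < r ->
  exists del, 0 < del /\ forall h, Rabs (fst h) < del -> Rabs (snd h) < del -> Q h < r.
Proof.
intros [_ [_ [hC [_ [_ hQ]]]]] hr.
exists (Rmin 1 (r / (2 * C))).
assert (h0 : 0 < r / (2 * C)) by (apply Rdiv_lt_0_compat; lra).
split; [apply Rmin_glb_lt; lra|]; intros h h1 h2.
set (d := Rmin 1 (r / (2 * C))) in *.
assert (hd1 : d <= 1) by apply Rmin_l.
assert (hd2 : d <= r / (2 * C)) by apply Rmin_r.
assert (hsq : forall a, Rabs a < d -> a ^ 2 < d).
{ intros a ha; rewrite <- pow2_abs; generalize (Rabs_pos a); intros; nra. }
apply hsq in h1; apply hsq in h2.
eapply Rle_lt_trans; [apply hQ|].
apply Rlt_le_trans with (C * (2 * d)).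
- apply Rmult_lt_compat_l; [exact hC|unfold sq2; lra].
- apply Rle_trans with (C * (2 * (r / (2 * C)))).
  + apply Rmult_le_compat_l; lra.
  + right; field; lra.
Qed.

(** Sublevel sets of [Q] serve as neighbourhoods of [p], because [f] need not
    contract distances; the last two clauses compare them with balls. *)
Definition basin (f : R2 -> R2) (p : R2) (Q : R2 -> R) (r kappa c : R) : Prop :=
  contracts f p Q r kappa /\ 0 < c /\
  (forall q, Q (sub2 q p) < r -> posq q) /\
  (forall h, 0 <= Q h) /\
  (forall eps h, 0 < eps -> Q h < c * eps ^ 2 ->
     Rabs (fst h) < eps /\ Rabs (snd h) < eps) /\
  (forall rho, 0 < rho -> exists del, 0 < del /\
     forall h, Rabs (fst h) < del -> Rabs (snd h) < del -> Q h < rho).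

Lemma basin_exists (t : R) : PI < t < tg ->
  exists Q r kappa c, basin (half_return (eta mu t)) (p0 mu t) Q r kappa c.
Proof.
intros ht.
destruct (contraction_exists t ht)
  as [Q [r [kap [c [C [hQ [kappa [hk [hr hcon]]]]]]]]].
assert (hc : 0 < c) by apply hQ.
destruct (p0_posq t ht) as [hx hy].
set (eps := Rmin (fst (p0 mu t)) (snd (p0 mu t))).
assert (heps : 0 < eps) by now apply Rmin_glb_lt.
exists Q, (Rmin r (c * eps ^ 2)), kappa, c.
split; [split; [exact hk|split]|split; [exact hc|split; [|split; [|split]]]].
- apply Rmin_glb_lt; [exact hr|]; apply Rmult_lt_0_compat; [exact hc|now apply pow_lt].
- intros q hq; apply hcon; eapply Rlt_le_trans; [exact hq|apply Rmin_l].
- intros q hq.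
  destruct (lyapunov_lt_close _ _ _ _ _ eps (sub2 q (p0 mu t)) hQ heps) as [h1 h2].
  { eapply Rlt_le_trans; [exact hq|apply Rmin_r]. }
  unfold sub2 in h1, h2; simpl fst in h1; simpl snd in h2.
  apply Rabs_lt_between' in h1; apply Rabs_lt_between' in h2.
  assert (e1 : eps <= fst (p0 mu t)) by apply Rmin_l.
  assert (e2 : eps <= snd (p0 mu t)) by apply Rmin_r.
  simpl in e1, e2; split; lra.
- intros h; destruct hQ as [_ [_ [_ [_ [_ hQ]]]]].
  eapply Rle_trans; [|apply hQ]; apply Rmult_le_pos; [lra|].
  unfold sq2; generalize (pow2_ge_0 (fst h)) (pow2_ge_0 (snd h)); lra.
- intros e h he hlt; exact (lyapunov_lt_close _ _ _ _ _ e h hQ he hlt).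
- intros rho hrho; exact (lyapunov_close_lt _ _ _ _ _ rho hQ hrho).
Qed.

Lemma basin_step (f : R2 -> R2) (p : R2) (Q : R2 -> R) (r kappa c rho : R) (q : R2) :
  basin f p Q r kappa c -> rho <= r -> Q (sub2 q p) < rho ->
  Q (sub2 (f q) p) < rho.
Proof.
intros [[hk [hr hcon]] [_ [_ [hQ _]]]] hrho hq.
specialize (hcon q ltac:(lra)); assert (h0 := hQ (sub2 q p)).
assert (kappa * Q (sub2 q p) <= 1 * Q (sub2 q p))
  by (apply Rmult_le_compat_r; lra); lra.
Qed.

Lemma basin_iter (f : R2 -> R2) (p : R2) (Q : R2 -> R) (r kappa c : R) (q : R2) (n : nat) :
  basin f p Q r kappa c -> Q (sub2 q p) < r ->
  Q (sub2 (Nat.iter n f q) p) < r /\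
  Q (sub2 (Nat.iter n f q) p) <= kappa ^ n * r.
Proof.
intros hb hq; induction n as [|n [IH1 IH2]]; [simpl; lra|].
simpl Nat.iter; split; [now apply (basin_step f p Q r kappa c)|].
destruct hb as [[hk [hr hcon]] _].
eapply Rle_trans; [now apply hcon|].
simpl; rewrite Rmult_assoc; apply Rmult_le_compat_l; lra.
Qed.

Lemma basin_forever (H : R) (p : R2) (Q : R2 -> R) (r kappa c : R) (q : R2) :
  basin (half_return H) p Q r kappa c -> Q (sub2 q p) < r -> forever H q.
Proof.
intros hb hq n; destruct (basin_iter _ _ _ _ _ _ q n hb hq) as [h _].
destruct hb as [_ [_ [hpos _]]]; now apply hpos.
Qed.

Lemma locally_basin (f : R2 -> R2) (p : R2) (Q : R2 -> R) (r kappa c : R) :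
  basin f p Q r kappa c ->
  locally (T := prod_UniformSpace R_UniformSpace R_UniformSpace) p
    (fun q => Q (sub2 q p) < r).
Proof.
intros [[_ [hr _]] [_ [_ [_ [_ hd]]]]].
destruct (hd r hr) as [d [hd0 h]]; exists (mkposreal d hd0).
intros q [h1 h2]; now apply h.
Qed.

(** ** Floquet multipliers *)

Lemma is_differential_ext (f g : R2 -> R2) (p : R2) (L : R2 -> R2) :
  locally (T := prod_UniformSpace R_UniformSpace R_UniformSpace) p (fun q => f q = g q) ->
  is_differential f p L -> is_differential g p L.
Proof. intros h1 h2; exact (filterdiff_ext_locally f g p L h1 h2). Qed.

Lemma is_differential_comp (f g : R2 -> R2) (p : R2) (L M : R2 -> R2) :
  is_differential f p L -> is_differential g (f p) M ->
  is_differential (fun q => g (f q)) p (fun h => M (L h)).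
Proof. intros h1 h2; exact (filterdiff_comp' f g p L M h1 h2). Qed.

Lemma S_Sigma_differential (p : R2) : is_differential S_Sigma p S_Sigma.
Proof.
apply (filterdiff_linear (F := locally (T := prod_UniformSpace R_UniformSpace R_UniformSpace) p)
  (U := prod_NormedModule R_AbsRing R_NormedModule R_NormedModule)
  (V := prod_NormedModule R_AbsRing R_NormedModule R_NormedModule) S_Sigma).
constructor.
- intros [a b] [a' b']; apply injective_projections;
    [change (- (b + b') = - b + - b')|change (- (a + a') = - a + - a')]; ring.
- intros k [a b]; apply injective_projections;
    [change (- (k * b) = k * - b)|change (- (k * a) = k * - a)]; ring.
- exists 2; split; [lra|]; intros x.
  eapply Rle_trans; [apply prod_norm_le|].
  assert (h1 := prod_norm_fst x); assert (h2 := prod_norm_snd x).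
  assert (e1 := norm_opp (snd x)); assert (e2 := norm_opp (fst x)).
  apply Rle_trans with (norm (snd x) + norm (fst x)); [|lra].
  exact (Rplus_le_compat _ _ _ _ (Req_le _ _ e1) (Req_le _ _ e2)).
Qed.

Lemma F_differential (t : R) : PI < t < tg ->
  is_differential (F mu (eta mu t)) (p0 mu t)
    (companion (dphi t) (exp (- 2 * mu * t)) (trace_N (eta mu t) t)).
Proof.
intros ht; destruct (basin_exists t ht) as [Q [r [kappa [c hb]]]].
apply (is_differential_ext (half_return (eta mu t)));
  [|now apply half_return_differential].
generalize (locally_basin _ _ _ _ _ _ hb); apply filter_imp; intros q hq.
symmetry; apply (F_half_return).
destruct hb as [_ [_ [hpos _]]]; now apply hpos.
Qed.

Lemma poincare_differential (t : R) : PI < t < tg ->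
  let N := companion (dphi t) (exp (- 2 * mu * t)) (trace_N (eta mu t) t) in
  is_differential (poincare_map mu (eta mu t)) (p0 mu t) (fun h => N (N h)) /\
  is_differential (poincare_map mu (eta mu t)) (S_Sigma (p0 mu t))
    (fun h => S_Sigma (N (N (S_Sigma h)))).
Proof.
intros ht N; destruct (basin_exists t ht) as [Q [r [kappa [c hb]]]].
assert (hN := half_return_differential (eta mu t) t ht); fold N in hN.
assert (hfix := proj2 (p0_fixed_iff (eta mu t) t ht) eq_refl).
set (f := half_return (eta mu t)) in *.
assert (hN2 : is_differential (fun q => f (f q)) (p0 mu t) (fun h => N (N h))).
{ apply is_differential_comp; [exact hN|now rewrite hfix]. }
split.
- apply (is_differential_ext (fun q => f (f q))); [|exact hN2].
  generalize (locally_basin _ _ _ _ _ _ hb); apply filter_imp; intros q hq.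
  symmetry; apply poincare_map_eq; now apply (basin_forever _ _ Q r kappa c q hb).
- apply (is_differential_ext (fun q => S_Sigma (f (f (S_Sigma q))))).
  + destruct (locally_basin _ _ _ _ _ _ hb) as [d hd]; exists d.
    intros q [h1 h2]; symmetry; apply poincare_map_S_eq.
    apply (basin_forever _ _ Q r kappa c _ hb), hd.
    unfold S_Sigma in *; simpl in *; split.
    * change (Rabs (- snd q - x0 mu t) < d); change (Rabs (snd q - - x0 mu t) < d) in h2.
      rewrite <- Rabs_Ropp; replace (- (- snd q - x0 mu t)) with (snd q - - x0 mu t) by ring.
      exact h2.
    * change (Rabs (- fst q - y0 mu t) < d); change (Rabs (fst q - - y0 mu t) < d) in h1.
      rewrite <- Rabs_Ropp; replace (- (- fst q - y0 mu t)) with (fst q - - y0 mu t) by ring.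
      exact h1.
  + apply (is_differential_comp (fun q => f (f (S_Sigma q))) S_Sigma _
      (fun h => N (N (S_Sigma h))) S_Sigma); [|apply S_Sigma_differential].
    apply (is_differential_comp S_Sigma (fun q => f (f q)) _ S_Sigma (fun h => N (N h))).
    * apply S_Sigma_differential.
    * now rewrite S_Sigma_invol.
Qed.

Lemma orbit_floquet (t : R) (g : R -> R3) (l1 l2 : C) : PI < t < tg ->
  (forall s, traj_at mu (eta mu t) (fun _ => True) g s) -> g 0 = emb (p0 mu t) ->
  charpoly_roots
    (companion (dphi t) (exp (- 2 * mu * t)) (trace_N (eta mu t) t)) l1 l2 ->
  floquet_multipliers mu (eta mu t) (orbit g) (l1 ^ 2)%C (l2 ^ 2)%C /\
  Cmod (l1 ^ 2)%C < 1 /\ Cmod (l2 ^ 2)%C < 1.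
Proof.
intros ht hg g0 hl.
set (H := eta mu t) in *; set (q := p0 mu t) in *.
assert (hq : posq q) by now apply (p0_posq).
assert (hfix : half_return H q = q) by now apply (p0_fixed_iff).
split; [split|].
- now apply (orbit_simple H q).
- intros p hp.
  destruct (poincare_differential t ht) as [d1 d2].
  assert (hroots := charpoly_roots_square _ _ _ _ _ hl).
  assert (hpq : emb p = emb q \/ emb p = Sinv (emb q)).
  { apply (orbit_Sigma H q g hq hfix hg g0); split;
      [exact hp|apply emb_coords]. }
  destruct hpq as [e|e].
  + apply emb_inj in e; subst p.
    eexists; split; [exact d1|exact hroots].
  + rewrite Sinv_emb in e; apply emb_inj in e; subst p.
    eexists; split; [exact d2|].
    intros z; rewrite <- hroots; apply charpoly_trace_det;
      unfold H, S_Sigma, companion; simpl; ring.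
- destruct (jury_conditions t ht) as [_ [hD hT]].
  apply charpoly_roots_companion in hl; destruct hl as [hs hp]; unfold H in hs.
  assert (m1 := jury_disc _ _ _ _ hD hT hs hp).
  assert (m2 : Cmod l2 < 1).
  { apply (jury_disc _ _ l2 l1 hD hT).
    - rewrite <- hs; ring.
    - rewrite <- hp; ring. }
  assert (hsq : forall l : C, Cmod l < 1 -> Cmod (l ^ 2)%C < 1).
  { intros l hl1; simpl; rewrite !Cmod_mult, Cmod_1, Rmult_1_r.
    assert (h0 := Cmod_ge_0 l); nra. }
  split; now apply hsq.
Qed.

(** * Stability *)

Section Stability.

Context (H : R) (q : R2) (g : R -> R3).

Notation fwd k := (Fwd k H).
Notation T := (tau (snd q)).
Notation arc := (flow mu H (emb q)).

Context (hq : posq q) (hfix : half_return H q = q).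
Context (hg : forall t, traj_at mu H (fun _ => True) g t) (g0 : g 0 = emb q).

Lemma arc_profile (e : R) : 0 < e ->
  exists th m, 0 < th <= 1 /\ 0 < m /\
    (forall s, Rabs s <= th -> close3 e (arc s) (emb q)) /\
    (forall s, Rabs (s - T) <= th -> close3 e (arc s) (Sinv (emb q))) /\
    (forall s, th <= s <= T - th -> m <= zc (arc s)).
Proof.
intros he; assert (hPI := PI2_1).
assert (hT := tau_pos _ (proj2 hq)).
destruct (flow_half_return H q (proj2 hq)) as [_ [hland harc]].
rewrite hfix in hland.
destruct (flow_continuous mu H (emb q) 0 e he) as [d1 [hd1 c1]].
destruct (flow_continuous mu H (emb q) T e he) as [d2 [hd2 c2]].
rewrite flow_0 in c1; rewrite hland in c2.
set (th := Rmin 1 (Rmin (d1 / 2) (d2 / 2))).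
assert (hth : 0 < th) by (repeat apply Rmin_glb_lt; lra).
assert (hth0 : th <= 1) by min_upper.
assert (hth1 : th <= d1 / 2) by min_upper.
assert (hth2 : th <= d2 / 2) by min_upper.
destruct (continuity_ab_min (fun s => zc (arc s)) th (T - th)) as [sm [hmin hsm]];
  [lra|intros s _; eapply continuity_pt_of_derive, is_derive_flow_zc|].
exists th, (zc (arc sm)); split; [lra|split; [apply harc; lra|split; [|split]]].
- intros s hs; apply c1; rewrite Rminus_0_r; lra.
- intros s hs; apply c2; lra.
- exact hmin.
Qed.

(** An upper arc issued from any point near the arc of the closed orbit lands
    near its end. Three stretches of time are compared: [z] increases near the
    start, is bounded below in the middle, and decreases through zero near the
    end; the starting point may be on any of them. *)
Lemma arc_lands_nearby (eps : R) : 0 < eps ->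
  exists del, 0 < del /\ forall p s0, up_start p -> 0 <= s0 <= T ->
    close3 del p (arc s0) ->
    exists sigma p', 0 < sigma /\
      (forall s, 0 < s < sigma -> 0 < zc (flow mu H p s)) /\
      flow mu H p sigma = Sinv (emb p') /\
      Rabs (fst p' - fst q) < eps /\ Rabs (snd p' - snd q) < eps /\
      forall s, 0 <= s <= sigma ->
        exists s', 0 <= s' <= T /\ close3 eps (flow mu H p s) (arc s').
Proof.
intros heps; assert (hPI := PI_RGT_0).
assert (hT := tau_pos _ (proj2 hq)).
destruct hq as [hx hy].
destruct (flow_half_return H q hy) as [_ [hland harc]].
rewrite hfix in hland.
destruct (emb_coords q) as [eq1 [eq2 eq3]].
set (e := Rmin (eps / 2) (Rmin (snd q / 2) (fst q / 2))).
assert (he : 0 < e) by (repeat apply Rmin_glb_lt; lra).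
assert (he1 : e <= eps / 2) by apply Rmin_l.
assert (he2 : e <= snd q / 2) by min_upper.
assert (he3 : e <= fst q / 2) by min_upper.
destruct (arc_profile e he) as [th [m [hth0 [hm [c1 [c2 hmin]]]]]].
assert (hth : 0 < th) by lra.
assert (hPI2 := PI2_1).
(* near the start the arc rises, near the end it falls *)
assert (hstart : forall s, Rabs s <= th -> snd q / 2 < yc (arc s)).
{ intros s hs; destruct (c1 s hs) as [_ [k _]].
  rewrite eq2 in k; apply Rabs_lt_between' in k; lra. }
assert (hend : forall s, Rabs (s - T) <= th ->
  yc (arc s) < - (fst q / 2) /\ close3 e (arc s) (Sinv (emb q))).
{ intros s hs; assert (k := c2 s hs); split; [|exact k].
  destruct k as [_ [k _]]; rewrite yc_S, eq1 in k.
  apply Rabs_lt_between' in k; lra. }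
assert (hafter : zc (arc (T + th)) < - (fst q / 2 * th)).
{ assert (h : zc (arc (T + th)) + fst q / 2 * (T + th) < zc (arc T) + fst q / 2 * T).
  { apply (derive_sign_decr (fun s => zc (arc s) + fst q / 2 * s)
      (fun s => yc (arc s) + fst q / 2)); [lra| |].
    - intros s; apply (is_derive_plus (fun s => zc (arc s)) (fun s => fst q / 2 * s));
        [apply is_derive_flow_zc|auto_derive; [trivial|ring]].
    - intros s hs; destruct (hend s) as [k _]; [rewrite Rabs_pos_eq; lra|lra]. }
  rewrite hland, zc_S, eq3 in h; lra. }
destruct (flow_lipschitz mu H (T + th) ltac:(lra)) as [C [hC hlip]].
set (b := Rmin (eps / 2) (Rmin (snd q / 2) (Rmin (fst q / 2) (Rmin m (fst q / 2 * th))))).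
assert (hfth : 0 < fst q / 2 * th) by (apply Rmult_lt_0_compat; lra).
assert (hb : 0 < b) by (repeat apply Rmin_glb_lt; lra).
assert (hb1 : b <= eps / 2) by min_upper.
assert (hb2 : b <= snd q / 2) by min_upper.
assert (hb3 : b <= fst q / 2) by min_upper.
assert (hb4 : b <= m) by min_upper.
assert (hb5 : b <= fst q / 2 * th) by min_upper.
exists (b / C); split; [now apply Rdiv_lt_0_compat|]; intros p s0 hp hs0 hclose.
assert (hfl : forall s, 0 <= s <= T + th - s0 -> close3 b (flow mu H p s) (arc (s0 + s))).
{ intros s hs; rewrite <- flow_add by lra.
  replace b with (C * (b / C)) by (field; lra); apply hlip; [lra|exact hclose]. }
set (Z := fun s => zc (flow mu H p s)).
assert (hZ : forall s, is_derive Z s (yc (flow mu H p s)))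
  by (intros s; apply is_derive_flow_zc).
assert (hZ0 : Z 0 = zc p) by (unfold Z; now rewrite flow_0).
assert (hp0 : 0 <= zc p) by (destruct hp as [k|[k _]]; lra).
assert (hearly : forall s, 0 < s -> s0 + s <= T - th -> 0 < Z s).
{ intros s hs hle; destruct (Rle_lt_dec (s0 + s) th) as [h|h].
  - assert (Z 0 < Z s); [|lra].
    apply (derive_sign_incr Z (fun s => yc (flow mu H p s))); [exact hs|exact hZ|].
    intros r hr; destruct (hfl r ltac:(lra)) as [_ [k _]].
    assert (k' := hstart (s0 + r) ltac:(rewrite Rabs_pos_eq; lra)).
    apply Rabs_lt_between' in k; lra.
  - destruct (hfl s ltac:(lra)) as [_ [_ k]].
    assert (k' := hmin (s0 + s) ltac:(lra)).
    apply Rabs_lt_between' in k; unfold Z; lra. }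
set (a0 := Rmax 0 (T - th - s0)).
assert (ha0 : 0 <= a0) by apply Rmax_l.
assert (ha1 : T - th - s0 <= a0) by apply Rmax_r.
assert (ha2 : a0 = 0 \/ (0 < a0 /\ a0 = T - th - s0)).
{ unfold a0, Rmax; destruct Rle_dec as [h|h]; [|now left].
  destruct h as [h|h]; [right; lra|left; lra]. }
assert (hfall : forall s, a0 <= s <= T + th - s0 -> yc (flow mu H p s) < 0).
{ intros s hs; destruct (hfl s ltac:(lra)) as [_ [k _]].
  destruct (hend (s0 + s)) as [k' _]; [apply Rabs_le; lra|].
  apply Rabs_lt_between' in k; lra. }
assert (hab : a0 < T + th - s0) by (destruct ha2 as [h|h]; lra).
assert (hZa : 0 < Z a0).
{ destruct ha2 as [h|[h1 h2]]; [|apply hearly; lra].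
  rewrite h, hZ0; destruct hp as [k|[k [_ k2]]]; [exact k|exfalso].
  assert (k3 := hfall a0 ltac:(lra)); rewrite h, flow_0 in k3; lra. }
assert (hZb : Z (T + th - s0) < 0).
{ destruct (hfl (T + th - s0) ltac:(lra)) as [_ [_ k]].
  replace (s0 + (T + th - s0)) with (T + th) in k by ring.
  apply Rabs_lt_between' in k; unfold Z; lra. }
destruct (Ranalysis5.IVT_interv (fun s => - Z s) a0 (T + th - s0)) as [sigma [hsig hzero]].
{ intros s _; apply (continuity_pt_opp Z); eapply continuity_pt_of_derive, hZ. }
{ exact hab. }
{ lra. }
{ lra. }
assert (hsig0 : a0 < sigma).
{ destruct (proj1 hsig) as [h|h]; [exact h|rewrite <- h in hzero; lra]. }
assert (hend' := hend (s0 + sigma) ltac:(apply Rabs_le; lra)).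
assert (hc := close3_trans _ _ _ _ _ (hfl sigma ltac:(lra)) (proj2 hend')).
assert (hS : Sigma (flow mu H p sigma)).
{ unfold Sigma; fold (Z sigma); lra. }
exists sigma, (S_Sigma (xc (flow mu H p sigma), yc (flow mu H p sigma))).
split; [lra|split; [|split; [|split; [|split]]]].
- intros s hs; fold (Z s); destruct (Rle_lt_dec s a0) as [h|h].
  + apply hearly; [lra|]; destruct ha2 as [k|k]; lra.
  + assert (Z sigma < Z s); [|lra].
    apply (derive_sign_decr Z (fun s => yc (flow mu H p s))); [lra|exact hZ|].
    intros r hr; apply hfall; lra.
- rewrite Sinv_emb, S_Sigma_invol; now apply Sigma_emb.
- destruct hc as [_ [k _]]; rewrite yc_S, eq1 in k.
  unfold S_Sigma; simpl fst; simpl snd.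
  replace (- yc (flow mu H p sigma) - fst q)
    with (- (yc (flow mu H p sigma) - - fst q)) by ring.
  rewrite Rabs_Ropp; lra.
- destruct hc as [k _]; rewrite xc_S, eq2 in k.
  unfold S_Sigma; simpl fst; simpl snd.
  replace (- xc (flow mu H p sigma) - snd q)
    with (- (xc (flow mu H p sigma) - - snd q)) by ring.
  rewrite Rabs_Ropp; lra.
- intros s hs; destruct (Rle_lt_dec (s0 + s) T) as [h|h].
  + exists (s0 + s); split; [lra|].
    apply (close3_mono b); [lra|apply hfl; lra].
  + exists T; split; [lra|].
    destruct (hend (s0 + s) ltac:(apply Rabs_le; lra)) as [_ k].
    apply (close3_mono (b + e)); [lra|].
    eapply close3_trans; [apply hfl; lra|rewrite hland; exact k].
Qed.

Notation gam := (orbit g).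

Lemma arc_in_orbit (s : R) : 0 <= s <= T -> gam (arc s).
Proof.
intros hs; exists s; now apply (orbit_arc H q g hq hfix hg g0).
Qed.

Lemma near_set_S (eps : R) (p : R3) : near_set gam eps p -> near_set gam eps (Sinv p).
Proof.
intros [r [hr hc]]; exists (Sinv r); split;
  [now apply (orbit_S H q)|now apply close3_S].
Qed.

Lemma near_set_S_inv (eps : R) (p : R3) : near_set gam eps (Sinv p) -> near_set gam eps p.
Proof. intros h; apply near_set_S in h; now rewrite Sinv_invol in h. Qed.

Lemma orbit_two_arcs (p : R3) : gam p ->
  exists s, 0 <= s <= T /\ (p = arc s \/ p = Sinv (arc s)).
Proof.
intros [s <-].
destruct (orbit_reduce H q g hq hfix hg g0 s) as [r [hr e]].
destruct (orbit_arc H q g hq hfix hg g0) as [harc _].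
rewrite (harc r ltac:(lra)) in e; exists r; split; [lra|exact e].
Qed.

(** Up to the symmetry, a point near the closed orbit starts an upper arc: if
    it is on the wrong side of the section, it is near one of the two crossing
    points, which the symmetry exchanges. *)
Lemma near_orbit_starts_arc (eps : R) : 0 < eps ->
  exists del, 0 < del /\ forall p, near_set gam del p ->
    exists p1 s0, (p1 = p \/ p1 = Sinv p) /\ up_start p1 /\ 0 <= s0 <= T /\
      close3 eps p1 (arc s0).
Proof.
intros heps; assert (hPI2 := PI2_1).
assert (hT := tau_pos _ (proj2 hq)).
destruct hq as [hx hy].
destruct (flow_half_return H q hy) as [_ [hland harc]].
rewrite hfix in hland.
destruct (emb_coords q) as [eq1 [eq2 eq3]].
set (e := Rmin (eps / 2) (Rmin (fst q / 2) (snd q / 2))).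
assert (he : 0 < e) by (repeat apply Rmin_glb_lt; lra).
assert (he1 : e <= eps / 2) by apply Rmin_l.
assert (he2 : e <= fst q / 2) by min_upper.
assert (he3 : e <= snd q / 2) by min_upper.
destruct (arc_profile e he) as [th [m [hth0 [hm [c1 [c2 hmin]]]]]].
set (del := Rmin e m).
assert (hdel1 : del <= e) by apply Rmin_l; assert (hdel2 : del <= m) by apply Rmin_r.
assert (hdel : 0 < del) by now apply Rmin_glb_lt.
(* near the upper arc but not above the section: near a crossing point *)
assert (hlow : forall p s, 0 <= s <= T -> close3 del p (arc s) -> zc p <= 0 ->
  close3 (e + e) p (emb q) \/ close3 (e + e) p (Sinv (emb q))).
{ intros p s hs hc hz.
  assert (hc' : close3 e p (arc s)) by now apply (close3_mono del).
  destruct (Rlt_le_dec s th) as [h|h].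
  - left; eapply close3_trans; [exact hc'|apply c1]; rewrite Rabs_pos_eq; lra.
  - destruct (Rlt_le_dec (T - th) s) as [h'|h'].
    + right; eapply close3_trans; [exact hc'|apply c2]; rewrite Rabs_left1; lra.
    + exfalso; destruct hc as [_ [_ k]]; assert (k' := hmin s ltac:(lra)).
      apply Rabs_lt_between' in k; lra. }
assert (hcase : forall p s, 0 <= s <= T -> close3 del p (arc s) ->
  exists p1 s0, (p1 = p \/ p1 = Sinv p) /\ up_start p1 /\ 0 <= s0 <= T /\
      close3 eps p1 (arc s0)).
{ intros p s hs hc.
  destruct (Rlt_le_dec 0 (zc p)) as [hz|hz].
  - exists p, s; split; [now left|split; [now left|split; [exact hs|]]].
    apply (close3_mono del); [lra|exact hc].
  - destruct (hlow p s hs hc hz) as [k|k].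
    + destruct hz as [hz|hz].
      * exists (Sinv p), T; split; [now right|split; [|split; [lra|]]].
        { left; rewrite zc_S; lra. }
        rewrite hland; apply (close3_mono (e + e)); [lra|now apply close3_S].
      * exists p, 0; split; [now left|split; [|split; [lra|]]].
        { right; destruct k as [k1 [k2 _]]; rewrite eq1 in k1; rewrite eq2 in k2.
          apply Rabs_lt_between' in k1; apply Rabs_lt_between' in k2; lra. }
        rewrite flow_0; apply (close3_mono (e + e)); [lra|exact k].
    + apply close3_S in k; rewrite Sinv_invol in k.
      exists (Sinv p), 0; split; [now right|split; [|split; [lra|]]].
      * destruct hz as [hz|hz]; [left; rewrite zc_S; lra|right].
        destruct k as [k1 [k2 _]]; rewrite eq1 in k1; rewrite eq2 in k2.
        apply Rabs_lt_between' in k1; apply Rabs_lt_between' in k2.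
        rewrite zc_S; lra.
      * rewrite flow_0; apply (close3_mono (e + e)); [lra|exact k]. }
exists del; split; [exact hdel|]; intros p [r [hr hc]].
destruct (orbit_two_arcs r hr) as [s [hs [-> | ->]]].
- exact (hcase p s hs hc).
- apply close3_S in hc; rewrite Sinv_invol in hc.
  destruct (hcase (Sinv p) s hs hc) as [p1 [s0 [h1 h2]]].
  exists p1, s0; split; [|exact h2].
  rewrite Sinv_invol in h1; tauto.
Qed.

Context (Q : R2 -> R) (r kappa c : R) (hb : basin (half_return H) q Q r kappa c).

(** Induction on the half turns: the sublevel set is mapped into itself, and each
    arc that starts in it stays near the orbit. *)
Lemma stable_section (eps : R) : 0 < eps ->
  exists rho, 0 < rho <= r /\ forall q' k, Q (sub2 q' q) < rho -> fwd k ->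
    k 0 = emb q' -> forall t, 0 <= t -> near_set gam eps (k t).
Proof.
intros heps; assert (hPI := PI_RGT_0).
destruct (arc_lands_nearby eps heps) as [del [hdel harc]].
destruct hb as [[hk [hr hcon]] [hc [hpos [hQ [hQlow hQup]]]]].
assert (hcd : 0 < c * del ^ 2)
  by (apply Rmult_lt_0_compat; [exact hc|now apply pow_lt]).
set (rho := Rmin r (c * del ^ 2)).
assert (hrho : 0 < rho) by now apply Rmin_glb_lt.
assert (hrho1 : rho <= r) by apply Rmin_l.
assert (hrho2 : rho <= c * del ^ 2) by apply Rmin_r.
exists rho; split; [lra|].
assert (hind : forall n q' k, Q (sub2 q' q) < rho -> fwd k -> k 0 = emb q' ->
  forall t, 0 <= t <= INR n * PI -> near_set gam eps (k t)).
{ assert (harc' : forall q' k, Q (sub2 q' q) < rho -> fwd k -> k 0 = emb q' ->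
    forall t, 0 <= t <= tau (snd q') -> near_set gam eps (k t)).
  { intros q' k hq' hkf k0 t ht.
    assert (hp' := hpos q' ltac:(lra)).
    destruct (hQlow del (sub2 q' q) hdel ltac:(lra)) as [l1 l2].
    destruct (harc (emb q') 0 (posq_up q' hp')) as [sig [p' [s1 [s2 [s3 [_ [_ s4]]]]]]].
    - assert (hT := tau_pos _ (proj2 hq)); lra.
    - rewrite flow_0; unfold close3.
      destruct (emb_coords q) as [-> [-> ->]]; destruct (emb_coords q') as [-> [-> ->]].
      rewrite Rminus_diag, Rabs_R0; split; [exact l1|split; [exact l2|exact hdel]].
    - assert (esig : sig = tau (snd q')).
      { apply (first_zero_tau H); [apply hp'|exact s1|exact s2|].
        rewrite s3, zc_S; destruct (emb_coords p') as [_ [_ ->]]; ring. }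
      destruct (forward_step H k q' hkf k0 hp') as [f1 _].
      rewrite f1 by lra.
      destruct (s4 t ltac:(lra)) as [s' [hs' hclose]].
      exists (arc s'); split; [now apply arc_in_orbit|exact hclose]. }
  induction n as [|n IH]; intros q' k hq' hkf k0 t ht.
  - apply (harc' q' k hq' hkf k0).
    assert (hT := tau_pos _ (proj2 (hpos q' ltac:(lra)))).
    simpl in ht; lra.
  - assert (hp' := hpos q' ltac:(lra)).
    assert (hT := tau_pos _ (proj2 hp')).
    destruct (Rle_lt_dec t (tau (snd q'))) as [h|h];
      [apply (harc' q' k hq' hkf k0); lra|].
    destruct (forward_step H k q' hkf k0 hp') as [_ [_ [f2 f3]]].
    rewrite S_INR in ht.
    assert (hstep := basin_step _ _ _ _ _ _ rho q' hb hrho1 hq').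
    assert (h' := IH _ _ hstep f2 f3 (t - tau (snd q')) ltac:(lra)).
    cbv beta in h'; replace (t - tau (snd q') + tau (snd q')) with t in h' by ring.
    now apply near_set_S_inv. }
intros q' k hq' hkf k0 t ht.
apply (hind (nat_above t) q' k hq' hkf k0).
generalize (nat_above_spec t) (pos_INR (nat_above t)) PI2_1; intros; nra.
Qed.

Lemma section_attracts (q' : R2) (k : R -> R3) (eps : R) : 0 < eps ->
  Q (sub2 q' q) < r -> fwd k -> k 0 = emb q' ->
  exists t0, 0 <= t0 /\ forall t, t0 <= t -> near_set gam eps (k t).
Proof.
intros heps hq' hkf k0.
destruct (stable_section eps heps) as [rho [hrho hst]].
assert (hk1 : 0 < kappa < 1 /\ 0 < r) by (destruct hb as [[? [? _]] _]; auto).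
assert (hn : exists n, kappa ^ n * r < rho).
{ destruct (pow_lt_1_zero kappa ltac:(rewrite Rabs_pos_eq; lra) (rho / r)) as [n hn];
    [apply Rdiv_lt_0_compat; lra|].
  exists n; specialize (hn n (le_n n)).
  rewrite Rabs_pos_eq in hn by (apply pow_le; lra).
  apply Rmult_lt_reg_r with (/ r); [apply Rinv_0_lt_compat; lra|].
  rewrite Rmult_assoc, Rinv_r by lra; unfold Rdiv in hn; lra. }
destruct hn as [n hn].
assert (hlast : Q (sub2 (Nat.iter n (half_return H) q') q) < rho).
{ eapply Rle_lt_trans; [exact (proj2 (basin_iter _ _ _ _ _ _ q' n hb hq'))|exact hn]. }
clear hn; revert q' k hq' hkf k0 hlast.
induction n as [|n IH]; intros q' k hq' hkf k0 hlast.
- exists 0; split; [lra|]; intros t ht; now apply (hst q' k).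
- assert (hp' : posq q') by (destruct hb as [_ [_ [hpos _]]]; now apply hpos).
  assert (hT := tau_pos _ (proj2 hp')); assert (hPI := PI_RGT_0).
  destruct (forward_step H k q' hkf k0 hp') as [_ [_ [f2 f3]]].
  rewrite Nat.iter_succ_r in hlast.
  destruct (IH _ _ (basin_step _ _ _ _ _ _ r q' hb ltac:(lra) hq') f2 f3 hlast)
    as [t0 [h0 ht0]].
  exists (t0 + tau (snd q')); split; [lra|]; intros t ht.
  apply near_set_S_inv; specialize (ht0 (t - tau (snd q')) ltac:(lra)).
  cbv beta in ht0; now replace (t - tau (snd q') + tau (snd q')) with t in ht0 by ring.
Qed.

(** Reduces stability in space to stability on the section: what starts near the
    orbit stays near it until it lands in a given sublevel set. *)
Lemma first_landing (eps rho : R) : 0 < eps -> 0 < rho ->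
  exists del, 0 < del /\ forall p, near_set gam del p ->
    exists p1 sigma p', (p1 = p \/ p1 = Sinv p) /\ up_start p1 /\ 0 < sigma /\
      (forall s, 0 < s < sigma -> 0 < zc (flow mu H p1 s)) /\
      flow mu H p1 sigma = Sinv (emb p') /\ Q (sub2 p' q) < rho /\
      forall s, 0 <= s <= sigma -> near_set gam eps (flow mu H p1 s).
Proof.
intros heps hrho.
destruct hb as [_ [_ [_ [_ [_ hQup]]]]].
destruct (hQup rho hrho) as [d [hd hQd]].
destruct (arc_lands_nearby (Rmin eps d) ltac:(now apply Rmin_glb_lt)) as [d1 [hd1 harc]].
destruct (near_orbit_starts_arc d1 hd1) as [del [hdel hup]].
exists del; split; [exact hdel|]; intros p hp.
destruct (hup p hp) as [p1 [s0 [h1 [h2 [h3 h4]]]]].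
destruct (harc p1 s0 h2 h3 h4) as [sig [p' [k1 [k2 [k3 [k4 [k5 k6]]]]]]].
exists p1, sig, p'; repeat (split; [assumption|]).
split.
- apply hQd; unfold sub2; simpl fst; simpl snd.
  + eapply Rlt_le_trans; [exact k4|apply Rmin_r].
  + eapply Rlt_le_trans; [exact k5|apply Rmin_r].
- intros s hs; destruct (k6 s hs) as [s' [hs' hc]].
  exists (arc s'); split; [now apply arc_in_orbit|].
  apply (close3_mono (Rmin eps d)); [apply Rmin_l|exact hc].
Qed.

Lemma after_landing (k : R -> R3) (p1 : R3) (sigma : R) (p' : R2) :
  fwd k -> k 0 = p1 -> up_start p1 -> 0 < sigma ->
  (forall s, 0 < s < sigma -> 0 < zc (flow mu H p1 s)) ->
  flow mu H p1 sigma = Sinv (emb p') ->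
  (forall t, 0 <= t <= sigma -> k t = flow mu H p1 t) /\
  fwd (fun s => Sinv (k (s + sigma))) /\ Sinv (k (0 + sigma)) = emb p'.
Proof.
intros hk k0 hup hs hpos hland.
assert (hf : forall t, 0 <= t <= sigma -> k t = flow mu H p1 t).
{ rewrite <- k0; apply (follow_flow mu H sigma (fun s => 0 <= s));
    rewrite ?k0; auto; try lra; intros; lra. }
split; [exact hf|split].
- intros t ht; apply (traj_at_mono mu H (fun s => 0 <= s + sigma)); [lra|intros; lra|].
  apply (traj_at_S_shift mu H _ (fun s => 0 <= s)); [exact hk|lra].
- rewrite Rplus_0_l, hf, hland by lra; apply Sinv_invol.
Qed.

Lemma forward_iff (k : R -> R3) : forward_trajectory mu H k <-> fwd k.
Proof. apply crossing_trajectory_iff. Qed.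

Lemma Fwd_S (k : R -> R3) : fwd k -> fwd (fun s => Sinv (k s)).
Proof. intros h t ht; now apply traj_at_S, h. Qed.

Lemma orbit_stable : orbitally_stable mu H gam.
Proof.
intros eps heps.
destruct (stable_section eps heps) as [rho [hrho hst]].
destruct (first_landing eps rho heps (proj1 hrho)) as [del [hdel hentry]].
exists del; split; [exact hdel|]; intros p hp.
destruct (hentry p hp) as [p1 [sig [p' [h1 [h2 [h3 [h4 [h5 [h6 h7]]]]]]]]].
assert (hex : exists k, fwd k /\ k 0 = p1).
{ assert (hfor := basin_forever H q Q r kappa c p' hb ltac:(lra)).
  destruct (forward_exists H p' hfor) as [k [hk k0]].
  exists (glue sig (flow mu H p1) k); split.
  - intros t ht; apply (glue_traj mu H sig (t + 1) p1 p' k); auto; try lra.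
    + exact (hfor 0%nat).
    + intros s hs; apply hk; lra.
  - rewrite glue_left by lra; apply flow_0. }
assert (hnear : forall k, fwd k -> k 0 = p1 -> forall t, 0 <= t -> near_set gam eps (k t)).
{ intros k hk k0 t ht.
  destruct (after_landing k p1 sig p' hk k0 h2 h3 h4 h5) as [a1 [a2 a3]].
  destruct (Rle_lt_dec t sig) as [h|h]; [rewrite a1 by lra; apply h7; lra|].
  apply near_set_S_inv; assert (a4 := hst p' _ h6 a2 a3 (t - sig) ltac:(lra)).
  cbv beta in a4; now replace (t - sig + sig) with t in a4 by ring. }
split.
- destruct hex as [k [hk k0]]; destruct h1 as [-> | ->].
  + exists k; split; [now apply forward_iff|exact k0].
  + exists (fun s => Sinv (k s)); split; [now apply forward_iff, Fwd_S|].
    now rewrite k0, Sinv_invol.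
- intros k hk k0 t ht; assert (hk' := proj1 (forward_iff k) hk); clear hk; rename hk' into hk; destruct h1 as [-> | ->].
  + now apply hnear.
  + apply near_set_S_inv, (hnear (fun s => Sinv (k s))); auto using Fwd_S.
    now rewrite k0.
Qed.

Lemma orbit_attracting : orbitally_attracting mu H gam.
Proof.
assert (hr : 0 < r) by (destruct hb as [[_ [? _]] _]; auto).
destruct (first_landing 1 r ltac:(lra) hr) as [del [hdel hentry]].
exists del; split; [exact hdel|]; intros p hp k hk k0 eps heps.
assert (hk' := proj1 (forward_iff k) hk); clear hk; rename hk' into hk.
destruct (hentry p hp) as [p1 [sig [p' [h1 [h2 [h3 [h4 [h5 [h6 _]]]]]]]]].
assert (hatt : forall k, fwd k -> k 0 = p1 ->
  exists t0, forall t, t0 <= t -> 0 <= t -> near_set gam eps (k t)).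
{ clear k hk k0; intros k hk k0.
  destruct (after_landing k p1 sig p' hk k0 h2 h3 h4 h5) as [a1 [a2 a3]].
  destruct (section_attracts p' _ eps heps h6 a2 a3) as [t0 [ht0 ha]].
  exists (t0 + sig); intros t ht _; apply near_set_S_inv.
  specialize (ha (t - sig) ltac:(lra)); cbv beta in ha.
  now replace (t - sig + sig) with t in ha by ring. }
destruct h1 as [-> | ->]; [now apply hatt|].
destruct (hatt (fun s => Sinv (k s)) (Fwd_S k hk) ltac:(cbv beta; now rewrite k0)) as [t0 h].
exists t0; intros t h1 h2'; apply near_set_S_inv; now apply h.
Qed.

Lemma arc_distance_min (p : R3) :
  (exists s, 0 <= s <= T /\ p = arc s) \/
  (exists eps, 0 < eps /\ forall s, 0 <= s <= T -> ~ close3 eps p (arc s)).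
Proof.
assert (hT := tau_pos _ (proj2 hq)); assert (hPI := PI_RGT_0).
set (d := fun s => (xc p - flow_x mu H (emb q) s) ^ 2
  + (yc p - flow_y mu (emb q) s) ^ 2 + (zc p - flow_z mu (emb q) s) ^ 2).
destruct (continuity_ab_min d 0 T) as [sm [hmin hsm]]; [lra| |].
- intros s _; eapply continuity_pt_of_derive; unfold d; auto_derive; [|reflexivity].
  repeat split; eexists;
    [apply is_derive_flow_x|apply is_derive_flow_y|apply is_derive_flow_z].
- destruct (Rle_lt_dec (d sm) 0) as [h|h].
  + left; exists sm; split; [lra|].
    unfold d in h.
    generalize (pow2_ge_0 (xc p - flow_x mu H (emb q) sm))
      (pow2_ge_0 (yc p - flow_y mu (emb q) sm)) (pow2_ge_0 (zc p - flow_z mu (emb q) sm)).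
    intros p1 p2 p3.
    assert (k : forall a b : R, (a - b) ^ 2 <= 0 -> a = b) by (intros; nra).
    apply R3_eq; apply k;
      [change (xc (arc sm)) with (flow_x mu H (emb q) sm)
      |change (yc (arc sm)) with (flow_y mu (emb q) sm)
      |change (zc (arc sm)) with (flow_z mu (emb q) sm)]; lra.
  + right; exists (Rmin 1 (d sm / 3)).
    assert (he : 0 < Rmin 1 (d sm / 3)) by (apply Rmin_glb_lt; lra).
    split; [exact he|]; intros s hs [k1 [k2 k3]].
    set (e := Rmin 1 (d sm / 3)) in *.
    assert (he1 : e <= 1) by apply Rmin_l.
    assert (he2 : e <= d sm / 3) by apply Rmin_r.
    assert (k : forall a, Rabs a < e -> a ^ 2 < e).
    { intros a ha; rewrite <- pow2_abs; generalize (Rabs_pos a); intros; nra. }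
    apply k in k1; apply k in k2; apply k in k3.
    specialize (hmin s hs); unfold d at 2 in hmin.
    change (xc (arc s)) with (flow_x mu H (emb q) s) in k1.
    change (yc (arc s)) with (flow_y mu (emb q) s) in k2.
    change (zc (arc s)) with (flow_z mu (emb q) s) in k3.
    lra.
Qed.

(** Compactness of the two arcs: the distance to each of them is attained. *)
Lemma orbit_closed (p : R3) : (forall eps, 0 < eps -> near_set gam eps p) -> gam p.
Proof.
intros h.
destruct (arc_distance_min p) as [[s [hs ->]]|[e1 [he1 h1]]];
  [now apply arc_in_orbit|].
destruct (arc_distance_min (Sinv p)) as [[s [hs e]]|[e2 [he2 h2]]].
{ rewrite <- (Sinv_invol p), e.
  apply (orbit_S H q g hq hfix hg g0); now apply arc_in_orbit. }
exfalso; destruct (h (Rmin e1 e2) ltac:(now apply Rmin_glb_lt)) as [p' [hp' hc]].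
destruct (orbit_two_arcs p' hp') as [s [hs [-> | ->]]].
- apply (h1 s hs); eapply close3_mono; [apply Rmin_l|exact hc].
- apply close3_S in hc; rewrite Sinv_invol in hc.
  apply (h2 s hs); eapply close3_mono; [apply Rmin_r|exact hc].
Qed.

(** A periodic orbit within the domain of attraction is in the closure of the
    orbit_attracting orbit. *)
Lemma orbit_isolated : isolated_periodic_orbit mu H gam.
Proof.
destruct orbit_attracting as [del [hdel hatt]].
exists del; split; [exact hdel|].
intros gam' [k [hk [_ [[P [hP hper]] hgam]]]] hnear.
assert (hk' := proj1 (crossing_trajectory_iff _ _ _ _) hk).
assert (hk'' : forall t, traj_at mu H (fun _ => True) k t) by (intros t; now apply hk').
assert (hpern : forall n, k (INR n * P) = k 0).
{ induction n as [|n IH]; [f_equal; simpl; ring|].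
  rewrite S_INR; replace ((INR n + 1) * P) with (INR n * P + P) by ring.
  now rewrite hper. }
assert (hin : gam (k 0)).
{ apply orbit_closed; intros eps heps.
  destruct (hatt (k 0) (hnear (k 0) (proj2 (hgam (k 0)) (ex_intro _ 0 eq_refl))) k)
    with (eps := eps) as [t0 ht0]; auto.
  - apply forward_iff; intros t ht.
    apply (traj_at_mono mu H (fun _ => True)); auto.
  - set (n := nat_above (t0 / P)).
    assert (hn : t0 < INR n * P).
    { replace t0 with (t0 / P * P) by (field; lra).
      apply Rmult_lt_compat_r; [exact hP|apply nat_above_spec]. }
    rewrite <- (hpern n); apply ht0; [lra|].
    apply Rmult_le_pos; [apply pos_INR|lra]. }
destruct hin as [c0 hc0].
intros p; rewrite (hgam p), (orbit_shift g c0 p).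
apply (same_set_orbit H k (fun s => g (s + c0)) hk'').
- now apply trajectory_shift.
- now rewrite Rplus_0_l.
Qed.

End Stability.

End ZeroDivergence.

Theorem theorem1 (mu : R) (hmu : 0 < mu) :
  (exists! tg, is_t_g mu tg) /\
  forall tg : R, is_t_g mu tg ->
  (* (a) *)
  ((forall t, PI < t < tg -> I_mu mu tg (eta mu t)) /\
   (forall s t, PI < s -> s < t -> t < tg -> eta mu t < eta mu s) /\
   (forall H, I_mu mu tg H -> exists t, PI < t < tg /\ eta mu t = H)) /\
  (forall t, PI < t < tg ->
     continuous (x0 mu) t /\ continuous (y0 mu) t /\
     forall H, (0 < H < 1 \/ 1 < H) -> Sigma_c mu H (emb (p0 mu t))) /\
  (forall H, (0 < H < 1 \/ 1 < H) -> forall t, PI < t < tg ->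
     ((exists g, trajectory mu H g /\ g 0 = emb (p0 mu t) /\
         simple_crossing_periodic_orbit mu H (orbit g))
      <-> H = eta mu t) /\
     (H = eta mu t ->
      forall g, trajectory mu H g -> g 0 = emb (p0 mu t) ->
        (exists tau, 0 < tau /\ g tau = Sinv (emb (p0 mu t)) /\
           forall s, 0 < s < tau -> ~ Sigma (g s)) /\
        least_period g (2 * t) /\
        forall gam, simple_crossing_periodic_orbit mu H gam <->
                    same_set gam (orbit g))) /\
  (forall H, (0 < H < 1 \/ 1 < H) -> ~ I_mu mu tg H ->
     ~ exists gam, simple_crossing_periodic_orbit mu H gam) /\
  (* (b) *)
  (forall H, I_mu mu tg H -> forall t, PI < t < tg -> eta mu t = H ->
     forall g, trajectory mu H g -> g 0 = emb (p0 mu t) ->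
     (exists N, is_differential (F mu H) (p0 mu t) N /\
        forall l1 l2 : C, charpoly_roots N l1 l2 ->
          floquet_multipliers mu H (orbit g) (l1 ^ 2)%C (l2 ^ 2)%C /\
          Cmod (l1 ^ 2)%C < 1 /\ Cmod (l2 ^ 2)%C < 1) /\
     isolated_periodic_orbit mu H (orbit g) /\
     hyperbolic mu H (orbit g) /\
     orbitally_asymptotically_stable mu H (orbit g)).
Proof.
split; [now apply t_g_exists_unique|].
intros tg htg.
assert (hT : forall g H, trajectory mu H g -> forall t, traj_at mu H (fun _ => True) g t).
{ intros g H h t; now apply (proj1 (crossing_trajectory_iff mu H _ g) h t). }
assert (hfix : forall t, PI < t < tg ->
  posq (p0 mu t) /\ half_return mu tg (eta mu t) (p0 mu t) = p0 mu t).
{ intros t ht; split; [now apply (p0_posq mu tg hmu htg)|].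
  now apply (p0_fixed_iff mu tg hmu htg). }
split; [|split; [|split; [|split]]].
- split; [|split].
  + intros t ht; now apply eta_in_I.
  + intros s t h1 h2 h3; now apply (eta_decr mu tg hmu htg).
  + intros H hH; now apply eta_surj.
- intros t ht; generalize (tg_bounds mu tg htg); intros hb.
  assert (hs := sin_neg_arc t ltac:(lra)).
  split; [|split].
  + apply (ex_derive_continuous (x0 mu)); eexists; apply is_derive_x0; lra.
  + apply (ex_derive_continuous (y0 mu)); eexists; apply is_derive_y0; lra.
  + intros H _; apply Sigma_c_iff.
    destruct (emb_coords (p0 mu t)) as [-> [-> ->]].
    destruct (p0_posq mu tg hmu htg t ht); split; [reflexivity|nra].
- intros H hH t ht; assert (hH0 : 0 < H) by lra.
  split; [split|].
  + intros [g [hg [g0 hsimple]]].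
    destruct (simple_orbit_fixed mu tg hmu htg H _ hH0 hsimple)
      as [k [q [hk [k0 [hq [hf hset]]]]]].
    assert (hgam : orbit g (emb (p0 mu t)) /\ Sigma (emb (p0 mu t))).
    { split; [now exists 0|apply emb_coords]. }
    rewrite (hset (emb (p0 mu t))) in hgam.
    apply (orbit_Sigma mu tg hmu htg H q k hq hf hk k0) in hgam.
    destruct hgam as [e|e].
    * apply emb_inj in e; subst q; now apply (p0_fixed_iff mu tg hmu htg).
    * rewrite Sinv_emb in e; apply emb_inj in e.
      destruct (posq_neq_S _ _ (p0_posq mu tg hmu htg t ht) hq e).
  + intros ->; destruct (hfix t ht) as [hq hf].
    destruct (fixed_trajectory_exists mu tg hmu htg _ _ hq hf) as [g [hg g0]].
    exists g; split; [apply crossing_trajectory_iff; auto|split; [exact g0|]].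
    now apply (orbit_simple mu tg hmu htg (eta mu t) (p0 mu t)).
  + intros -> g hg g0; destruct (hfix t ht) as [hq hf].
    assert (hg' := hT g _ hg).
    assert (htau : tau mu tg (snd (p0 mu t)) = t) by now apply tau_y0.
    destruct (orbit_arc mu tg hmu htg _ _ g hq hf hg' g0) as [_ [hl hpos]].
    rewrite htau in hl, hpos.
    split; [|split].
    * exists t; split; [generalize PI_RGT_0; lra|split; [exact hl|]].
      intros s hs hz; specialize (hpos s hs); unfold Sigma in hz; lra.
    * rewrite <- htau; now apply (orbit_least_period mu tg hmu htg (eta mu t) (p0 mu t)).
    * intros gam; split.
      -- intros hgam.
         destruct (simple_orbit_fixed mu tg hmu htg _ _ hH0 hgam)
           as [k [q [hk [k0 [hq' [hf' hset]]]]]].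
         destruct (fixed_is_p0 mu tg hmu htg _ q hq' hf') as [h1 [h2 h3]].
         apply (eta_inj mu tg hmu htg) in h3; [|exact ht|exact h1].
         rewrite <- h3 in h2; subst q.
         intros p; rewrite (hset p).
         apply (same_set_orbit mu _ k g hk hg'); congruence.
      -- intros hset; apply (simple_same_set mu _ _ _ hset).
         now apply (orbit_simple mu tg hmu htg (eta mu t) (p0 mu t)).
- intros H hH hnot [gam hgam]; apply hnot.
  destruct (simple_orbit_fixed mu tg hmu htg H gam ltac:(lra) hgam)
    as [k [q [_ [_ [hq [hf _]]]]]].
  destruct (fixed_is_p0 mu tg hmu htg H q hq hf) as [h1 [_ ->]].
  now apply eta_in_I.
- intros H hH t ht <- g hg g0; destruct (hfix t ht) as [hq hf].
  assert (hg' := hT g _ hg).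
  destruct (basin_exists mu tg hmu htg t ht) as [Q [r [kappa [c hb]]]].
  split; [|split; [|split; [|split]]].
  + eexists; split; [now apply (F_differential mu tg)|].
    intros l1 l2 hl; now apply (orbit_floquet mu tg hmu htg).
  + exact (orbit_isolated mu tg hmu htg _ _ g hq hf hg' g0 Q r kappa c hb).
  + destruct (real_quadratic_roots (dphi mu t * exp (- 2 * mu * t))
      (trace_N mu (eta mu t) t)) as [l1 [l2 hl]].
    apply charpoly_roots_companion in hl.
    destruct (orbit_floquet mu tg hmu htg t g l1 l2 ht hg' g0 hl) as [h1 [h2 h3]].
    exists (l1 ^ 2)%C, (l2 ^ 2)%C; split; [exact h1|split; lra].
  + exact (orbit_stable mu tg hmu htg _ _ g hq hf hg' g0 Q r kappa c hb).
  + exact (orbit_attracting mu tg hmu htg _ _ g hq hf hg' g0 Q r kappa c hb).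
Qed.
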